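(* Let $\mathcal J$ be a countable index set and let $(b^{(j)})_{j\in\mathcal J}$ be a family of real window functions $b^{(j)}:\mathbb N\to\mathbb R$, $\ell\mapsto b^{(j)}_\ell$, each with finite support. Assume that there exist positive constants $C_1,C_2$ such that $$\forall \ell\in\mathbb N,\qquad C_1\le\sum_{j\in\mathcal J}|b^{(j)}_\ell|^2\le C_2 .$$ Define the synthesis windows $\tilde b^{(j)}_\ell=b^{(j)}_\ell\big/\sum_{j'\in\mathcal J}(b^{(j')}_\ell)^2$ and $h^{(j)}_\ell=\tilde b^{(j)}_\ell b^{(j)}_\ell$ (so that the exact reconstruction condition $\sum_{j\in\mathcal J}h^{(j)}_\ell=1$ holds for all $\ell\in\mathbb N$), and let $d^{(j)}=\max\{\ell:h^{(j)}_\ell\ne0\}$. Assume that for every $j\in\mathcal J$ the finite set $\{(\xi_k^{(j)},\lambda_k^{(j)})\}_{k\in K^{(j)}}$ provides an exact and positive-weight quadrature formula at degree $2d^{(j)}$. Then the family of decomposition needlets $\{\psi^{(j)}_k\}_{j\in\mathcal J,k\in K^{(j)}}$ is a frame of $\mathbb H$ with frame bounds $C_1$ and $C_2$, and its dual frame is the family of reconstruction needlets $\{\tilde\psi^{(j)}_k\}_{j\in\mathcal J,k\in K^{(j)}}$. In particular, for every $X\in\mathbb H$, $$X=\sum_{j\in\mathcal J}\sum_{k\in K^{(j)}}\beta_k^{(j)}\tilde\psi_k^{(j)}\quad\text{(in }\mathbb H)\qquad\text{and}\qquad\|X\|^2=\sum_{j\in\mathcal J}\sum_{k\in K^{(j)}}\overline{\tilde\beta_k^{(j)}}\,\beta_k^{(j)},$$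 where $\beta_k^{(j)}=\langle X,\psi_k^{(j)}\rangle$ and $\tilde\beta_k^{(j)}=\langle X,\tilde\psi_k^{(j)}\rangle$.
   Context: $\mathbb S$ is the unit sphere in $\mathbb R^3$ with its surface measure $d\xi$ ($=\sin\theta\,d\theta\,d\varphi$), and $\xi\cdot\xi'$ is the dot product. $\mathbb N=\{0,1,2,\dots\}$. $\mathbb H=L^2(\mathbb S)$ is the Hilbert space of complex-valued square integrable functions on $\mathbb S$ with $\langle f,g\rangle=\int_{\mathbb S}f(\xi)\overline{g(\xi)}\,d\xi$ and norm $\|\cdot\|$. $(Y_{\ell m})_{\ell\ge0,-\ell\le m\le\ell}$ are the usual orthonormal complex spherical harmonics and $\mathbb H_\ell$ is the linear span of $Y_{\ell m}$, $-\ell\le m\le\ell$. $L_\ell(z)=\frac{2\ell+1}{4\pi}P_\ell(z)$, where $P_\ell$ is the Legendre polynomial of degree $\ell$ with $P_\ell(1)=1$. Quadrature: a finite family $\{(\xi_k,\lambda_k)\}_{k\in K}$ in $\mathbb S\times\mathbb R$ provides an exact (Gauss) quadrature formula at degree $\ell_{\max}$ if $\int_{\mathbb S}X(\xi)\,d\xi=\sum_{k\in K}\lambda_kX(\xi_k)$ for all $X\in\bigoplus_{\ell=0}^{\ell_{\max}}\mathbb H_\ell$; it is positive-weight if $\lambda_k>0$ for all $k\in K$. Needlets: the decomposition needlets are $\psi_k^{(j)}(\xi)=\sqrt{\lambda_k^{(j)}}\sum_{\ell=0}^{d^{(j)}}b^{(j)}_\ell L_\ell(\xi\cdot\xi^{(j)}_k)$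 and the reconstruction needlets are $\tilde\psi_k^{(j)}(\xi)=\sqrt{\lambda_k^{(j)}}\sum_{\ell=0}^{d^{(j)}}\tilde b^{(j)}_\ell L_\ell(\xi\cdot\xi^{(j)}_k)$. Convention: $\max\emptyset=0$ if a window vanishes identically. Frames: a countable family $\{f_n\}$ in a Hilbert space $\mathcal H$ is a frame with frame bounds $C_1,C_2>0$ if $C_1\|g\|^2\le\sum_n|\langle g,f_n\rangle|^2\le C_2\|g\|^2$ for all $g\in\mathcal H$. Its dual frame is the canonical dual $\{S^{-1}f_n\}$, where $Sg=\sum_n\langle g,f_n\rangle f_n$ is the frame operator. *)

(* Defs.v *)
From HB Require Import structures.
From mathcomp Require Import all_boot all_order all_algebra finmap.
From mathcomp Require Import sesquilinear.
From mathcomp Require Import all_classical all_reals all_analysis measurable_realfun.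
From mathcomp.analysis Require summability.
Import Order.TTheory GRing.Theory Num.Theory numFieldNormedType.Exports.
From mathcomp Require Import complex lra ring.

Set Implicit Arguments.
Unset Strict Implicit.
Unset Printing Implicit Defensive.

Local Open Scope classical_set_scope.
Local Open Scope ring_scope.

Import ComplexField.Normc.

Section ComplexParts.
Context {R : realType}.
Implicit Types a b : R[i].

Lemma ReD a b : Re (a + b) = Re a + Re b. Proof. by case: a b => ? ? []. Qed.
Lemma ImD a b : Im (a + b) = Im a + Im b. Proof. by case: a b => ? ? []. Qed.
Lemma ReM a b : Re (a * b) = Re a * Re b - Im a * Im b.
Proof. by case: a b => ? ? []. Qed.
Lemma ImM a b : Im (a * b) = Re a * Im b + Im a * Re b.
Proof. by case: a b => ? ? []. Qed.
Lemma ReJ a : Re a^*%C = Re a. Proof. by case: a. Qed.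
Lemma ImJ a : Im a^*%C = - Im a. Proof. by case: a. Qed.
Lemma normc_sqr a : normc a ^+ 2 = Re a ^+ 2 + Im a ^+ 2.
Proof. by case: a => p q /=; rewrite sqr_sqrtr ?addr_ge0 ?sqr_ge0. Qed.

End ComplexParts.

Section ComplexL2.
Context d (T : measurableType d) (R : realType)
  (mu : {measure set T -> \bar R}).
Implicit Types (f g : T -> R[i]) (a b : R[i]).

Definition cintegral f : R[i] :=
  Complex (\int[mu]_x Re (f x)) (\int[mu]_x Im (f x)).

Definition cmeasurable f : Prop :=
  measurable_fun [set: T] (fun x => Re (f x)) /\
  measurable_fun [set: T] (fun x => Im (f x)).

Definition sq_integrable f : Prop :=
  cmeasurable f /\ (\int[mu]_x (normc (f x) ^+ 2)%:E < +oo)%E.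

Definition nsq f x : R := Re (f x) ^+ 2 + Im (f x) ^+ 2.

Let normc_nsq f x : normc (f x) ^+ 2 = nsq f x.
Proof. exact: normc_sqr. Qed.

Lemma nsq_ge0 f x : 0 <= nsq f x.
Proof. by rewrite addr_ge0 ?sqr_ge0. Qed.

Lemma cmeasurable_nsq f : cmeasurable f -> measurable_fun [set: T] (nsq f).
Proof.
by move=> [mr mi]; apply: measurable_funD; apply: measurable_funX.
Qed.

Lemma sq_integrableP f : sq_integrable f <->
  cmeasurable f /\ mu.-integrable [set: T] (EFin \o nsq f).
Proof.
split=> -[mf fi]; split=> //.
  apply/integrableP; split.
    by apply/measurable_EFinP; exact: cmeasurable_nsq.
  by under eq_integral => x _ do rewrite /= ger0_norm ?nsq_ge0// -normc_nsq.
move/integrableP : fi => [_].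
by under eq_integral => x _ do rewrite /= ger0_norm ?nsq_ge0// -normc_nsq.
Qed.

Let sq_integrable_le f g h : cmeasurable h -> sq_integrable f ->
  sq_integrable g -> (exists2 c, 0 <= c &
    forall x, nsq h x <= c * (nsq f x + nsq g x)) -> sq_integrable h.
Proof.
move=> mh /sq_integrableP[_ fi] /sq_integrableP[_ gi] [c c0 hle].
apply/sq_integrableP; split=> //.
apply: (@le_integrable _ _ _ mu setT measurableT _
    (fun x => (c%:E * ((nsq f x)%:E + (nsq g x)%:E))%E)) => //.
- by apply/measurable_EFinP; exact: cmeasurable_nsq.
- move=> x _ /=; rewrite lee_fin.
  rewrite (ger0_norm (nsq_ge0 h x)) ger0_norm ?hle//.
  by rewrite mulr_ge0// addr_ge0// nsq_ge0.
- by apply: integrableZl => //; exact: integrableD.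
Qed.

Lemma sq_integrable0 : sq_integrable (fun=> 0).
Proof.
split; first by split; exact: measurable_cst.
under eq_integral => x _ do rewrite normc0 expr0n.
by rewrite integral0.
Qed.

Lemma sq_integrableD f g : sq_integrable f -> sq_integrable g ->
  sq_integrable (fun x => f x + g x).
Proof.
move=> fi gi; apply: (sq_integrable_le _ fi gi).
  case: fi gi => [[fr fim] _] [[gr gim] _]; split.
    by under eq_fun do rewrite ReD; exact: measurable_funD.
  by under eq_fun do rewrite ImD; exact: measurable_funD.
exists 2 => // x; rewrite /nsq ReD ImD.
have := sqr_ge0 (Re (f x) - Re (g x)); have := sqr_ge0 (Im (f x) - Im (g x)).
by rewrite !expr2; nra.
Qed.

Lemma sq_integrableZ a f : sq_integrable f -> sq_integrable (fun x => a * f x).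
Proof.
move=> fi; apply: (sq_integrable_le _ fi fi).
  case: fi => [[fr fim] _]; split.
    under eq_fun do rewrite ReM.
    by apply: measurable_funB; apply: measurable_funM => //; exact: measurable_cst.
  under eq_fun do rewrite ImM.
  by apply: measurable_funD; apply: measurable_funM => //; exact: measurable_cst.
exists (Re a ^+ 2 + Im a ^+ 2); first by rewrite addr_ge0 ?sqr_ge0.
move=> x; rewrite /nsq ReM ImM.
have -> : (Re a * Re (f x) - Im a * Im (f x)) ^+ 2 +
   (Re a * Im (f x) + Im a * Re (f x)) ^+ 2 =
   (Re a ^+ 2 + Im a ^+ 2) * (Re (f x) ^+ 2 + Im (f x) ^+ 2) by ring.
by rewrite ler_wpM2l ?addr_ge0 ?sqr_ge0// lerDl addr_ge0 ?sqr_ge0.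
Qed.

Record L2fun := MkL2fun { L2val :> T -> R[i]; L2valP : sq_integrable L2val }.
HB.instance Definition _ := gen_eqMixin L2fun.
HB.instance Definition _ := gen_choiceMixin L2fun.

(* Complex-valued L^2, as square-integrable functions modulo a.e. equality. *)
Definition L2eq (f g : L2fun) := `[< {ae mu, forall x, f x = g x} >].

Let L2eq_refl : reflexive L2eq.
Proof. by move=> f; apply/asboolP; exact: aeW. Qed.

Let L2eq_sym : symmetric L2eq.
Proof.
move=> f g; apply/idP/idP => /asboolP h; apply/asboolP; apply: filterS h => x.
  by [].
by [].
Qed.

Let L2eq_trans : transitive L2eq.
Proof.
move=> f g h /asboolP gf /asboolP fh; apply/asboolP.
by apply: filterS2 gf fh => x -> ->.
Qed.

Canonical L2eq_equiv := EquivRel L2eq L2eq_refl L2eq_sym L2eq_trans.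

Local Open Scope quotient_scope.

Definition L2space : Type := {eq_quot L2eq}.
HB.instance Definition _ := Choice.on L2space.
HB.instance Definition _ := EqQuotient.on L2space.

Definition L2class f (fi : sq_integrable f) : L2space := \pi_L2space (MkL2fun fi).

Implicit Types u v w : L2space.

Definition L2repr u : T -> R[i] := repr u.
Lemma L2reprP u : sq_integrable (L2repr u).
Proof. exact: L2valP. Qed.

Lemma L2funK (F : L2fun) (Fi : sq_integrable F) : MkL2fun Fi = F.
Proof. by case: F Fi => f fi Fi; congr MkL2fun; exact: Prop_irrelevance. Qed.

Lemma L2classP f g (fi : sq_integrable f) (gi : sq_integrable g) :
  L2class fi = L2class gi <-> {ae mu, forall x, f x = g x}.
Proof.
rewrite /L2class; split=> [/eqP|fg].
  by rewrite eqmodE => /asboolP.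
by apply/eqP; rewrite eqmodE; exact/asboolP.
Qed.

Lemma L2class_repr f (fi : sq_integrable f) :
  {ae mu, forall x, L2repr (L2class fi) x = f x}.
Proof.
by apply/(L2classP (L2reprP (L2class fi)) fi); rewrite /L2class L2funK reprK.
Qed.

Lemma L2repr_inj u v : {ae mu, forall x, L2repr u x = L2repr v x} -> u = v.
Proof.
move=> uv; rewrite -[u]reprK -[v]reprK; apply/eqP; rewrite eqmodE.
exact/asboolP.
Qed.

Definition L2zero : L2space := L2class sq_integrable0.
Definition L2add u v := L2class (sq_integrableD (L2reprP u) (L2reprP v)).
Definition L2scale a u := L2class (sq_integrableZ a (L2reprP u)).
Definition L2opp u := L2scale (-1) u.

Lemma L2reprD u v :
  {ae mu, forall x, L2repr (L2add u v) x = L2repr u x + L2repr v x}.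
Proof. exact: L2class_repr. Qed.
Lemma L2reprZ a u : {ae mu, forall x, L2repr (L2scale a u) x = a * L2repr u x}.
Proof. exact: L2class_repr. Qed.
Lemma L2repr0 : {ae mu, forall x, L2repr L2zero x = 0}.
Proof. exact: L2class_repr. Qed.

Let L2addA : associative L2add.
Proof.
move=> u v w; apply: L2repr_inj.
near=> x; rewrite (near (L2reprD u (L2add v w)) x)//.
rewrite (near (L2reprD v w) x)// (near (L2reprD (L2add u v) w) x)//.
by rewrite (near (L2reprD u v) x)// addrA.
Unshelve. all: by end_near. Qed.

Let L2addC : commutative L2add.
Proof.
move=> u v; apply: L2repr_inj.
near=> x; rewrite (near (L2reprD u v) x)// (near (L2reprD v u) x)//.
by rewrite addrC.
Unshelve. all: by end_near. Qed.

Let L2add0 : left_id L2zero L2add.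
Proof.
move=> u; apply: L2repr_inj.
near=> x; rewrite (near (L2reprD L2zero u) x)// (near L2repr0 x)//.
by rewrite add0r.
Unshelve. all: by end_near. Qed.

Let L2addN : left_inverse L2zero L2opp L2add.
Proof.
move=> u; apply: L2repr_inj.
near=> x; rewrite (near (L2reprD (L2opp u) u) x)// (near (L2reprZ (-1) u) x)//.
by rewrite (near L2repr0 x)// mulN1r addNr.
Unshelve. all: by end_near. Qed.

HB.instance Definition _ :=
  GRing.isZmodule.Build L2space L2addA L2addC L2add0 L2addN.

Let L2scaleA a b u : L2scale a (L2scale b u) = L2scale (a * b) u.
Proof.
apply: L2repr_inj.
near=> x; rewrite (near (L2reprZ a (L2scale b u)) x)// (near (L2reprZ b u) x)//.
by rewrite (near (L2reprZ (a * b) u) x)// mulrA.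
Unshelve. all: by end_near. Qed.

Let L2scale1 : left_id 1 L2scale.
Proof.
move=> u; apply: L2repr_inj.
near=> x; rewrite (near (L2reprZ 1 u) x)//.
by rewrite mul1r.
Unshelve. all: by end_near. Qed.

Let L2scaleDr : right_distributive L2scale +%R.
Proof.
move=> a u v; apply: L2repr_inj.
near=> x; rewrite (near (L2reprZ a (L2add u v)) x)// (near (L2reprD u v) x)//.
rewrite (near (L2reprD (L2scale a u) (L2scale a v)) x)//.
by rewrite (near (L2reprZ a u) x)// (near (L2reprZ a v) x)// mulrDr.
Unshelve. all: by end_near. Qed.

Let L2scaleDl u : {morph L2scale^~ u : a b / a + b}.
Proof.
move=> a b; apply: L2repr_inj.
near=> x; rewrite (near (L2reprZ (a + b) u) x)//.
rewrite (near (L2reprD (L2scale a u) (L2scale b u)) x)//.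
by rewrite (near (L2reprZ a u) x)// (near (L2reprZ b u) x)// mulrDl.
Unshelve. all: by end_near. Qed.

HB.instance Definition _ := GRing.Zmodule_isLmodule.Build R[i] L2space
  L2scaleA L2scale1 L2scaleDr L2scaleDl.

Definition cintegrable f : Prop :=
  mu.-integrable [set: T] (fun x => (Re (f x))%:E) /\
  mu.-integrable [set: T] (fun x => (Im (f x))%:E).

Lemma cintegrableM f g : sq_integrable f -> sq_integrable g ->
  cintegrable (fun x => f x * (g x)^*%C).
Proof.
move=> fi gi; have [[fr fim] fn] := (sq_integrableP f).1 fi.
have [[gr gim] gn] := (sq_integrableP g).1 gi.
have dom (h : T -> R) : measurable_fun setT h ->
    (forall x, `|h x| <= nsq f x + nsq g x) ->
    mu.-integrable setT (fun x => (h x)%:E).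
  move=> mh hle; apply: (@le_integrable _ _ _ mu setT measurableT _
      (fun x => ((nsq f x)%:E + (nsq g x)%:E)%E)) => //.
  - exact/measurable_EFinP.
  - move=> x _; rewrite lee_fin.
    by rewrite (ger0_norm (addr_ge0 (nsq_ge0 f x) (nsq_ge0 g x))).
  - exact: integrableD.
split; apply: dom.
- under eq_fun do rewrite ReM ReJ ImJ mulrN opprK.
  by apply: measurable_funD; exact: measurable_funM.
- move=> x; rewrite ReM ReJ ImJ mulrN opprK /nsq ler_norml.
  move: (Re (f x)) (Im (f x)) (Re (g x)) (Im (g x)) => p q r s.
  have := sqr_ge0 (p + r); have := sqr_ge0 (q + s); have := sqr_ge0 (p - r).
  have := sqr_ge0 (q - s); have := sqr_ge0 (p); have := sqr_ge0 (q).
  have := sqr_ge0 (r); have := sqr_ge0 (s).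
  by rewrite !expr2 => *; apply/andP; split; nra.
- under eq_fun do rewrite ImM ReJ ImJ mulrN.
  by apply: measurable_funD; [apply: measurableT_comp => //|]; exact: measurable_funM.
- move=> x; rewrite ImM ReJ ImJ mulrN /nsq ler_norml.
  move: (Re (f x)) (Im (f x)) (Re (g x)) (Im (g x)) => p q r s.
  have := sqr_ge0 (p + s); have := sqr_ge0 (q + r); have := sqr_ge0 (p - s).
  have := sqr_ge0 (q - r); have := sqr_ge0 (p); have := sqr_ge0 (q).
  have := sqr_ge0 (r); have := sqr_ge0 (s).
  by rewrite !expr2 => *; apply/andP; split; nra.
Qed.

Lemma cintegralD f g : cintegrable f -> cintegrable g ->
  cintegral (fun x => f x + g x) = cintegral f + cintegral g.
Proof.
move=> [fr fim] [gr gim]; rewrite /cintegral.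
under eq_Rintegral do rewrite ReD; rewrite RintegralD//.
by under [in X in Complex _ X]eq_Rintegral do rewrite ImD; rewrite RintegralD.
Qed.

Lemma cintegralZ a f : cintegrable f ->
  cintegral (fun x => a * f x) = a * cintegral f.
Proof.
move=> [fr fim]; rewrite /cintegral.
have Z (c : R) (h : T -> R) : mu.-integrable [set: T] (fun x => (h x)%:E) ->
    mu.-integrable [set: T] (fun x => (c * h x)%:E).
  by move=> hi; under eq_fun do rewrite EFinM; exact: integrableZl.
under eq_Rintegral do rewrite ReM.
rewrite RintegralB//; [|exact: Z|exact: Z]; rewrite !RintegralZl//.
under [in X in Complex _ X]eq_Rintegral do rewrite ImM.
rewrite RintegralD//; [|exact: Z|exact: Z]; rewrite !RintegralZl//.
by case: a => p q.
Qed.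

Lemma ae_eq_cintegral f g : cintegrable f -> cintegrable g ->
  {ae mu, forall x, f x = g x} -> cintegral f = cintegral g.
Proof.
move=> [/measurable_int fr /measurable_int fim].
move=> [/measurable_int gr /measurable_int gim] fg.
by rewrite /cintegral /Rintegral; congr (Complex (fine _) (fine _));
  apply: ae_eq_integral => //; apply: filterS fg => x -> _.
Qed.

Lemma cintegralJ f : cintegrable f ->
  cintegral (fun x => (f x)^*%C) = (cintegral f)^*%C.
Proof.
move=> [fr fim]; rewrite /cintegral/=.
under eq_Rintegral do rewrite ReJ.
under [in X in Complex _ X]eq_Rintegral do rewrite ImJ -mulN1r.
by rewrite RintegralZl// mulN1r.
Qed.

Definition L2dot u v : R[i] :=
  cintegral (fun x => L2repr u x * (L2repr v x)^*%C).

Let dotI u v : cintegrable (fun x => L2repr u x * (L2repr v x)^*%C).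
Proof. by apply: cintegrableM; exact: L2reprP. Qed.

Lemma L2dot_class f g (fi : sq_integrable f) (gi : sq_integrable g) :
  L2dot (L2class fi) (L2class gi) = cintegral (fun x => f x * (g x)^*%C).
Proof.
apply: ae_eq_cintegral; [exact: dotI|exact: cintegrableM|].
near=> x; rewrite (near (L2class_repr fi) x)//.
by rewrite (near (L2class_repr gi) x).
Unshelve. all: by end_near. Qed.

Let L2dotC u v : L2dot u v = (-1) ^+ false * conjc (L2dot v u).
Proof.
rewrite expr0 mul1r -cintegralJ// /L2dot; congr cintegral; apply/funext => x.
by rewrite rmorphM/= conjcK mulrC.
Qed.

Let L2dotDl u v w : L2dot (u + v) w = L2dot u w + L2dot v w.
Proof.
rewrite -cintegralD//; apply: ae_eq_cintegral => //.
  have [ur ui] := dotI u w; have [vr vi] := dotI v w.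
  split.
    by under eq_fun do rewrite ReD EFinD; exact: integrableD.
  by under eq_fun do rewrite ImD EFinD; exact: integrableD.
by near=> x; rewrite (near (L2reprD u v) x)// mulrDl.
Unshelve. all: by end_near. Qed.

Let L2dotZl a u w : L2dot (a *: u) w = a * L2dot u w.
Proof.
rewrite -cintegralZ//; apply: ae_eq_cintegral => //.
  have := dotI (a *: u) w; have [ur ui] := dotI u w.
  have Z (c : R) (h : T -> R) : mu.-integrable [set: T] (fun x => (h x)%:E) ->
    mu.-integrable [set: T] (fun x => (c * h x)%:E).
    by move=> hi; under eq_fun do rewrite EFinM; exact: integrableZl.
  move=> _; split.
    under eq_fun do rewrite ReM EFinB.
    by apply: integrableB => //; exact: Z.
  under eq_fun do rewrite ImM EFinD.
  by apply: integrableD => //; exact: Z.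
by near=> x; rewrite (near (L2reprZ a u) x)// mulrA.
Unshelve. all: by end_near. Qed.

Let L2dotNl u w : L2dot (- u) w = - L2dot u w.
Proof. by rewrite -scaleN1r L2dotZl mulN1r. Qed.

Let L2dot_zmodl w : zmod_morphism (L2dot ^~ w).
Proof. by move=> u v; rewrite L2dotDl L2dotNl. Qed.

Let L2dot_zmodr w : zmod_morphism (L2dot w).
Proof.
move=> u v; rewrite (L2dotC w (u - v)) L2dot_zmodl.
by rewrite (L2dotC w u) (L2dotC w v) !expr0 !mul1r rmorphB.
Qed.

Let L2dot_scalel w : scalable_for *%R (L2dot ^~ w).
Proof. by move=> a u; rewrite L2dotZl. Qed.

Let L2dot_scaler w : scalable_for (conjc \; *%R) (L2dot w).
Proof.
move=> a u; rewrite (L2dotC w (a *: u)) L2dotZl /= (L2dotC w u).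
by rewrite !expr0 !mul1r rmorphM.
Qed.

Let L2dot_gt0 u : u != 0 -> 0 < L2dot u u.
Proof.
have [/= _ ni] := (sq_integrableP (L2repr u)).1 (L2reprP u).
have E : L2dot u u = (\int[mu]_x nsq (L2repr u) x)%:C%C.
  rewrite /L2dot /cintegral; congr Complex.
    by apply: eq_Rintegral => x _; rewrite ReM ReJ ImJ mulrN opprK /nsq !expr2.
  rewrite (_ : (fun x => _) = cst 0) ?Rintegral_cst ?mul0r//.
  by apply/funext => x; rewrite ImM ReJ ImJ mulrN mulrC addNr.
move=> u0; rewrite E ltcR lt_neqAle Rintegral_ge0 ?andbT; last first.
  by move=> x _; exact: nsq_ge0.
apply: contra u0; rewrite eq_sym => /eqP I0; apply/eqP; apply: L2repr_inj.
have : (\int[mu]_x `|(nsq (L2repr u) x)%:E| = 0)%E.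
  under eq_integral do rewrite gee0_abs ?lee_fin ?nsq_ge0//.
  move: I0; rewrite /Rintegral => /eqP; rewrite fine_eq0 => [/eqP//|].
  exact: integrable_fin_num.
move/ae_eq_integral_abs => /(_ measurableT (measurable_int _ ni)) H.
near=> x; rewrite (near L2repr0 x)//.
have /(_ I)/= : [set: T] x -> (nsq (L2repr u) x)%:E = 0%E by near: x.
move=> [] /eqP; rewrite /nsq paddr_eq0 ?sqr_ge0// !sqrf_eq0.
by case: (L2repr u x) => p q /= /andP[/eqP-> /eqP->].
Unshelve. all: by end_near. Qed.

HB.instance Definition _ := isBilinear.Build R[i] L2space L2space R[i]
  *%R (conjc \; *%R) L2dot L2dot_zmodl L2dot_zmodr L2dot_scalel L2dot_scaler.
HB.instance Definition _ := isHermitianSesquilinear.Build R[i] L2space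
  false conjc L2dot L2dotC.
HB.instance Definition _ := isDotProduct.Build R[i] L2space L2dot L2dot_gt0.
End ComplexL2.

Definition sphere (R : realType) :=
  {p : R * R * R | p.1.1 ^+ 2 + p.1.2 ^+ 2 + p.2 ^+ 2 == 1}.

Definition sphere_display : measure_display. Proof. exact. Qed.

Section Sphere.
Context {R : realType}.
Local Notation S2 := (sphere R).

Fact polar_subproof (theta phi : R) :
  (sin theta * cos phi) ^+ 2 + (sin theta * sin phi) ^+ 2 + cos theta ^+ 2 == 1.
Proof. by rewrite !exprMn -mulrDr cos2Dsin2 mulr1 addrC cos2Dsin2. Qed.

Definition polar (t : R * R) : S2 :=
  exist (fun p : R * R * R => p.1.1 ^+ 2 + p.1.2 ^+ 2 + p.2 ^+ 2 == 1)
    (sin t.1 * cos t.2, sin t.1 * sin t.2, cos t.1) (polar_subproof t.1 t.2).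

HB.instance Definition _ := Choice.on S2.
HB.instance Definition _ := isPointed.Build S2 (polar (0, 0)).

(* The Borel sets of the sphere: traces of the Borel sets of R^3. *)
Let borelS2 := g_sigma_algebra_preimageType (val : S2 -> R * R * R).
HB.instance Definition _ := @isMeasurable.Build sphere_display S2
  (g_sigma_algebra_preimage (val : S2 -> R * R * R))
  (@measurable0 _ borelS2) (@measurableC _ borelS2)
  (@bigcupT_measurable _ borelS2).

Definition dotS (x y : S2) : R :=
  (val x).1.1 * (val y).1.1 + (val x).1.2 * (val y).1.2 + (val x).2 * (val y).2.

Lemma measurable_polar : measurable_fun [set: R * R] polar.
Proof.
move=> _ B [C mC <-]; rewrite !setTI.
have ms : measurable_fun [set: R] (@sin R).
  by apply: continuous_measurable_fun; exact: continuous_sin.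
have mc : measurable_fun [set: R] (@cos R).
  by apply: continuous_measurable_fun; exact: continuous_cos.
have mp : measurable_fun [set: R * R] (val \o polar).
  have s1 : measurable_fun [set: R * R] (fun t => sin t.1).
    exact: measurableT_comp ms measurable_fst.
  have s2 : measurable_fun [set: R * R] (fun t => sin t.2).
    exact: measurableT_comp ms measurable_snd.
  have c1 : measurable_fun [set: R * R] (fun t => cos t.1).
    exact: measurableT_comp mc measurable_fst.
  have c2 : measurable_fun [set: R * R] (fun t => cos t.2).
    exact: measurableT_comp mc measurable_snd.
  by apply: measurable_fun_pair; [apply: measurable_fun_pair|] => //;
    exact: measurable_funM.
by have := mp measurableT C mC; rewrite setTI.
Qed.

(* theta in [0, pi], phi in [0, 2 pi] *)
Definition angles : set (R * R) := `[0%R, pi] `*` `[0%R, (2 * pi)%R].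

Lemma measurable_angles : measurable angles.
Proof. by apply: measurableX. Qed.

Lemma sin_angles_ge0 t : angles t -> 0 <= sin t.1.
Proof. by move=> [+ _]; exact: sin_ge0_pi. Qed.

Lemma measurable_sin1 (D : set (R * R)) :
  measurable_fun D (fun t => (sin t.1)%:E).
Proof.
apply: (@measurable_funS _ _ _ _ setT) => //; apply/measurable_EFinP.
apply: (measurableT_comp _ measurable_fst).
by apply: continuous_measurable_fun; exact: continuous_sin.
Qed.

(* Image under polar of the measure sin theta dtheta dphi. *)
Definition surface_measure (A : set S2) : \bar R :=
  (\int[lebesgue_measure \x lebesgue_measure]_(t in angles `&` polar @^-1` A)
     (sin t.1)%:E)%E.

Let surface_measure0 : surface_measure set0 = 0%E.
Proof. by rewrite /surface_measure preimage_set0 setI0 integral_set0. Qed.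

Let surface_measure_ge0 A : (0 <= surface_measure A)%E.
Proof.
by apply: integral_ge0 => t [tA _]; rewrite lee_fin sin_angles_ge0.
Qed.

Let measurable_preim A : measurable A -> measurable (angles `&` polar @^-1` A).
Proof.
move=> mA; apply: measurableI; first exact: measurable_angles.
by rewrite -[X in measurable X]setTI; exact: measurable_polar.
Qed.

Let surface_measure_sigma_additive : semi_sigma_additive surface_measure.
Proof.
move=> F mF tF mUF; rewrite /surface_measure preimage_bigcup setI_bigcupr.
rewrite ge0_integral_bigcup//.
- apply: is_cvg_nneseries => n _ _.
  by apply: integral_ge0 => t [tA _]; rewrite lee_fin sin_angles_ge0.
- by move=> k; exact: measurable_preim.
- exact: measurable_sin1.
- by move=> t [k _ [tA _]]; rewrite lee_fin sin_angles_ge0.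
- apply: trivIset_setIl; apply/trivIsetP => i j _ _ ij.
  by rewrite -preimage_setI; move/trivIsetP : tF => ->//; rewrite preimage_set0.
Qed.

HB.instance Definition _ := isMeasure.Build _ S2 R surface_measure
  surface_measure0 surface_measure_ge0 surface_measure_sigma_additive.

Let surface_measure_fin : fin_num_fun surface_measure.
Proof.
move=> A mA; rewrite ge0_fin_numE//.
apply: (@le_lt_trans _ _
  (\int[lebesgue_measure \x lebesgue_measure]_(t in angles) 1)%E).
  apply: (@le_trans _ _
    (\int[lebesgue_measure \x lebesgue_measure]_(t in angles) (sin t.1)%:E)%E).
    apply: ge0_subset_integral => //.
    - exact: measurable_preim.
    - exact: measurable_angles.
    - exact: measurable_sin1.
    - by move=> t /sin_angles_ge0; rewrite lee_fin.
  apply: ge0_le_integral => //.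
  - exact: measurable_angles.
  - by move=> t /sin_angles_ge0; rewrite lee_fin.
  - exact: measurable_sin1.
  - by move=> t _; rewrite lee_fin sin_le1.
rewrite integral_cst; last exact: measurable_angles.
rewrite mul1e /angles.
have /= -> := @product_measure1E _ _ _ _ R (@lebesgue_measure R)
  (@lebesgue_measure R) `[0, pi] `[0, 2 * pi] (measurable_itv _) (measurable_itv _).
rewrite !lebesgue_measure_itv/=.
by case: ifP => _; case: ifP => _; rewrite ?mule0 ?mul0e// -?EFinD -?EFinM ltry.
Qed.

HB.instance Definition _ := Measure_isFinite.Build _ S2 R surface_measure
  surface_measure_fin.

Lemma dotS_le1 (x y : S2) : `|dotS x y| <= 1.
Proof.
have /eqP xE := valP x; have /eqP yE := valP y; move: xE yE.
rewrite /dotS ler_norml.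
case: (val x) (val y) => -[a b] c [[p q] r]; rewrite /= !expr2 => xE yE.
have := sqr_ge0 (a - p); have := sqr_ge0 (b - q); have := sqr_ge0 (c - r).
have := sqr_ge0 (a + p); have := sqr_ge0 (b + q); have := sqr_ge0 (c + r).
by rewrite !expr2 => *; apply/andP; split; nra.
Qed.

Lemma measurable_val : measurable_fun [set: S2] (val : S2 -> R * R * R).
Proof. by move=> _ B mB; exists B => //. Qed.

Lemma measurable_dotS y : measurable_fun [set: S2] (dotS ^~ y).
Proof.
have m1 : measurable_fun [set: S2] (fun x => (val x).1).
  exact: measurableT_comp measurable_fst measurable_val.
have m11 : measurable_fun [set: S2] (fun x => (val x).1.1).
  exact: measurableT_comp measurable_fst m1.
have m12 : measurable_fun [set: S2] (fun x => (val x).1.2).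
  exact: measurableT_comp measurable_snd m1.
have m2 : measurable_fun [set: S2] (fun x => (val x).2).
  exact: measurableT_comp measurable_snd measurable_val.
by apply: measurable_funD; [apply: measurable_funD|];
  apply: measurable_funM => //; exact: measurable_cst.
Qed.

(* Rodrigues' formula *)
Definition legendre (n : nat) : {poly R} :=
  (2 ^+ n * n`!%:R)^-1 *: (('X^2 - 1) ^+ n)^`(n).

(* L_l(z) = (2l+1)/(4 pi) P_l(z) *)
Definition zonal (l : nat) (z : R) : R :=
  (2 * l + 1)%N%:R / (4 * pi) * (legendre l).[z].

(* Y_lm for m >= 0, with the Condon-Shortley phase. At x = polar (theta, phi),
     x1 + i x2 = sin theta * e^(i phi), hence
     P_l^m(cos theta) * e^(i m phi)
       = (-1)^m * (sin theta)^m * P_l^(m)(cos theta) * e^(i m phi)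
       = (-1)^m * P_l^(m)(x3) * (x1 + i x2)^m. *)
Definition sphericalY_nat (l m : nat) (x : S2) : R[i] :=
  ((-1) ^+ m
   * Num.sqrt ((2 * l + 1)%N%:R / (4 * pi)
               * ((l - m)%N`!%:R / (l + m)%N`!%:R))
   * ((legendre l)^`(m)).[(val x).2])%:C%C
  * (Complex (val x).1.1 (val x).1.2) ^+ m.

(* Y_(l,-m) = (-1)^m * conj(Y_lm) *)
Definition sphericalY (l : nat) (m : int) (x : S2) : R[i] :=
  match m with
  | Posz m => sphericalY_nat l m x
  | Negz m => (-1) ^+ m.+1 * (sphericalY_nat l m.+1 x)^*%C
  end.

(* The index k - l, for 0 <= k <= 2l, ranges over the orders -l, ..., l. *)
Definition harmonic_space (l : nat) : set (S2 -> R[i]) :=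
  [set X | exists a : int -> R[i], X = fun x =>
    \sum_(k < (2 * l)%N.+1) a (k%:Z - l%:Z) * sphericalY l (k%:Z - l%:Z) x].

Definition harmonic_sum (L : nat) : set (S2 -> R[i]) :=
  [set X | exists2 Y : nat -> S2 -> R[i],
    forall l, (l <= L)%N -> harmonic_space l (Y l) &
    X = fun x => \sum_(l < L.+1) Y l x].

Definition exact_quadrature (K : finType) (xi : K -> S2) (lam : K -> R)
    (L : nat) : Prop :=
  forall X, harmonic_sum L X ->
    cintegral surface_measure X = \sum_k (lam k)%:C%C * X (xi k).

Definition needlet (w : nat -> R) (deg : nat) (xi0 : S2) (lam : R) (x : S2) :
    R[i] :=
  (Num.sqrt lam * \sum_(l < deg.+1) w l * zonal l (dotS x xi0))%:C%C.

Lemma zonal_measurable l (y : S2) :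
  measurable_fun [set: S2] (fun x => zonal l (dotS x y)).
Proof.
apply: measurable_funM; first exact: measurable_cst.
under eq_fun do rewrite horner_coef.
apply: measurable_sum => i; apply: measurable_funM; first exact: measurable_cst.
by apply: measurable_funX; exact: measurable_dotS.
Qed.

Lemma zonal_bounded l (y : S2) : exists M, forall x, `|zonal l (dotS x y)| <= M.
Proof.
exists (`|(2 * l + 1)%N%:R / (4 * pi)| * \sum_(i < size (legendre l)) `|(legendre l)`_i|).
move=> x; rewrite normrM ler_wpM2l// horner_coef.
apply: (le_trans (ler_norm_sum _ _ _)); apply: ler_sum => i _.
by rewrite normrM ler_piMr// normrX exprn_ile1// dotS_le1.
Qed.

Lemma needlet_L2 w deg xi0 lam :
  sq_integrable surface_measure (needlet w deg xi0 lam).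
Proof.
have mr : measurable_fun [set: S2] (fun x => Re (needlet w deg xi0 lam x)).
  apply: measurable_funM; first exact: measurable_cst.
  apply: measurable_sum => i; apply: measurable_funM; first exact: measurable_cst.
  exact: zonal_measurable.
split; first by split=> //; exact: measurable_cst.
have [M hM] : exists M, forall x, `|Re (needlet w deg xi0 lam x)| <= M.
  have [B hB] := choice (fun l => zonal_bounded l xi0).
  exists (`|Num.sqrt lam| * \sum_(l < deg.+1) `|w l| * B l) => x.
  rewrite /= normrM ler_wpM2l//; apply: (le_trans (ler_norm_sum _ _ _)).
  by apply: ler_sum => i _; rewrite normrM ler_wpM2l.
apply: (@le_lt_trans _ _ (\int[surface_measure]_x (M ^+ 2)%:E)%E).
  apply: ge0_le_integral => //.
  - by move=> x _; rewrite lee_fin sqr_ge0.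
  - under eq_fun do rewrite normc_sqr.
    apply/measurable_EFinP; apply: measurable_funD; apply: measurable_funX => //.
  - move=> x _; rewrite lee_fin normc_sqr /= expr0n addr0 -real_normK ?num_real//.
    by rewrite ler_pXn2r// ?nnegrE// (le_trans _ (hM x)).
rewrite integral_cst// lte_mul_pinfty// ?lee_fin ?sqr_ge0//.
by rewrite -ge0_fin_numE//; exact: fin_num_measure.
Qed.

Definition needletL2 w deg xi0 lam : L2space surface_measure :=
  L2class (needlet_L2 w deg xi0 lam).

End Sphere.

Section Windows.
Context {R : realType} {J : countType}.
Implicit Types b : J -> nat -> R.

Definition window_sum b (l : nat) : R :=
  fine (\esum_(j in [set: J]) (b j l ^+ 2)%:E).

Definition synthesis_window b (j : J) (l : nat) : R := b j l / window_sum b l.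

Definition reconstruction_window b (j : J) (l : nat) : R :=
  synthesis_window b j l * b j l.

(* \max over the empty set is 0; fset_set is meaningful because the supports of
   the windows are finite. *)
Definition window_degree b (j : J) : nat :=
  \max_(l <- fset_set [set l | reconstruction_window b j l != 0]) l.

End Windows.

Section Frames.
Context {R : realType} {V : lmodType R[i]} (ip : {dot V for conjc}).

Definition hnorm (v : V) : R := Num.sqrt (Re (ip v v)).

(* Unconditional convergence, in norm, of the net of finite partial sums. *)
Definition hsums_to {I : choiceType} (x : I -> V) (s : V) : Prop :=
  (fun A => hnorm (summability.partial_sum x A - s)) @ summability.totally
    --> (0 : R).

Context {I : countType}.
Implicit Types f : I -> V.

Definition is_frame f (C1 C2 : R) : Prop :=
  [/\ 0 < C1, 0 < C2 & forall g : V,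
    ((C1 * hnorm g ^+ 2)%:E
       <= \esum_(n in [set: I]) (normc (ip g (f n)) ^+ 2)%:E
       <= (C2 * hnorm g ^+ 2)%:E)%E].

Definition is_frame_operator f (S : V -> V) : Prop :=
  forall g, hsums_to (fun n => ip g (f n) *: f n) (S g).

Definition is_canonical_dual f (f' : I -> V) : Prop :=
  exists S Sinv : V -> V, [/\ is_frame_operator f S, cancel S Sinv,
    cancel Sinv S & forall n, f' n = Sinv (f n)].

End Frames.

(* Main.v *)
Require Import Defs.
From HB Require Import structures.
From mathcomp Require Import all_boot all_order all_algebra finmap.
From mathcomp Require Import sesquilinear.
From mathcomp Require Import all_classical all_reals all_analysis measurable_realfun.
From mathcomp.analysis Require summability.
Import Order.TTheory GRing.Theory Num.Theory numFieldNormedType.Exports.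
From mathcomp Require Import complex lra ring zify.

Set Implicit Arguments.
Unset Strict Implicit.
Unset Printing Implicit Defensive.

Local Open Scope classical_set_scope.
Local Open Scope ring_scope.

Import ComplexField.Normc.
#[local] Existing Instance summability.totally_filter.

(** The harmonic projections P_l X = sum_m <X, Y_lm> Y_lm are mutually
    orthogonal and add up to the identity, and the whole statement follows from
    the fact that every operator built from the needlets is diagonal with respect
    to them.

    By the addition theorem ([zonal_addition]) L_l (x . y) is the sum over m of
    Y_lm x times the conjugate of Y_lm y, so that a needlet centred at xi_k is the
    combination of the Y_lm with coefficients sqrt lambda_k * b_l * conj (Y_lm xi_k).
    In sum_k <X, psi_k> psi'_k, for two windows b and b', the nodes therefore only
    sample products Y_lm * conj Y_l'm' with l, l' <= d. Such a product is a
    polynomial of degree at most 2 d on the sphere ([sphericalY_prod]), hence the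
    quadrature may be replaced by the integral, and orthonormality leaves
    sum_l b_l b'_l P_l X ([needlet_sum]).

    Summation over j turns the frame operator into the multiplier sum_l B_l P_l,
    where B_l, the sum over j of the squares of the windows at l, lies between C1
    and C2. With Parseval's identity this gives the frame bounds; the inverse of the
    frame operator multiplies P_l by 1 / B_l and so maps the decomposition needlets
    to the reconstruction needlets; and the blocks sum_k <X, psi_k> psit_k are
    multipliers whose coefficients add up to 1 over j. All the sums over j and k are
    sums of positive operators T_i whose quadratic forms add up to the quadratic
    form of a bounded operator S. Convergence in norm is then automatic: each
    remainder D = S - sum_(i in A) T_i satisfies 0 <= D <= C, whence
    |D g|^2 <= C <D g, g>, which tends to 0 ([psd_sum_cvg]).

    Three facts about the sphere support this argument. The addition theorem and
    the orthonormality of the Y_lm both come from Legendre's differential equation,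
    the former by comparing Fourier coefficients in the longitude. That the P_l add
    up to the identity is the density of the polynomials in L^2 ([sphpoly_dense]):
    the bounded functions that preserve the closure of the polynomials under
    multiplication contain the coordinates and are stable under bounded pointwise
    limits, hence contain the indicators of all Borel sets. Finally L^2 is complete
    ([L2_complete]), so that bounded multipliers of the P_l exist. *)

(** * Legendre polynomials *)

Section Legendre.
Context {R : realType}.
Implicit Types (p q : {poly R}) (n l k m : nat).

Lemma deriv_natr n : (n%:R : {poly R})^`() = 0.
Proof. by rewrite -polyC_natr derivC. Qed.

Definition deriv_simp := (derivD, derivB, derivN, derivM, derivXn, derivX, deriv_natr, derivC).

(** The function u = (X^2 - 1)^n satisfies (X^2 - 1) u' = 2 n X u; this is that
    equation differentiated j + 1 times. *)
Lemma derivn_rodrigues_ode n j (u := ('X^2 - 1) ^+ n : {poly R}) :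
  ('X^2 - 1) * u^`(j.+2) + 2%:R * (j%:R + 1 - n%:R) * 'X * u^`(j.+1)
  + (j%:R + 1) * (j%:R - 2%:R * n%:R) * u^`(j) = 0.
Proof.
elim: j => [|j].
  rewrite derivn0 derivn1 derivnS derivn1.
  have E : ('X^2 - 1) * u^`() = 2%:R * n%:R * 'X * u.
    case: n @u => [|n]; rewrite /= ?expr0 ?derivC; first by ring.
    by rewrite deriv_exp !deriv_simp /= (exprS _ n); ring.
  move/(congr1 deriv): E; rewrite !deriv_simp => E.
  transitivity (('X^2 - 1) * u^`()^`() + 'X *+ 2 * u^`() - (2%:R * n%:R * u
     + 2%:R * n%:R * 'X * u^`())); first by ring.
  apply/eqP; rewrite subr_eq0; apply/eqP.
  move: E; rewrite /= !expr1 => E.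
  by transitivity (('X *+ 2 ^ 2.-1 - 0) * u^`() + ('X^2 - 1) * u^`()^`()); [ring|rewrite [LHS]E; ring].
move/(congr1 deriv); rewrite deriv0 !deriv_simp /= -!derivnS => E.
rewrite -[RHS]E -natr1; ring.
Qed.

Local Notation P l k := ((@legendre R l)^`(k)).

Lemma derivn_derivn p n k : (p^`(n))^`(k) = p^`(n + k).
Proof. by rewrite /derivn addnC iterD. Qed.

Lemma legendre_ode l k :
  (1 - 'X^2) * P l k.+2 - 2%:R * k.+1%:R * 'X * P l k.+1
  + (l%:R * l.+1%:R - k%:R * k.+1%:R) * P l k = 0.
Proof.
rewrite /legendre !derivnZ !derivn_derivn !addnS.
have := derivn_rodrigues_ode l (l + k).
set u := ('X^2 - 1) ^+ l => E.
rewrite -!scalerAr -scalerBr -scalerDr.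
apply/eqP; rewrite scaler_eq0; apply/orP; right; rewrite -oppr_eq0 -E.
by apply/eqP; rewrite natrD -!natr1; ring.
Qed.

Lemma size_legendre_pow l : size (('X^2 - 1) ^+ l : {poly R}) = (2 * l).+1.
Proof.
have m : ('X^2 - 1 : {poly R}) \is monic by rewrite -polyC1 monicXnsubC.
by rewrite polySpred ?monic_neq0 ?monic_exp// size_exp -polyC1 size_XnsubC.
Qed.

Lemma coef_legendre_gt l k n : (l < k + n)%N -> (P l k)`_n = 0.
Proof.
move=> ln; rewrite coef_derivn coefZ coef_derivn nth_default ?mul0rn ?mulr0 ?mul0rn//.
by rewrite size_legendre_pow mul2n -addnn -addnS leq_add2l.
Qed.

Lemma coef_legendre_top l k : (k <= l)%N -> (P l k)`_(l - k) != 0.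
Proof.
move=> kl; rewrite coef_derivn coefZ coef_derivn subnKC//.
rewrite !mulrn_eq0 !mulf_eq0 invr_eq0 mulf_eq0 expf_eq0 pnatr_eq0 andbF/=.
have -> : (('X^2 - 1) ^+ l : {poly R})`_(l + l) = 1.
  have /monicP : (('X^2 - 1) ^+ l : {poly R}) \is monic.
    by rewrite monic_exp// -polyC1 monicXnsubC.
  by rewrite /lead_coef size_legendre_pow /= mul2n addnn.
by rewrite !pnatr_eq0 !eqn0Ngt !ffact_gt0 fact_gt0 leq_addr kl.
Qed.

Lemma legendre_derivn_eq0 l k : (l < k)%N -> P l k = 0.
Proof.
by move=> lk; apply/polyP => n; rewrite coef0 coef_legendre_gt// ltn_addr.
Qed.

Lemma size_legendre l k : (size (P l k) <= (l - k).+1)%N.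
Proof.
apply/leq_sizeP => n ln; apply: coef_legendre_gt.
by lia.
Qed.

(** In Leibniz' formula only the term where every derivative falls on (X - 1)^n
    survives at 1. Applied to (X - 1)^n (X + 1)^n it gives P_n(1) = 1. *)
Lemma derivn_XsubC_exp n q : ((('X - 1) ^+ n * q)^`(n)).[1] = n`!%:R * q.[1].
Proof.
elim: n q => [|n IH] q; first by rewrite expr0 derivn0 fact0 !mul1r.
rewrite derivSn derivM deriv_exp !deriv_simp /= subr0 mul1r.
rewrite (_ : _ + _ = ('X - 1) ^+ n * (n.+1%:R * q + ('X - 1) * q^`())).
  rewrite IH !hornerE /= subrr mul0r addr0 factS natrM.
  by rewrite -polyC_natr hornerC; ring.
by rewrite exprS; ring.
Qed.

Lemma legendre1 l : (@legendre R l).[1] = 1.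
Proof.
rewrite /legendre hornerZ.
have -> : 'X^2 - 1 = ('X - 1) * ('X + 1) :> {poly R} by ring.
rewrite exprMn derivn_XsubC_exp !hornerE /=.
by rewrite -mulrA (mulrC l`!%:R) mulVf// mulf_neq0 ?expf_neq0 ?pnatr_eq0// -lt0n fact_gt0.
Qed.

(** At 1 the second-order term of Legendre's equation vanishes, which leaves a
    two-term recursion in m. *)
Lemma legendre_derivn1 l m : (m <= l)%N ->
  (P l m).[1] = (l + m)`!%:R / ((l - m)`!%:R * m`!%:R * 2 ^+ m).
Proof.
have F n : n`!%:R != 0 :> R by rewrite pnatr_eq0 -lt0n fact_gt0.
elim: m => [|m IH] ml.
  by rewrite derivn0 legendre1 addn0 subn0 fact0 expr0 !mulr1 divff.
have /(congr1 (fun p => p.[1])) := legendre_ode l m.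
rewrite -!polyC_natr !hornerE /= expr1n subrr mul0r sub0r IH; last exact: ltnW.
have -> : (l - m = (l - m.+1).+1)%N by rewrite subnSK.
rewrite addnS !factS !natrM exprS.
set b := (l + m)%N; set a := (l - m.+1)%N.
have El : l%:R = a%:R + m%:R + 1 :> R by rewrite -natrD natr1 -addnS subnK.
have Eb : b%:R = a%:R + 2 * m%:R + 1 :> R.
  rewrite /b natrD El; move: (a%:R) (m%:R) => x y.
  ring.
have [Fa Fm Fb] := And3 (F a) (F m) (F b).
have [a1 m1] : a%:R + 1 != 0 :> R /\ m%:R + 1 != 0 :> R by rewrite !natr1 !pnatr_eq0.
rewrite -(natr1 l) -(natr1 m) -(natr1 a) -(natr1 b) El Eb; set y := (P l m)^`().[1] => H.
have {}H : 2 * (m%:R + 1) * y = (a%:R + 1) * (a%:R + 2 * m%:R + 2) *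
     (b`!%:R / ((a%:R + 1) * a`!%:R * m`!%:R * 2 ^+ m)) :> R.
  by apply/eqP; rewrite eq_sym -subr_eq0 -H; apply/eqP; ring.
have -> : y = (2 * (m%:R + 1) * y) / (2 * (m%:R + 1)) by field.
by rewrite H; field; rewrite a1 m1 Fa Fm expf_neq0 ?pnatr_eq0.
Qed.

(** In degree d = deg p the equation reads (l - m - d) (l + m + d + 1) p_d = 0, so
    that a nonzero polynomial solution has degree exactly l - m. *)
Lemma legendre_ode_unique l m p : (m <= l)%N ->
  (1 - 'X^2) * p^`()^`() - 2%:R * m.+1%:R * 'X * p^`()
  + (l%:R * l.+1%:R - m%:R * m.+1%:R) * p = 0 ->
  p`_(l - m) = 0 -> p = 0.
Proof.
move=> ml E pd; apply/eqP; apply: contraPT pd => p0.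
have : p`_(size p).-1 != 0 by rewrite -/(lead_coef p) lead_coef_eq0.
set d := (size p).-1.
have [->//|dl] := eqVneq d (l - m)%N; first by move=> /eqP.
move/(congr1 (fun p => p`_d)): E.
have z n : (d < n)%N -> p`_n = 0.
  by move=> dn; rewrite nth_default//; rewrite /d in dn; case: size dn.
have -> : (1 - 'X^2) * p^`()^`() - 2%:R * m.+1%:R * 'X * p^`()
  + (l%:R * l.+1%:R - m%:R * m.+1%:R) * p =
  p^`()^`() - 'X * ('X * p^`()^`()) - (2%:R * m.+1%:R)%:P * ('X * p^`())
  + (l%:R * l.+1%:R - m%:R * m.+1%:R)%:P * p.
  by rewrite !polyCB !polyCM !polyC_natr; ring.
rewrite coefD !coefB !coefCM !coefXM !coef_deriv (z d.+2)// !mul0rn sub0r coef0.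
have lmE : l%:R = (l - m)%:R + m%:R :> R by rewrite -natrD subnK.
have dl' : d%:R - (l - m)%:R != 0 :> R by rewrite subr_eq0 eqr_nat.
have -> : (if d == 0%N then 0 else if d.-1 == 0%N then 0 else p`_d.-2.+2 *+ d.-2.+2 *+ d.-2.+1)
    = d%:R * (d%:R - 1) * p`_d :> R.
  by case: (d) => [|[|e]] /=; rewrite ?eqxx ?mul0r ?subrr ?mulr0 ?mul0r//=; ring.
have -> : (if d == 0%N then 0 else p`_d.-1.+1 *+ d.-1.+1) = d%:R * p`_d.
  by case: (d) => [|e] /=; rewrite ?mul0r// mulr_natl.
move=> H pd0; exfalso; move: H.
rewrite -!natr1 lmE; set e : R := (l - m)%:R in dl' *.
rewrite (_ : _ + _ = (e - d%:R) * (e + m%:R *+ 2 + d%:R + 1) * p`_d); last by ring.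
move/eqP; rewrite !mulf_eq0 (negPf pd0) orbF -opprB oppr_eq0 (negPf dl') /=.
apply/negP; rewrite gt_eqF// ltr_wpDl// !addr_ge0 ?mulrn_wge0 ?ler0n//.
Qed.

Definition primitive p : {poly R} := \poly_(i < (size p).+1) (p`_i.-1 / i%:R).

Lemma coef_primitive p i : (primitive p)`_i = p`_i.-1 / i%:R.
Proof.
rewrite coef_poly; case: ifP => // /negbT; rewrite -leqNgt => pi.
by rewrite nth_default ?mul0r//; case: i pi.
Qed.

Lemma deriv_primitive p : (primitive p)^`() = p.
Proof.
apply/polyP => i; rewrite coef_deriv coef_primitive /= -[LHS]mulr_natr.
by rewrite divfK// pnatr_eq0.
Qed.

(** The integral over [-1, 1]. The formal primitive makes integration by parts
    polynomial algebra; [integral_zonal] identifies it with a Lebesgue integral. *)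
Definition int11 p : R := (primitive p).[1] - (primitive p).[-1].

Lemma int11D p q : int11 (p + q) = int11 p + int11 q.
Proof.
rewrite /int11 (_ : primitive (p + q) = primitive p + primitive q).
  by rewrite !hornerD; ring.
by apply/polyP => i; rewrite coefD !coef_primitive coefD mulrDl.
Qed.

Lemma int11Z a p : int11 (a *: p) = a * int11 p.
Proof.
rewrite /int11 (_ : primitive (a *: p) = a *: primitive p).
  by rewrite !hornerZ mulrBr.
by apply/polyP => i; rewrite coefZ !coef_primitive coefZ mulrA.
Qed.

Lemma int11_deriv p : int11 p^`() = p.[1] - p.[-1].
Proof.
have E : p = primitive p^`() + (p`_0)%:P.
  apply/polyP => -[|i]; rewrite coefD coefC coef_primitive/= ?invr0 ?mulr0 ?add0r//.
  by rewrite coef_deriv -[X in X / _]mulr_natr mulfK ?pnatr_eq0// addr0.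
by rewrite [in RHS]E !hornerD !hornerC /int11; ring.
Qed.

Let wt k : {poly R} := (1 - 'X^2) ^+ k.

(** Legendre's equation in divergence form, which is what makes integration by
    parts effective. *)
Lemma legendre_sturm_liouville l k : (wt k.+1 * P l k.+1)^`() =
  - (l%:R * l.+1%:R - k%:R * k.+1%:R) *: (wt k * P l k).
Proof.
rewrite -mul_polyC polyCN polyCB !polyCM !polyC_natr.
rewrite derivM /wt deriv_exp !deriv_simp /= -derivnS (exprS _ k).
have := legendre_ode l k.
rewrite -derivnS sub0r; move: (P l k.+2) (P l k.+1) (P l k) => h g f E.
rewrite -[RHS]addr0 -[X in _ = _ + X](mulr0 ((1 - 'X^2) ^+ k)) -E; ring.
Qed.

Definition legendre_gram k l l' := int11 (wt k * P l k * P l' k).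

Lemma legendre_gramC k l l' : legendre_gram k l l' = legendre_gram k l' l.
Proof. by rewrite /legendre_gram mulrAC. Qed.

(** Integration by parts; the weight kills the boundary terms. *)
Lemma legendre_gramS k l l' : legendre_gram k.+1 l l' =
  (l%:R * l.+1%:R - k%:R * k.+1%:R) * legendre_gram k l l'.
Proof.
have := int11_deriv (wt k.+1 * P l k.+1 * P l' k).
have -> : (wt k.+1 * P l k.+1 * P l' k)^`() =
    - (l%:R * l.+1%:R - k%:R * k.+1%:R) *: (wt k * P l k * P l' k)
    + wt k.+1 * P l k.+1 * P l' k.+1.
  by rewrite derivM legendre_sturm_liouville -scalerAl.
rewrite int11D int11Z -/(legendre_gram k l l') -/(legendre_gram k.+1 l l').
have wt0 x : x ^+ 2 = 1 -> (wt k.+1).[x] = 0.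
  by move=> x1; rewrite /wt horner_exp !hornerE x1 subrr expr0n.
rewrite !hornerM !wt0 ?sqrrN ?expr1n// !mul0r subrr mulNr addrC => /eqP.
by rewrite subr_eq0 => /eqP.
Qed.

(** The Gram entry is symmetric in l and l', whereas the factor of [legendre_gramS]
    is not. *)
Lemma legendre_gram_neq k l l' : l != l' -> legendre_gram k l l' = 0.
Proof.
move=> ll'; have := legendre_gramS k l l'.
rewrite legendre_gramC legendre_gramS (legendre_gramC k l').
move/eqP; rewrite -subr_eq0 -mulrBl mulf_eq0 => /orP[|/eqP//].
rewrite -!natr1 (_ : _ - _ = (l'%:R - l%:R) * (l'%:R + l%:R + 1)); last by ring.
by rewrite mulf_eq0 subr_eq0 eqr_nat eq_sym (negPf ll')/= gt_eqF ?ltr_wpDl ?addr_ge0 ?ler0n.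
Qed.

Lemma int11_wt k : int11 (wt k) = 2 ^+ (2 * k).+1 * k`!%:R ^+ 2 / (2 * k).+1`!%:R.
Proof.
have F n : n`!%:R != 0 :> R by rewrite pnatr_eq0 -lt0n fact_gt0.
elim: k => [|k IH].
  rewrite /wt expr0 muln0 fact0 expr1 (factS 0) fact0 muln1 expr1n mulr1 divr1.
  by rewrite -(derivX R) int11_deriv !hornerX opprK.
have := int11_deriv ('X * wt k.+1).
rewrite !hornerM /wt !horner_exp !hornerE /= sqrrN expr1n subrr expr0n /= !(mul0r, mulr0) subrr.
rewrite derivM derivX deriv_exp !deriv_simp.
rewrite (_ : _ + _ = (2 * k.+1 + 1)%:R *: wt k.+1 + (- (2 * k.+1)%:R) *: wt k); last first.
  rewrite -!mul_polyC polyCN !polyC_natr /wt exprS natrD natrM; ring.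
rewrite int11D !int11Z IH mulNr => /eqP; rewrite subr_eq0 => /eqP H.
have k1 : (2 * k.+1 + 1)%:R != 0 :> R by rewrite pnatr_eq0 addn1.
apply: (mulfI k1); rewrite H.
have -> : (2 * k.+1).+1 = ((2 * k).+1.+2)%N by lia.
rewrite (factS (2 * k).+2) (factS (2 * k).+1) (factS k) (exprS _ (2 * k).+2) (exprS _ (2 * k).+1).
have := F (2 * k).+1; have := F k.
move: (2 ^+ _) (k`!) ((2 * k).+1)`! => a x y x0 y0; rewrite !natrM.
have -> : (2 * k.+1 + 1)%:R = 2 * k%:R + 3 :> R by rewrite -natr1 natrD natrM; ring.
have -> : (2 * k).+3%:R = 2 * k%:R + 3 :> R by rewrite -!natr1 natrM; ring.
have -> : (2 * k).+2%:R = 2 * (k%:R + 1) :> R by rewrite -!natr1 natrM; ring.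
rewrite -(natr1 k); by field; rewrite y0 !gt_eqF// ltr_wpDl ?mulr_ge0 ?ler0n.
Qed.

(** Descent in k by [legendre_gramS] from k = l, where P_l^(l) is constant and only
    the integral of the weight remains. *)
Lemma legendre_gram_diag l k : (k <= l)%N ->
  legendre_gram k l l = 2 / (2 * l + 1)%:R * ((l + k)`!%:R / (l - k)`!%:R).
Proof.
have F n : n`!%:R != 0 :> R by rewrite pnatr_eq0 -lt0n fact_gt0.
move=> kl; rewrite -(subKn kl); move: (l - k)%N (leq_subr k l) => i {kl k}.
elim: i => [_|i IH il].
  rewrite subn0 subnn fact0 divr1.
  have [c cE] : exists c, P l l = c%:P.
    by exists (P l l)`_0; apply: size1_polyC; rewrite (leq_trans (size_legendre _ _))// subnn.
  have := legendre_derivn1 (leqnn l); rewrite cE hornerC subnn fact0 mul1r addnn -mul2n => c1.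
  have -> : legendre_gram l l l = c ^+ 2 * int11 (wt l).
    by rewrite -int11Z /legendre_gram cE -mul_polyC; congr int11; ring.
  rewrite int11_wt c1 (factS (2 * l)) addn1 (exprS _ (2 * l)) (mulnC 2%N l) (exprM _ l).
  have := F (l * 2)%N; have := F l.
  have : (l * 2).+1%:R != 0 :> R by rewrite pnatr_eq0.
  have : 2 ^+ l != 0 :> R by rewrite expf_neq0 ?pnatr_eq0.
  move: (2 ^+ l) (l`!) ((l * 2)`!) => x y z x0 t0 y0 z0; rewrite natrM.
  move: (l * 2).+1%:R t0 => t t0.
  by field; rewrite ?x0 ?y0 ?z0 ?t0.
have /IH {}IH := ltnW il.
have := legendre_gramS (l - i.+1) l l; rewrite subnSK// IH.
have -> : (l - (l - i) = i)%N by lia.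
have -> : (l - (l - i.+1) = i.+1)%N by lia.
have El : l%:R = (l - i.+1)%:R + i%:R + 1 :> R by rewrite -natrD natr1 -addnS subnK.
have -> : (l - i = (l - i.+1).+1)%N by rewrite subnSK.
move: (l - i.+1)%N El => k El; move: (legendre_gram _ _ _) => G E.
rewrite (addnS l k) (factS (l + k)) in E; rewrite (factS i).
have lk0 : (l + k).+1%:R != 0 :> R by rewrite pnatr_eq0.
have i0 : i.+1%:R != 0 :> R by rewrite pnatr_eq0.
have {}El : l%:R * l.+1%:R - k%:R * k.+1%:R = i.+1%:R * (l + k).+1%:R :> R.
  by rewrite -!natr1 natrD El; ring.
apply: (mulfI (mulf_neq0 i0 lk0)); rewrite -El -E.
have l0 : (2 * l + 1)%:R != 0 :> R by rewrite addn1 pnatr_eq0.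
rewrite El; move: i0 lk0 l0 (F (l + k)%N) (F i).
move: (2 * l + 1)%N (l + k).+1 i.+1 (l + k)`! (i`!) => a b c d e.
by move=> x y z t u; rewrite !natrM; field; rewrite x z u.
Qed.

(** The i-th of these polynomials has degree exactly i, so that the family is
    triangular with respect to the monomials. *)
Lemma legendre_derivn_span m n q : (size q <= n.+1)%N ->
  exists a : nat -> R, q = \sum_(i < n.+1) a i *: P (m + i) m.
Proof.
elim: n q => [|n IH] q sq.
  have /negPf p0 := coef_legendre_top (leqnn m); rewrite subnn in p0.
  exists (fun=> q`_0 / (P m m)`_0); rewrite big_ord1 addn0.
  have sp := size_legendre m m; rewrite subnn in sp.
  rewrite (size1_polyC sp) (size1_polyC sq) !coefC/= -mul_polyC -polyCM.
  by rewrite divfK// p0.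
have /negPf p0 := coef_legendre_top (leq_addr n.+1 m); rewrite addKn in p0.
have sp := size_legendre (m + n.+1) m; rewrite addKn in sp.
set f := P (m + n.+1) m in p0 sp *.
have [|a qE] := IH (q - (q`_n.+1 / f`_n.+1) *: f).
  apply/leq_sizeP => j; rewrite leq_eqVlt => /predU1P[<-|nj].
    by rewrite coefB coefZ divfK ?p0// subrr.
  by rewrite coefB coefZ !(nth_default _ (leq_trans _ nj)) ?mulr0 ?subrr.
exists (fun i => if i == n.+1 then q`_n.+1 / f`_n.+1 else a i).
rewrite big_ord_recr/= eqxx -/f; apply/eqP; rewrite -subr_eq; apply/eqP.
rewrite qE; apply: eq_bigr => i _; case: ifP => // /eqP iE.
by have := ltn_ord i; rewrite iE ltnn.
Qed.

(** The addition theorem for a fixed order m. Write P_l(z w + h) for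
    h = sqrt ((1 - z^2) (1 - w^2)) cos phi by Taylor's formula at z w: its Fourier
    coefficient of order m in phi is, up to a power of (1 - z^2) (1 - w^2), the sum
    over j of the polynomials [addterm w (1 - w^2) l m j] in z. *)
Let addterm (w s : R) l m j : {poly R} :=
  (s ^+ j / ((m + j)`!%:R * j`!%:R * 2 ^+ (m + 2 * j))) *:
    (wt j * (P l (m + 2 * j) \Po (w *: 'X))).

Let ode l m p := (1 - 'X^2) * p^`()^`() - 2%:R * m.+1%:R * 'X * p^`()
  + (l%:R * l.+1%:R - m%:R * m.+1%:R) * p.

Let odeD l m p q : ode l m (p + q) = ode l m p + ode l m q.
Proof. by rewrite /ode !derivD; ring. Qed.

Let odeZ l m a p : ode l m (a *: p) = a *: ode l m p.
Proof. by rewrite /ode !derivZ -!mul_polyC; ring. Qed.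

Let ode_base (w : R) l m j : let f i := P l i \Po (w *: 'X) in
  ode l m (wt j * f (m + 2 * j)%N) =
  4%:R * j%:R * (j%:R + m%:R) * (wt j.-1 * f (m + 2 * j)%N)
  - (1 - w ^+ 2)%:P * (wt j * f (m + 2 * j).+2).
Proof.
move=> f.
have df i : (f i)^`() = w%:P * f i.+1.
  by rewrite /f deriv_comp derivZ derivX alg_polyC mulrC.
have odef i : (1 - w%:P ^+ 2 * 'X^2) * f i.+2 - 2%:R * i.+1%:R * (w%:P * 'X) * f i.+1
  + (l%:R * l.+1%:R - i%:R * i.+1%:R) * f i = 0.
  have /(congr1 (fun p => p \Po (w *: 'X))) := legendre_ode l i.
  have cn n : (n%:R \Po (w *: 'X) : {poly R}) = n%:R by rewrite -polyC_natr comp_polyC.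
  rewrite !(comp_polyB, comp_polyD, comp_polyM, comp_Xn_poly, cn, comp_polyX) (cn 1) (cn 0) -/(f _) -/(f _) -/(f _).
  by rewrite -!mul_polyC => E; etransitivity; [|exact: E]; ring.
rewrite /ode.
have dw : (wt j)^`() = - (2%:R * j%:R * 'X * wt j.-1).
  by rewrite /wt deriv_exp !deriv_simp /= -mulr_natl; ring.
have dw2 : (1 - 'X^2) * (wt j.-1)^`() = - (2%:R * (j.-1)%:R * 'X * wt j.-1).
  case: j.-1 => [|n]; first by rewrite /wt expr0 derivC; ring.
  by rewrite /wt deriv_exp !deriv_simp /= -mulr_natl (exprS _ n); ring.
have wE : j%:R * wt j = j%:R * (1 - 'X^2) * wt j.-1.
  by case: (j) => [|i]; rewrite /= ?mul0r// /wt (exprS _ i); ring.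
have jE : j%:R * j.-1%:R = j%:R * (j%:R - 1) :> {poly R}.
  by case: (j) => [|i]; rewrite /= ?mul0r// -natr1; ring.
set k := (m + 2 * j)%N.
have kE : k%:R = m%:R + 2%:R * j%:R :> {poly R} by rewrite /k natrD natrM.
have := odef k.
rewrite !(deriv_simp, df, dw) -(natr1 l) -(natr1 m) -(natr1 k) kE polyCB polyCM.
move: (f k) (f k.+1) (f k.+2) (wt j) (wt j.-1) (wt j.-1)^`() (j%:R) ((j.-1)%:R) wE dw2 jE.
move=> f0 f1 f2 v v' dv x x' wE dw2 jE E.
have {}wE : x * v - x * (1 - 'X^2) * v' = 0 by rewrite wE subrr.
have {}dw2 : (1 - 'X^2) * dv + 2%:R * x' * 'X * v' = 0 by rewrite dw2 addNr.
have {}jE : x * x' - x * (x - 1) = 0 by rewrite jE subrr.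
apply/eqP; rewrite -subr_eq0; apply/eqP.
(* The difference of the two sides, written as a combination of Legendre's equation
   at w X and of the three relations between the weights. *)
transitivity (v * ((1 - w%:P ^+ 2 * 'X^2) * f2 -
    2%:R * (m%:R + 2%:R * x + 1) * (w%:P * 'X) * f1 +
    (l%:R * (l%:R + 1) - (m%:R + 2%:R * x) * (m%:R + 2%:R * x + 1)) * f0)
  + (x * v - x * (1 - 'X^2) * v') * (2%:R * f0 + 4%:R * (x - 1) * f0
      + 4%:R * 'X * w%:P * f1 + 4%:R * (m%:R + 1) * f0)
  - ((1 - 'X^2) * dv + 2%:R * x' * 'X * v') * (2%:R * x * 'X * f0)
  + (x * x' - x * (x - 1)) * (4%:R * 'X^2 * v' * f0)).
  by ring.
by rewrite E wE dw2 jE; ring.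
Qed.

(** The operator [ode] maps the j-th term to a difference of consecutive terms of a
    sequence ([ode_base]). The sum telescopes, and its last term vanishes because it
    contains a derivative of P_l of order above l. *)
Lemma addition_block_ode (w : R) l m (s := 1 - w ^+ 2) :
  ode l m (\sum_(j < l.+1) addterm w s l m j) = 0.
Proof.
have F n : n`!%:R != 0 :> R by rewrite pnatr_eq0 -lt0n fact_gt0.
pose c j : R := s ^+ j / ((m + j)`!%:R * j`!%:R * 2 ^+ (m + 2 * j)).
pose g j := (c j * s) *: (wt j * (P l (m + 2 * j).+2 \Po (w *: 'X))).
have T j : ode l m (addterm w s l m j) = (if j is i.+1 then g i else 0) - g j.
  rewrite odeZ ode_base scalerBr -/(c j); congr (_ - _); last first.
    by rewrite /g mul_polyC scalerA.
  case: j => [|j]; first by rewrite mulr0 !mul0r scaler0.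
  have kE : (m + 2 * j.+1)%N = (m + 2 * j).+2 by lia.
  rewrite /g /= kE -natrD -!natrM mulr_natl -[X in c _ *: X]scaler_nat scalerA; congr (_ *: _).
  rewrite /c kE addnS (factS j) (factS (m + j)) !(exprS _ (_ + _).+1) (exprS _ (m + 2 * j)) (exprS _ j).
  have := expf_neq0 (m + 2 * j) (_ : 2 != 0 :> R); rewrite pnatr_eq0 => /(_ isT).
  have := F j; have := F (m + j)%N; have : j.+1%:R != 0 :> R by rewrite pnatr_eq0.
  have : (m + j).+1%:R != 0 :> R by rewrite pnatr_eq0.
  rewrite (_ : (j.+1 + m = (m + j).+1)%N); last by lia.
  move: (m + j).+1 (m + j)`! (j`!) j.+1 (2 ^+ _) (s ^+ j) => a b d e y z a0 e0 b0 d0 y0.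
  by rewrite !natrM; field; rewrite a0 b0 d0 e0 y0.
have S n : ode l m (\sum_(j < n.+1) addterm w s l m j) = - g n.
  elim: n => [|n IH]; first by rewrite big_ord1 T sub0r.
  by rewrite big_ord_recr odeD IH T /= addrA addNr add0r.
by rewrite S /g legendre_derivn_eq0 ?comp_poly0 ?mulr0 ?scaler0 ?oppr0//; lia.
Qed.

Lemma ode_legendre l m p : (m <= l)%N -> ode l m p = 0 ->
  p = (p.[1] / (P l m).[1]) *: P l m.
Proof.
move=> ml op; have ft := coef_legendre_top ml.
have E : p = (p`_(l - m) / (P l m)`_(l - m)) *: P l m.
  apply/eqP; rewrite -subr_eq0 -scaleNr; apply/eqP.
  apply: (legendre_ode_unique ml).
    by rewrite -/(ode l m _) odeD odeZ op /ode -!derivnS legendre_ode scaler0 add0r.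
  by rewrite coefD coefZ mulNr divfK// subrr.
have f1 : (P l m).[1] != 0.
  rewrite legendre_derivn1// !mulf_neq0 ?invr_neq0 ?mulf_neq0 ?expf_neq0 ?pnatr_eq0 -?lt0n ?fact_gt0//.
by rewrite {2}E hornerZ mulfK.
Qed.

(** Both sides solve the same equation in z, hence are proportional by
    [ode_legendre]; at z = 1 only the term j = 0 remains and gives the constant. *)
Lemma addition_block (w z : R) l m : (m <= l)%N ->
  \sum_(j < l.+1) (((1 - z ^+ 2) * (1 - w ^+ 2)) ^+ j
     / ((m + j)`!%:R * j`!%:R * 2 ^+ (m + 2 * j)))
     * (P l (m + 2 * j)).[z * w]
  = (l - m)`!%:R / (l + m)`!%:R * (P l m).[z] * (P l m).[w].
Proof.
move=> ml; have F n : n`!%:R != 0 :> R by rewrite pnatr_eq0 -lt0n fact_gt0.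
have := ode_legendre ml (addition_block_ode w l m).
set A := \sum_(j < _) _.
have hA x : A.[x] = \sum_(j < l.+1) (((1 - x ^+ 2) * (1 - w ^+ 2)) ^+ j
     / ((m + j)`!%:R * j`!%:R * 2 ^+ (m + 2 * j))) * (P l (m + 2 * j)).[x * w].
  rewrite horner_sum; apply: eq_bigr => j _.
  have hw : (1 - 'X^2 : {poly R}).[x] = 1 - x ^+ 2 by rewrite !hornerE.
  rewrite hornerZ hornerM /wt horner_exp horner_comp hw hornerZ hornerX (mulrC w) exprMn.
  ring.
rewrite -hA => ->; rewrite hornerZ [RHS]mulrAC; congr (_ * _).
rewrite legendre_derivn1// hA big_ord_recl big1 => [|j _].
  rewrite expr1n subrr mul0r expr0 muln0 !addn0 fact0 !mul1r addr0.
  have := expf_neq0 m (_ : 2 != 0 :> R); rewrite pnatr_eq0 => /(_ isT).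
  move: (F m) (F (l - m)%N) (F (l + m)%N) (2 ^+ m) => + + + x.
  move: (m`!) (l - m)`! (l + m)`! => a b c a0 b0 c0 x0.
  by field; rewrite a0 b0 c0 x0.
by rewrite expr1n subrr mul0r exprS !mul0r.
Qed.

End Legendre.

(** * Spherical harmonics as polynomials on the sphere *)

Section SphereAlgebra.
Context {R : realType}.
Local Notation S2 := (sphere R).
Local Notation P l k := ((@legendre R l)^`(k)).
Implicit Types (x y : S2) (q : {poly R}) (m n : int) (l : nat).

Definition height x : R := (val x).2.
(** In polar angles this is sin theta * e^(i phi). *)
Definition zeta x : R[i] := Complex (val x).1.1 (val x).1.2.

(** The conjugate plays the part of the inverse, so that this is
    (sin theta)^|n| e^(i n phi), a polynomial in the coordinates for every n. *)
Definition zetaX n x : R[i] :=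
  match n with Posz n => zeta x ^+ n | Negz n => (zeta x)^*%C ^+ n.+1 end.

(** These products span the polynomial functions on the sphere, and each of them
    has a single Fourier order n in the longitude. *)
Definition sphmono q n x : R[i] := (q.[height x])%:C%C * zetaX n x.

Lemma zeta_conj x : zeta x * (zeta x)^*%C = (1 - height x ^+ 2)%:C%C.
Proof.
have /eqP := valP x; rewrite /zeta /height; case: (val x) => -[a b] c /= E.
apply/eqP; rewrite eq_complex /=; apply/andP; split; apply/eqP; last by ring.
by rewrite -E; ring.
Qed.

Lemma conj_zetaX n x : (zetaX n x)^*%C = zetaX (- n) x.
Proof.
case: n => [[|n]|n]; rewrite ?oppr0 /zetaX ?expr0 ?rmorph1//.
  by rewrite rmorphXn.
by rewrite rmorphXn; congr (_ ^+ _); exact: conjcK.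
Qed.

(** Cancelling zeta against its conjugate produces 1 - x3^2, a polynomial in the
    height. The relation between the exponents keeps track of the degree. *)
Lemma zetaX_mul m n : exists2 e, (`|m| + `|n| = `|(m + n)%R| + 2 * e)%N &
  forall x, zetaX m x * zetaX n x = (((1 - 'X^2) ^+ e).[height x])%:C%C * zetaX (m + n) x.
Proof.
wlog mn : m n / (`|n| <= `|m|)%N => [W|].
  have [|/ltnW] := leqP `|n| `|m|; first exact: W.
  move=> /W[e eE h]; exists e; first by rewrite addnC eE (addrC m n).
  by move=> x; rewrite mulrC h (addrC m n).
have pE e x : (((1 - 'X^2) ^+ e : {poly R}).[height x])%:C%C = (zeta x * (zeta x)^*%C) ^+ e.
  by rewrite zeta_conj horner_exp !hornerE rmorphXn.
case: m n mn => [m|m] [n|n] /= mn.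
- exists 0%N; first by rewrite addn0.
  by move=> x; rewrite expr0 hornerC mul1r -exprD.
- exists n.+1; first by lia.
  move=> x; rewrite pE.
  have -> : Posz m + Negz n = (m - n.+1)%N by lia.
  by rewrite /= exprMn -{1}(subnK mn) exprD; ring.
- exists n; first by lia.
  move=> x; rewrite pE.
  have [E|mn'] := leqP m.+1 n.
    have {mn}E : n = m.+1 by apply/eqP; rewrite eqn_leq mn E.
    rewrite E (_ : Negz m + m.+1%:Z = 0); last by lia.
    by rewrite /= exprMn expr0 mulr1 mulrC.
  have -> : Negz m + n = Negz (m - n)%N by lia.
  by rewrite /= exprMn -subSn// -{1}(subnK mn) exprD; ring.
- exists 0%N; first by lia.
  move=> x; rewrite expr0 hornerC mul1r.
  by rewrite /= -exprD addSn addnS.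
Qed.

Lemma zetaX_norm n x :
  zetaX n x * (zetaX n x)^*%C = (((1 - 'X^2) ^+ `|n|).[height x])%:C%C.
Proof.
have [e] := zetaX_mul n (- n).
rewrite subrr abszN absz0 add0n addnn mul2n => /double_inj <- h.
by rewrite conj_zetaX h /= mulr1.
Qed.

Definition ynorm l n : R :=
  Num.sqrt ((2 * l + 1)%N%:R / (4 * pi) * ((l - `|n|)%N`!%:R / (l + `|n|)%N`!%:R)).

(** The Condon-Shortley phase, which cancels out for negative orders. *)
Definition ysign n : R := if n is Posz n then (-1) ^+ n else 1.

Lemma ynorm_arg_gt0 l n :
  0 < (2 * l + 1)%N%:R / (4 * pi) * ((l - `|n|)%N`!%:R / (l + `|n|)%N`!%:R) :> R.
Proof.
by rewrite mulr_gt0// divr_gt0 ?mulr_gt0 ?pi_gt0// ?ltr0n ?fact_gt0// addn1.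
Qed.

Lemma ysign_sqr n : ysign n ^+ 2 = 1.
Proof. by case: n => n /=; rewrite ?expr1n// sqrr_sign. Qed.

Lemma conjc_realM (a : R) (z : R[i]) : (a%:C%C * z)^*%C = a%:C%C * z^*%C.
Proof. by rewrite rmorphM; congr (_ * _); exact: conjc_real. Qed.

Lemma sphericalYE l n x :
  sphericalY l n x = sphmono ((ysign n * ynorm l n) *: P l `|n|) n x.
Proof.
rewrite /sphmono hornerZ; case: n => n; first by [].
rewrite /sphericalY /sphericalY_nat conjc_realM rmorphXn [LHS]mulrA; congr (_ * _).
rewrite -(rmorphN1 (@real_complex R)) -rmorphXn -rmorphM; congr (_%:C)%C.
rewrite -[in LHS](mulrA ((-1) ^+ n.+1)) [LHS]mulrA -expr2 sqrr_sign mul1r.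
by rewrite /ysign mul1r.
Qed.

Lemma sphmonoZ a q n x : sphmono (a *: q) n x = a%:C%C * sphmono q n x.
Proof. by rewrite /sphmono hornerZ rmorphM mulrA. Qed.

Lemma sphmono_sum N (F : 'I_N -> {poly R}) n x :
  sphmono (\sum_(i < N) F i) n x = \sum_(i < N) sphmono (F i) n x.
Proof. by rewrite /sphmono horner_sum rmorph_sum mulr_suml. Qed.

Lemma sphmonoM q1 q2 m n : exists2 e, (`|m| + `|n| = `|(m + n)%R| + 2 * e)%N &
  forall x, sphmono q1 m x * sphmono q2 n x = sphmono (q1 * q2 * (1 - 'X^2) ^+ e) (m + n) x.
Proof.
have [e eE h] := zetaX_mul m n; exists e => // x.
rewrite /sphmono [LHS]mulrACA h !hornerM !rmorphM /=; ring.
Qed.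

Lemma conj_mono q n x : (sphmono q n x)^*%C = sphmono q (- n) x.
Proof. by rewrite /sphmono conjc_realM conj_zetaX. Qed.

Lemma size_sphere_weight e : size ((1 - 'X^2) ^+ e : {poly R}) = (2 * e).+1.
Proof.
by rewrite -opprB exprNn -signr_odd mulr_sign; case: ifP => _; rewrite ?size_polyN size_legendre_pow.
Qed.

(** By [legendre_derivn_span] the polynomial q is a combination of the derivatives
    P_l^(|n|) with |n| <= l <= L, and each of these yields a multiple of Y_ln. *)
Lemma harmonic_sum_mono L q n : (size q + `|n| <= L.+1)%N ->
  harmonic_sum L (sphmono q n).
Proof.
have [->|q0] := eqVneq q 0.
  move=> _; exists (fun _ _ => 0) => [l _|].
    by exists (fun=> 0); apply/funext => x; rewrite big1// => k _; rewrite mul0r.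
  by apply/funext => x; rewrite big1// /sphmono horner0 mul0r.
move=> sq.
have nL : (`|n| <= L)%N by move: q0; rewrite -size_poly_gt0; lia.
have [|a qE] := @legendre_derivn_span R `|n| (L - `|n|)%N q; first by lia.
pose c l := ysign n * ynorm l n.
have c0 l : c l != 0.
  rewrite mulf_neq0 ?sqrtr_eq0 -?ltNge ?ynorm_arg_gt0//.
  by rewrite -sqrf_eq0 ysign_sqr oner_eq0.
pose Y l x := if (`|n| <= l)%N then (a (l - `|n|)%N)%:C%C * sphmono (P l `|n|) n x else 0.
exists Y => [l lL|].
  exists (fun k => if (`|n| <= l)%N && (k == n) then (a (l - `|n|)%N / c l)%:C%C else 0).
  apply/funext => x; rewrite /Y; case: ifP => nl /=; last first.
    by rewrite big1// => k _; rewrite mul0r.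
  (* The order n is the index n + l in the enumeration of the orders from -l. *)
  have kn : (`|(n + l%:Z)%R| < (2 * l).+1)%N by lia.
  rewrite (bigD1 (Ordinal kn))//= big1 ?addr0 => [|k /eqP kk].
    have -> : Posz `|(n + l%:Z)%R|%N - l%:Z = n by lia.
    rewrite eqxx sphericalYE sphmonoZ -/(c l) mulrA -rmorphM divfK//.
  case: ifP => [/eqP E|]; last by rewrite mul0r.
  by case: kk; apply/val_inj => /=; lia.
apply/funext => x; rewrite qE sphmono_sum.
under eq_bigr => i _ do rewrite sphmonoZ.
rewrite -(big_mkord xpredT (fun i => (a i)%:C%C * sphmono (P (`|n| + i) `|n|) n x)).
have -> : \sum_(l < L.+1) Y l x = \sum_(`|n| <= l < L.+1) Y l x.
  rewrite -(big_mkord xpredT (fun l => Y l x)) (big_cat_nat _ (n := `|n|%N)) ?leqW//=.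
  rewrite [X in X + _]big1_seq ?add0r// => l.
  by rewrite mem_index_iota /Y /= ltnNge => /negPf ->.
rewrite -[in RHS](add0n `|n|%N) big_addn subSn//; apply: eq_bigr => i _.
by rewrite /Y leq_addl addnK addnC.
Qed.

(** Why a quadrature of twice the degree integrates products exactly: the product
    has order m - n, and its polynomial factor has the degree that
    [harmonic_sum_mono] requires. *)
Lemma sphericalY_prod l l' L m n : (`|m| <= l)%N -> (`|n| <= l')%N ->
  (l + l' <= L)%N -> harmonic_sum L (fun x => sphericalY l m x * (sphericalY l' n x)^*%C).
Proof.
move=> ml nl lL; set c := ysign m * ynorm l m; set c' := ysign n * ynorm l' n.
have [e eE h] := sphmonoM (c *: P l `|m|) (c' *: P l' `|n|) m (- n).
have s1 : (size (c *: P l `|m|) <= (l - `|m|).+1)%N.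
  exact: leq_trans (size_scale_leq _ _) (size_legendre _ _).
have s2 : (size (c' *: P l' `|n|) <= (l' - `|n|).+1)%N.
  exact: leq_trans (size_scale_leq _ _) (size_legendre _ _).
rewrite (_ : (fun x => _) = sphmono (c *: P l `|m| * (c' *: P l' `|n|) * (1 - 'X^2) ^+ e) (m - n)); last first.
  by apply/funext => x; rewrite !sphericalYE conj_mono h.
move: (c *: P l `|m|) (c' *: P l' `|n|) s1 s2 => A B s1 s2.
apply: harmonic_sum_mono; rewrite abszN in eE.
have := size_polyMleq (A * B) ((1 - 'X^2) ^+ e); rewrite size_sphere_weight => s3.
have s4 := size_polyMleq A B.
move: (size A) (size B) (size (A * B)) (size (A * B * _)) s1 s2 s3 s4.
by move: `|m|%N `|n|%N `|(m - n)%R|%N ml nl lL eE => a1 b1 c1 ml nl lL eE a b ab s; lia.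
Qed.

End SphereAlgebra.

(** * The addition theorem *)

Section DiagonalSums.
Context {V : nmodType}.
Implicit Types (G : nat -> nat -> V).

Lemma sum_shift_vanish (H : nat -> V) N i : (i <= N)%N ->
  (forall k, (N <= k)%N -> H k = 0) ->
  \sum_(0 <= k < N) (if (i <= k)%N then H k else 0) = \sum_(0 <= m < N) H (m + i)%N.
Proof.
move=> iN H0; rewrite -big_mkcond -(big_nat_widenl i 0 N xpredT)//.
rewrite -[X in \sum_(X <= _ < _) _]add0n big_addn.
rewrite [RHS](big_cat_nat _ (n := (N - i)%N)) ?leq_subr//= [X in _ + X]big1_seq ?addr0// => m.
by rewrite mem_index_iota /= leq_subLR addnC => /andP[/H0].
Qed.

Lemma triangle_to_square G N :
  (forall i j, (N <= i + j)%N -> G i j = 0) ->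
  \sum_(0 <= k < N) \sum_(0 <= i < k.+1) G (k - i)%N i =
  \sum_(0 <= j < N) \sum_(0 <= i < N) G i j.
Proof.
move=> G0.
transitivity (\sum_(0 <= k < N) \sum_(0 <= j < N) (if (j <= k)%N then G (k - j)%N j else 0)).
  apply: eq_big_nat => k /andP[_ kN].
  by rewrite (big_nat_widen _ _ N)//= -big_mkcond.
rewrite exchange_big_nat; apply: eq_big_nat => j /andP[_ jN].
rewrite (sum_shift_vanish (H := fun k => G (k - j)%N j) (ltnW jN)); last first.
  by move=> k Nk; rewrite G0// subnK// (leq_trans (ltnW jN)).
by apply: eq_bigr => i _; rewrite addnK.
Qed.

(** The diagonals i - j = m collect the terms of Fourier order m. *)
Lemma square_to_diagonals G N :
  (forall i j, (N <= i + j)%N -> G i j = 0) ->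
  \sum_(0 <= j < N) \sum_(0 <= i < N) G i j =
  \sum_(0 <= m < N) \sum_(0 <= j < N) G (m + j)%N j
  + \sum_(0 <= m < N) \sum_(0 <= j < N) G j (m.+1 + j)%N.
Proof.
move=> G0.
rewrite [X in X + _]exchange_big_nat [X in _ + X]exchange_big_nat/=.
transitivity (\sum_(0 <= j < N) \sum_(0 <= i < N) (if (j <= i)%N then G i j else 0)
  + \sum_(0 <= j < N) \sum_(0 <= i < N) (if (j < i)%N then G j i else 0)).
  rewrite [X in _ + X]exchange_big_nat -big_split; apply: eq_bigr => j _ /=.
  rewrite -big_split; apply: eq_bigr => i _ /=.
  by case: ltnP => _; rewrite ?add0r ?addr0.
congr (_ + _); apply: eq_big_nat => j /andP[_ jN].
  rewrite (sum_shift_vanish (H := fun i => G i j) (ltnW jN))// => k Nk.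
  by rewrite G0// (leq_trans Nk)// leq_addr.
rewrite (sum_shift_vanish (H := fun i => G j i) jN) => [|k Nk].
  by apply: eq_bigr => m _; rewrite addnS addSn.
by rewrite G0// (leq_trans Nk)// leq_addl.
Qed.
End DiagonalSums.

Section Addition.
Context {R : realType}.
Local Notation S2 := (sphere R).
Local Notation P l k := ((@legendre R l)^`(k)).
Implicit Types (x y : S2) (l : nat).

Lemma sum_orders (V : nmodType) (F : int -> V) l :
  \sum_(k < (2 * l)%N.+1) F (k%:Z - l%:Z) =
  \sum_(0 <= m < l.+1) F m%:Z + \sum_(0 <= m < l) F (Negz m).
Proof.
rewrite -(big_mkord xpredT (fun k : nat => F (k%:Z - l%:Z))).
rewrite (big_cat_nat _ (n := l)) ?leqW ?leq_pmull//= addrC; congr (_ + _).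
  rewrite -{1}[l]add0n big_addn (_ : ((2 * l).+1 - l = l.+1)%N); last by lia.
  by apply: eq_bigr => i _; congr F; lia.
rewrite big_nat_rev/=; apply: eq_big_nat => i /andP[_ il].
by congr F; lia.
Qed.

Lemma legendre_taylor l (a h : R) : (@legendre R l).[a + h] =
  \sum_(0 <= k < l.+1) (P l k).[a] / k`!%:R * h ^+ k.
Proof.
rewrite nderiv_taylor; last exact: mulrC.
have E k : (@legendre R l)^`N(k).[a] * h ^+ k = (P l k).[a] / k`!%:R * h ^+ k.
  by rewrite nderivn_def hornerMn -[X in X / _]mulr_natr mulfK ?pnatr_eq0 -?lt0n ?fact_gt0.
under eq_bigr => k _ do rewrite E.
rewrite -(big_mkord xpredT (fun k => (P l k).[a] / k`!%:R * h ^+ k)).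
have sl : (size (@legendre R l) <= l.+1)%N by have := size_legendre l 0; rewrite subn0.
rewrite [RHS](big_cat_nat _ (n := size (@legendre R l)))//= [X in _ + X]big1_seq ?addr0// => k.
rewrite mem_index_iota => /andP[_ /andP[sk _]].
have -> : P l k = 0 by exact: derivn_poly0.
by rewrite horner0 !mul0r.
Qed.

Lemma sphericalY_diag l (m : int) x y :
  sphericalY l m x * (sphericalY l m y)^*%C =
  ((2 * l + 1)%N%:R / (4 * pi) * ((l - `|m|)%N`!%:R / (l + `|m|)%N`!%:R
    * (P l `|m|).[height x] * (P l `|m|).[height y]))%:C%C * (zetaX m x * zetaX (- m) y).
Proof.
rewrite !sphericalYE conj_mono /sphmono !hornerZ mulrACA -rmorphM; congr (_%:C%C * _).
set a := ysign m; set N := ynorm l m; set p := _.[height x]; set q := _.[height y].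
transitivity (a ^+ 2 * N ^+ 2 * (p * q)); first by ring.
by rewrite ysign_sqr sqr_sqrtr ?(ltW (ynorm_arg_gt0 _ _))//; ring.
Qed.

Lemma dotS_zeta x y : (dotS x y)%:C%C = (height x * height y)%:C%C +
   (zeta x * (zeta y)^*%C + (zeta x)^*%C * zeta y) * (2^-1)%:C%C.
Proof.
rewrite /dotS /height /zeta; case: (val x) (val y) => -[a b] c [[p q] r] /=.
by apply/eqP; rewrite eq_complex /=; apply/andP; split; apply/eqP; field.
Qed.

(** Let z and w be the heights, u = zeta x * conj (zeta y) and v = conj u. Then
    x . y = z w + (u + v) / 2, and Taylor's and Newton's formulas expand
    P_l (x . y) in the monomials u^i v^j. As u v = (1 - z^2) (1 - w^2) only depends
    on the heights, those with i - j = m add up to the block of [addition_block]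
    times u^m (or v^(-m) when m < 0), which is the term of order m. *)
Lemma zonal_addition l x y : (zonal l (dotS x y))%:C%C =
  \sum_(k < (2 * l)%N.+1)
    sphericalY l (k%:Z - l%:Z) x * (sphericalY l (k%:Z - l%:Z) y)^*%C.
Proof.
rewrite (sum_orders (fun m => sphericalY l m x * (sphericalY l m y)^*%C)).
pose z := height x; pose w := height y.
pose u := zeta x * (zeta y)^*%C; pose v := (zeta x)^*%C * zeta y.
have uv : u * v = ((1 - z ^+ 2) * (1 - w ^+ 2))%:C%C.
  by rewrite rmorphM /= -!zeta_conj /u /v; ring.
pose h := dotS x y - z * w.
have hE : h%:C%C = (u + v) * (2^-1)%:C%C.
  by rewrite rmorphB /= dotS_zeta addrAC subrr add0r.
have F n : n`!%:R != 0 :> R by rewrite pnatr_eq0 -lt0n fact_gt0.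
pose G i j : R[i] := ((P l (i + j)).[z * w] / (i`!%:R * j`!%:R * 2 ^+ (i + j)))%:C%C
  * u ^+ i * v ^+ j.
have G0 i j : (l.+1 <= i + j)%N -> G i j = 0.
  by move=> ij; rewrite /G legendre_derivn_eq0// horner0 !mul0r.
have PE : ((@legendre R l).[dotS x y])%:C%C =
   \sum_(0 <= k < l.+1) \sum_(0 <= i < k.+1) G (k - i)%N i.
  have -> : dotS x y = z * w + h by rewrite /h addrC subrK.
  rewrite legendre_taylor rmorph_sum; apply: eq_big_nat => k _.
  rewrite rmorphM rmorphXn /= hE exprMn exprDn big_mkord mulr_suml mulr_sumr.
  apply: eq_bigr => i _; have ik : (i <= k)%N by rewrite -ltnS.
  rewrite /G subnK//.
  have -> : (P l k).[z * w] / ((k - i)`!%:R * i`!%:R * 2 ^+ k) =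
    (P l k).[z * w] / k`!%:R * 'C(k, i)%:R * 2^-1 ^+ k.
    rewrite -(bin_fact ik) !natrM exprVn; field.
    by rewrite !F expf_neq0 ?pnatr_eq0// -lt0n bin_gt0 ik.
  by rewrite !rmorphM rmorphXn /= rmorph_nat -[X in _ * (X * _)]mulr_natr; ring.
(* Below, the monomials with i - j = m carry the factor (u v)^j u^m. *)
have diag m (j : nat) : G (m + j)%N j = (((1 - z ^+ 2) * (1 - w ^+ 2)) ^+ j
     / ((m + j)`!%:R * j`!%:R * 2 ^+ (m + 2 * j))
     * (P l (m + 2 * j)).[z * w])%:C%C * u ^+ m.
  rewrite /G (_ : (m + j + j = m + 2 * j)%N); last by lia.
  set c := _%:C%C; transitivity (c * (u * v) ^+ j * u ^+ m).
    by rewrite (exprMn j u v) (exprD u m j); ring.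
  rewrite uv -rmorphXn -rmorphM; congr (_%:C%C * _).
  by ring.
have diag' m (j : nat) : G j (m + j)%N = (((1 - z ^+ 2) * (1 - w ^+ 2)) ^+ j
     / ((m + j)`!%:R * j`!%:R * 2 ^+ (m + 2 * j))
     * (P l (m + 2 * j)).[z * w])%:C%C * v ^+ m.
  rewrite /G (_ : (j + (m + j) = m + 2 * j)%N); last by lia.
  set c := _%:C%C; transitivity (c * (u * v) ^+ j * v ^+ m).
    by rewrite (exprMn j u v) (exprD v m j); ring.
  rewrite uv -rmorphXn -rmorphM (mulrC j`!%:R); congr (_%:C%C * _).
  by ring.
have blk m : (m <= l)%N -> \sum_(0 <= j < l.+1) G (m + j)%N j =
  ((l - m)`!%:R / (l + m)`!%:R * (P l m).[z] * (P l m).[w])%:C%C * u ^+ m.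
  move=> ml; under eq_bigr => j _ do rewrite diag.
  by rewrite -mulr_suml big_mkord -rmorph_sum addition_block.
have blk' m : (m <= l)%N -> \sum_(0 <= j < l.+1) G j (m + j)%N =
  ((l - m)`!%:R / (l + m)`!%:R * (P l m).[z] * (P l m).[w])%:C%C * v ^+ m.
  move=> ml; under eq_bigr => j _ do rewrite diag'.
  by rewrite -mulr_suml big_mkord -rmorph_sum addition_block.
have -> : (zonal l (dotS x y))%:C%C =
    ((2 * l + 1)%N%:R / (4 * pi))%:C%C * ((@legendre R l).[dotS x y])%:C%C.
  exact: rmorphM.
rewrite PE triangle_to_square// square_to_diagonals// mulrDr.
congr (_ + _); rewrite mulr_sumr.
  apply: eq_big_nat => m /andP[_ ml].
  by rewrite sphericalY_diag blk// -conj_zetaX /= rmorphXn -exprMn [LHS]mulrA -rmorphM.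
rewrite big_nat_recr//= [X in _ + _ * X]big1 ?mulr0 ?addr0 => [|j _]; last first.
  by rewrite G0// addSn addnS ltnS addnCA leq_addr.
apply: eq_big_nat => m /andP[_ ml].
rewrite -[RHS]/(sphericalY l (Negz m) x * (sphericalY l (Negz m) y)^*%C).
by rewrite sphericalY_diag blk'// -[zetaX (Negz m) x * _]exprMn [LHS]mulrA -rmorphM.
Qed.

End Addition.

(** * Integration in polar angles *)

Section SurfaceIntegral.
Context {R : realType}.
Local Notation S2 := (sphere R).
Local Notation leb := (@lebesgue_measure R).
Local Notation sigma := (@surface_measure R).

Import HBNNSimple.

(** The surface measure is given on sets; the change of variables extends to simple
    functions by linearity and to f by monotone convergence. *)
Lemma ge0_integral_surface (f : S2 -> \bar R) : measurable_fun setT f ->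
  (forall x, (0 <= f x)%E) ->
  (\int[sigma]_x f x = \int[leb \x leb]_(t in angles) (f (polar t) * (sin t.1)%:E))%E.
Proof.
move=> mf f0.
have ma := @measurable_angles R.
have ms := @measurable_sin1 R (@angles R).
have mpol D : measurable_fun D (@polar R).
  by apply: measurable_funS (@measurable_polar R).
have s0 (t : R * R) : angles t -> (0 <= (sin t.1)%:E)%E.
  by move=> /sin_angles_ge0; rewrite lee_fin.
pose g := nnsfun_approx measurableT mf.
have mg n : measurable_fun setT (EFin \o g n) by exact/measurable_EFinP.
have mg' n : measurable_fun angles (fun t => (g n (polar t))%:E * (sin t.1)%:E)%E.
  by apply: emeasurable_funM => //; exact: (measurableT_comp (mg n)).
have cg x : (EFin \o g^~ x) @ \oo --> f x.
  by apply: (cvg_nnsfun_approx measurableT mf) => //.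
have E n : (\int[sigma]_x (g n x)%:E =
    \int[leb \x leb]_(t in angles) ((g n (polar t))%:E * (sin t.1)%:E))%E.
  under eq_integral do rewrite fimfunE -fsumEFin//.
  rewrite ge0_integral_fsum//; last 2 first.
    by move=> y; exact/measurable_EFinP/measurable_funM.
    by move=> y x _; rewrite nnfun_muleindic_ge0.
  have mi r : measurable_fun angles
      (fun t => (r * \1_(g n @^-1` [set r]) (polar t))%:E).
    apply/measurable_EFinP; apply: measurable_funM => //.
    exact: (measurableT_comp (measurable_indic _)).
  under [RHS]eq_integral => t _.
    rewrite fimfunE -fsumEFin// ge0_mule_fsuml; last by move=> y; rewrite nnfun_muleindic_ge0.
    over.
  rewrite ge0_integral_fsum//; last 2 first.
    by move=> r; apply: emeasurable_funM; [exact: mi|exact: ms].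
    by move=> r t ta; rewrite mule_ge0// ?s0// nnfun_muleindic_ge0.
  apply: eq_fsbigr => r rg.
  rewrite integralZl_indic_nnsfun// integral_indic// setIT.
  under [RHS]eq_integral do rewrite EFinM -muleA.
  rewrite ge0_integralZl//.
  - congr (_ * _)%E; rewrite /surface_measure.
    transitivity (\int[leb \x leb]_(t in angles)
        ((fun t => (sin t.1)%:E) \_ (@polar R @^-1` (g n @^-1` [set r]))) t)%E.
      by rewrite -integral_mkcondr.
    by apply: eq_integral => t _; rewrite epatch_indic muleC.
  - apply: emeasurable_funM; last exact: ms.
    apply/measurable_EFinP; apply: measurableT_comp; last exact: mpol.
    exact: measurable_indic.
  - by move=> t ta; rewrite mule_ge0// ?s0// lee_fin.
  - by move: rg; rewrite inE => -[t _ <-]; rewrite lee_fin.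
have -> : (\int[sigma]_x f x)%E = limn (fun n => \int[sigma]_x (g n x)%:E)%E.
  rewrite -monotone_convergence//.
  - by apply: eq_integral => x _; apply/esym/cvg_lim => //; exact: cg.
  - by move=> n x _; rewrite lee_fin.
  - by move=> x _ a b ab; rewrite lee_fin; exact/lefP/nd_nnsfun_approx.
under eq_fun do rewrite E.
rewrite -monotone_convergence//.
- apply: eq_integral => t ta; apply/cvg_lim => //; apply: cvgeZr => //; exact: cg.
- by move=> n t ta; rewrite mule_ge0 ?s0// lee_fin.
- move=> t ta a b ab; rewrite lee_wpmul2r ?s0// lee_fin.
  exact/lefP/nd_nnsfun_approx.
Qed.

Lemma Rintegral_surface (f : S2 -> R) : measurable_fun setT f ->
  \int[sigma]_x f x = \int[(leb \x leb)%E]_(t in angles) (f (polar t) * sin t.1).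
Proof.
move=> mf; rewrite /Rintegral; congr fine.
have mf' : measurable_fun setT (EFin \o f) by exact/measurable_EFinP.
rewrite integralE [RHS]integralE; congr (_ - _)%E.
  rewrite ge0_integral_surface//; last exact: measurable_funepos.
  apply: eq_integral => t; rewrite inE => /sin_angles_ge0 ta.
  by rewrite !funeposE/= maxe_pMl// mul0e EFinM.
rewrite ge0_integral_surface//; last exact: measurable_funeneg.
apply: eq_integral => t; rewrite inE => /sin_angles_ge0 ta.
by rewrite !funenegE/= maxe_pMl// mul0e; congr (maxe _ _)%E; rewrite -?EFinN -EFinM mulNr.
Qed.

Lemma Rintegral_prod (f g : R -> R) :
  leb.-integrable setT (EFin \o f) -> leb.-integrable setT (EFin \o g) ->
  \int[(leb \x leb)%E]_t (f t.1 * g t.2) = (\int[leb]_x f x) * (\int[leb]_x g x).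
Proof.
move=> fi gi; have mf := measurable_int _ fi; have mg := measurable_int _ gi.
have mf' : measurable_fun setT f by apply/measurable_EFinP.
have mg' : measurable_fun setT g by apply/measurable_EFinP.
have mfg : measurable_fun setT (fun t : R * R => (f t.1 * g t.2)%:E).
  by apply/measurable_EFinP; apply: measurable_funM; exact: measurableT_comp.
have ffin := integrable_fin_num measurableT fi.
have gfin := integrable_fin_num measurableT gi.
have afin (h : R -> R) : leb.-integrable setT (EFin \o h) ->
    (\int[leb]_y `|(h y)%:E| \is a fin_num)%E.
  by move=> /integrableP[_ hi]; rewrite ge0_fin_numE ?integral_ge0.
rewrite /Rintegral -fineM//; congr fine.
rewrite -integral12_prod_meas1.
  rewrite /fubini_F/=.
  under eq_integral => x _.
    under eq_integral do rewrite EFinM.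
    rewrite integralZl//.
    over.
  rewrite -(fineK gfin) integralZr//.
apply/integrable12ltyP => //=.
under eq_integral => x _.
  under eq_integral do rewrite normrM EFinM.
  rewrite ge0_integralZl//; last exact/measurable_EFinP/measurableT_comp.
  over.
have /fineK <- : (\int[leb]_y (`|g y|)%:E \is a fin_num)%E by exact: afin.
rewrite ge0_integralZr//; last first.
- by rewrite lee_fin fine_ge0// integral_ge0// => x _; rewrite lee_fin.
- exact/measurable_EFinP/measurableT_comp.
have /fineK <- : (\int[leb]_y (`|f y|)%:E \is a fin_num)%E by exact: afin.
by rewrite -EFinM ltry.
Qed.

Lemma integral_FTC (F f : R -> R) a b : a < b -> continuous f ->
  (forall x, is_derive x (1 : R) F (f x)) ->
  leb.-integrable `[a, b] (EFin \o f) /\ \int[leb]_(x in `[a, b]) f x = F b - F a.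
Proof.
move=> ab cf dF; have cF x : F @ x --> F x.
  exact/differentiable_continuous/derivable1_diffP/(@ex_derive _ _ _ _ _ _ _ (dF x)).
split.
  apply: continuous_compact_integrable; first exact: segment_compact.
  exact: continuous_subspaceT.
rewrite /Rintegral (@continuous_FTC2 _ f F)//.
- exact: continuous_subspaceT.
- split=> //.
  + by apply: cvg_at_right_filter.
  + by apply: cvg_at_left_filter.
- by move=> x _; rewrite derive1E; exact: derive_val.
Qed.

End SurfaceIntegral.

(** * Orthonormality of the spherical harmonics *)

Section CMeasurable.
Context d (T : measurableType d) (R : realType).
Implicit Types (f g : T -> R[i]).

Lemma cmeasurableM f g : cmeasurable f -> cmeasurable g ->
  cmeasurable (fun x => f x * g x).
Proof.
move=> [fr fi] [gr gi]; split.
  by under eq_fun do rewrite Defs.ReM; apply: measurable_funB; exact: measurable_funM.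
by under eq_fun do rewrite Defs.ImM; apply: measurable_funD; exact: measurable_funM.
Qed.

Lemma cmeasurable_real (f : T -> R) : measurable_fun setT f ->
  cmeasurable (fun x => (f x)%:C%C).
Proof. by move=> mf; split => //; exact: measurable_cst. Qed.

Lemma cmeasurableJ f : cmeasurable f -> cmeasurable (fun x => (f x)^*%C).
Proof.
move=> [fr fi]; split; first by under eq_fun do rewrite Defs.ReJ.
by under eq_fun do rewrite Defs.ImJ; exact: measurableT_comp.
Qed.

Lemma cmeasurableX f n : cmeasurable f -> cmeasurable (fun x => f x ^+ n).
Proof.
move=> mf; elim: n => [|n IH].
  by under eq_fun do rewrite expr0; split; exact: measurable_cst.
by under eq_fun do rewrite exprS; exact: cmeasurableM.
Qed.

Lemma bounded_sq_integrable (mu : {finite_measure set T -> \bar R}) f (M : R) :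
  cmeasurable f -> (forall x, normc (f x) <= M) ->
  sq_integrable mu f.
Proof.
move=> mf fM; split=> //.
apply: (@le_lt_trans _ _ (\int[mu]_x (M ^+ 2)%:E)%E).
  apply: ge0_le_integral => //.
  - by move=> x _; rewrite lee_fin sqr_ge0.
  - under eq_fun do rewrite normc_sqr.
    apply/measurable_EFinP; case: mf => fr fi.
    by apply: measurable_funD; apply: measurable_funX.
  - move=> x _; rewrite lee_fin ler_pXn2r ?nnegrE ?(le_trans _ (fM x)) ?fM//;
    by case: (f x) => a b /=; rewrite sqrtr_ge0.
rewrite integral_cst// lte_mul_pinfty// ?lee_fin ?sqr_ge0//.
by rewrite -ge0_fin_numE//; exact: fin_num_measure.
Qed.

End CMeasurable.

Section MonoIntegral.
Context {R : realType}.
Local Notation S2 := (sphere R).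
Local Notation leb := (@lebesgue_measure R).
Local Notation sigma := (@surface_measure R).
Local Notation P l k := ((@legendre R l)^`(k)).
Implicit Types (q : {poly R}) (n : int).

Lemma measurable_height : measurable_fun [set: S2] (@height R).
Proof. exact: measurableT_comp measurable_snd measurable_val. Qed.

Lemma cmeasurable_zeta : cmeasurable (@zeta R).
Proof.
have m1 : measurable_fun [set: S2] (fun x => (val x).1).
  exact: measurableT_comp measurable_fst measurable_val.
by split; [exact: measurableT_comp measurable_fst m1|exact: measurableT_comp measurable_snd m1].
Qed.

Lemma cmeasurable_mono q n : cmeasurable (sphmono q n).
Proof.
apply: cmeasurableM.
  apply: cmeasurable_real; apply: measurableT_comp measurable_height.
  by apply: continuous_measurable_fun; exact: continuous_horner.
case: n => n; first exact: cmeasurableX cmeasurable_zeta.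
exact/cmeasurableX/cmeasurableJ/cmeasurable_zeta.
Qed.

Lemma normc_real (a : R) : normc (a%:C%C) = `|a|.
Proof. by rewrite /= expr0n /= addr0 sqrtr_sqr. Qed.

Lemma height_zeta_le1 (x : S2) :
  `|height x| <= 1 /\ normc (zeta x) <= 1.
Proof.
have /eqP := valP x; rewrite /height /zeta; case: (val x) => -[a b] c /= E.
have := sqr_ge0 a; have := sqr_ge0 b; have := sqr_ge0 c => c0 b0 a0.
split; last by rewrite -sqrtr1 ler_sqrt//; lra.
by rewrite -sqrtr_sqr -sqrtr1 ler_sqrt//; lra.
Qed.

Lemma sphmono_bounded q n : exists M, forall x,
  normc (sphmono q n x) <= M.
Proof.
exists (\sum_(i < size q) `|q`_i|) => x.
have [hx zx] := height_zeta_le1 x.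
rewrite /sphmono normcM normc_real -[leRHS]mulr1.
have z1 : normc (zetaX n x) <= 1.
  have n0 (z : R[i]) : 0 <= normc z by case: z => a b /=; rewrite sqrtr_ge0.
  have X (z : R[i]) k : normc z <= 1 -> normc (z ^+ k) <= 1.
    move=> zle; elim: k => [|k IH]; first by rewrite expr0 normc1.
    by rewrite exprS normcM mulr_ile1.
  have J (z : R[i]) : normc z^*%C = normc z.
    by case: z => a b /=; rewrite sqrrN.
  by case: n => n; apply: X => //; rewrite J.
apply: ler_pM => //; first by case: (zetaX n x) => a b /=; rewrite sqrtr_ge0.
rewrite horner_coef; apply: (le_trans (ler_norm_sum _ _ _)); apply: ler_sum => i _.
by rewrite normrM ler_piMr// normrX exprn_ile1.
Qed.

Lemma sphmono_L2 q n : sq_integrable sigma (sphmono q n).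
Proof.
have [M hM] := sphmono_bounded q n.
exact: (@bounded_sq_integrable _ _ _ sigma) (cmeasurable_mono q n) hM.
Qed.

Lemma zeta_polar (t : R * R) k : zeta (polar t) ^+ k =
  Complex (sin t.1 ^+ k * cos (k%:R * t.2)) (sin t.1 ^+ k * sin (k%:R * t.2)).
Proof.
rewrite /zeta /polar /=.
elim: k => [|k IH]; first by rewrite !expr0 !mul0r cos0 sin0 mulr1 mulr0.
rewrite exprS IH -natr1 mulrDl mul1r cosD sinD exprS.
by apply/eqP; rewrite eq_complex /=; apply/andP; split; apply/eqP; ring.
Qed.

Lemma Rintegral_surface_prod (f : S2 -> R) (A B : R -> R) :
  measurable_fun setT f -> continuous A -> continuous B ->
  (forall t, f (polar t) = A t.1 * B t.2) ->
  \int[sigma]_x f x = (\int[leb]_(x in `[0, pi]) (A x * sin x)) *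
    (\int[leb]_(y in `[0, 2 * pi]) B y).
Proof.
move=> mf cA cB fE; rewrite Rintegral_surface//.
have cAs : continuous (fun x => A x * sin x).
  by move=> x; apply: cvgM; [exact: cA|exact: continuous_sin].
have int (h : R -> R) (c : R) : continuous h ->
    leb.-integrable setT (EFin \o (h \_ `[0, c])).
  move=> ch; rewrite -restrict_EFin; apply/integrable_restrict => //; rewrite setTI.
  apply: continuous_compact_integrable; first exact: segment_compact.
  exact: continuous_subspaceT.
rewrite Rintegral_mkcond [X in _ = X * _]Rintegral_mkcond [X in _ = _ * X]Rintegral_mkcond.
rewrite -Rintegral_prod; [|exact: int|exact: int].
apply: eq_Rintegral => t _; rewrite !patchE fE.
have -> : (t \in @angles R) = (t.1 \in `[0, pi]%classic) && (t.2 \in `[0, 2 * pi]%classic).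
  by apply/idP/andP; rewrite !inE.
by case: (t.1 \in _); case: (t.2 \in _); rewrite /= ?mul0r ?mulr0// mulrAC.
Qed.

Lemma is_derive_dilate (F f : R -> R) (c x : R) :
  (forall y, is_derive y (1 : R) F (f y)) ->
  is_derive x (1 : R) (fun y => F (c * y)) (c * f (c * x)).
Proof.
move=> dF; have d1 : is_derive x (1 : R) (fun y => c * y) c.
  by apply: trigger_derive; rewrite /GRing.scale/= mulr1.
by have := @is_derive1_comp R F (fun y => c * y) x (f (c * x)) c (dF _) d1; rewrite mulrC.
Qed.

Lemma continuous_dilate (h : R -> R) (c : R) :
  continuous h -> continuous (fun y => h (c * y)).
Proof.
move=> ch y; apply: (@continuous_comp _ _ _ (fun y => c * y) h); last exact: ch.
by apply: cvgMl_tmp; exact: cvg_id.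
Qed.

Lemma sin_cos_2piX (k : nat) :
  sin (k%:R * (2 * pi)) = 0 :> R /\ cos (k%:R * (2 * pi)) = 1 :> R.
Proof.
elim: k => [|j]; first by rewrite mul0r sin0 cos0.
have -> : j.+1%:R * (2 * pi) = j%:R * (2 * pi) + pi *+ 2 :> R by ring.
by rewrite sinD2pi cosD2pi.
Qed.

Lemma integral_trig (k : nat) : (0 < k)%N ->
  \int[leb]_(y in `[0, 2 * pi]) cos (k%:R * y) = 0 /\
  \int[leb]_(y in `[0, 2 * pi]) sin (k%:R * y) = 0.
Proof.
move=> k0; have kn : k%:R != 0 :> R by rewrite pnatr_eq0 -lt0n.
have pi2 : 0 < 2 * pi :> R by rewrite mulr_gt0// pi_gt0.
have [s2 c2] := sin_cos_2piX k.
have FTC (F f : R -> R) : continuous f -> (forall y, is_derive y (1 : R) F (f y)) ->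
    \int[leb]_(y in `[0, 2 * pi]) f (k%:R * y) = k%:R^-1 * (F (k%:R * (2 * pi)) - F 0).
  move=> cf dF; have [||_ ->] := @integral_FTC R (fun y => k%:R^-1 * F (k%:R * y))
      (fun y => f (k%:R * y)) 0 (2 * pi) pi2.
  - exact: continuous_dilate.
  - move=> x; have d := is_derive_dilate k%:R x dF.
    apply: (@is_derive_eq _ _ _ (k%:R^-1 \*: (fun y => F (k%:R * y)))).
    by rewrite /GRing.scale/= mulKf.
  by rewrite mulr0 mulrBr.
have dN (y : R) : is_derive y (1 : R) (fun y => - cos y) (sin y).
  by apply: trigger_derive; rewrite opprK.
split.
  rewrite (FTC _ _ (@continuous_cos R) (@is_derive_sin R)).
  by rewrite s2 sin0 subrr mulr0.
by rewrite (FTC _ _ (@continuous_sin R) dN) c2 cos0 subrr mulr0.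
Qed.

Lemma integral_zonal q :
  \int[leb]_(x in `[0, pi]) (q.[cos x] * sin x) = int11 q.
Proof.
have cq : continuous (fun x : R => q.[cos x]).
  move=> x; apply: (@continuous_comp _ _ _ (@cos R) (horner q)).
    exact: continuous_cos.
  exact: continuous_horner.
have [||_ ->] := @integral_FTC R (fun x => - (primitive q).[cos x])
    (fun x => q.[cos x] * sin x) 0 pi (pi_gt0 R).
- by move=> x; apply: cvgM; [exact: cq|exact: continuous_sin].
- move=> x; have dp := is_derive_poly (primitive q) (cos x); rewrite deriv_primitive in dp.
  have := @is_derive1_comp R (horner (primitive q)) (@cos R) x _ _ dp (is_derive_cos x).
  move=> d; apply: (@is_derive_eq _ _ _ (- (horner (primitive q) \o cos))).
  by rewrite mulrN opprK.
- by rewrite cospi cos0 opprK addrC.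
Qed.

(** The integral over the longitude vanishes unless n = 0, and the substitution
    z = cos theta turns the remaining one into an integral over [-1, 1]. *)
Lemma cintegral_mono q n :
  cintegral sigma (sphmono q n) = if n == 0 then (2 * pi * int11 q)%:C%C else 0.
Proof.
have [mr mi] := cmeasurable_mono q n.
have cA k : continuous (fun x : R => q.[cos x] * sin x ^+ k).
  move=> x; apply: cvgM.
    apply: (@continuous_comp _ _ _ (@cos R) (horner q)).
      exact: continuous_cos.
    exact: continuous_horner.
  apply: (@continuous_comp _ _ _ (@sin R) (fun y => y ^+ k)); first exact: continuous_sin.
  exact: exprn_continuous.
have re t k : Re ((q.[height (polar t)])%:C%C * zeta (polar t) ^+ k) =
    (q.[cos t.1] * sin t.1 ^+ k) * cos (k%:R * t.2).
  by rewrite zeta_polar /= mul0r subr0 mulrA.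
have im t k : Im ((q.[height (polar t)])%:C%C * zeta (polar t) ^+ k) =
    (q.[cos t.1] * sin t.1 ^+ k) * sin (k%:R * t.2).
  by rewrite zeta_polar /= mul0r addr0 mulrA.
have cc k : continuous (fun y : R => cos (k%:R * y)).
  exact: continuous_dilate (@continuous_cos R).
have cs k : continuous (fun y : R => sin (k%:R * y)).
  exact: continuous_dilate (@continuous_sin R).
rewrite /cintegral; case: n mr mi => [[|n]|n] mr mi.
- rewrite (Rintegral_surface_prod mr (cA 0) (cc 0)); last by move=> t; exact: re.
  rewrite (Rintegral_surface_prod mi (cA 0) (cs 0)); last by move=> t; exact: im.
  have -> : \int[leb]_(x in `[0, pi]) (q.[cos x] * sin x ^+ 0 * sin x) = int11 q.
    by rewrite -integral_zonal; apply: eq_Rintegral => x _; rewrite expr0 mulr1.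
  have -> : \int[leb]_(y in `[0, 2 * pi]) cos (0%:R * y) = 2 * pi.
    under eq_Rintegral do rewrite mul0r cos0.
    rewrite Rintegral_cst// mul1r.
    have := @lebesgue_measure_itv R `[0, 2 * pi].
    by rewrite /= lte_fin mulr_gt0 ?pi_gt0//= oppr0 addr0 => ->.
  have -> : \int[leb]_(y in `[0, 2 * pi]) sin (0%:R * y) = 0.
    by under eq_Rintegral do rewrite mul0r sin0; rewrite Rintegral_cst// mul0r.
  by rewrite mulr0 mulrC.
- have [hc hs] := integral_trig (ltn0Sn n).
  rewrite (Rintegral_surface_prod mr (cA n.+1) (cc n.+1)); last by move=> t; exact: re.
  rewrite (Rintegral_surface_prod mi (cA n.+1) (cs n.+1)); last by move=> t; exact: im.
  by rewrite hc hs !mulr0.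
- have [hc hs] := integral_trig (ltn0Sn n).
  have E t : sphmono q (Negz n) t = ((q.[height t])%:C%C * zeta t ^+ n.+1)^*%C.
    by rewrite conjc_realM rmorphXn.
  rewrite (Rintegral_surface_prod mr (cA n.+1) (cc n.+1)); last first.
    by move=> t; rewrite E Defs.ReJ re.
  rewrite (Rintegral_surface_prod mi (cA n.+1) (fun y => cvgN (cs n.+1 y))); last first.
    by move=> t; rewrite E Defs.ImJ im mulrN.
  rewrite hc mulr0.
  have -> : \int[leb]_(y in `[0, 2 * pi]) (- sin (n.+1%:R * y)) = 0.
    under eq_Rintegral do rewrite -mulN1r.
    rewrite RintegralZl ?hs ?mulr0//.
    apply: continuous_compact_integrable; first exact: segment_compact.
    exact: continuous_subspaceT.
  by rewrite mulr0.
Qed.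

Lemma sphericalY_fun l m : sphericalY l m = sphmono ((ysign m * ynorm l m) *: P l `|m|) m :> (S2 -> _).
Proof. by apply/funext => x; exact: sphericalYE. Qed.

Lemma sphericalY_L2 l m : sq_integrable sigma (sphericalY l m).
Proof. by rewrite sphericalY_fun; exact: sphmono_L2. Qed.

(** Different orders are separated by the longitude; for equal orders the integral is
    an entry of [legendre_gram], and the normalization is the inverse of its diagonal. *)
Lemma sphericalY_ortho l l' m n : (`|m| <= l)%N -> (`|n| <= l')%N ->
  cintegral sigma (fun x => sphericalY l m x * (sphericalY l' n x)^*%C) =
  ((l == l') && (m == n))%:R.
Proof.
move=> ml nl; have [mn|mn] := eqVneq m n; last first.
  have [e _ h] := sphmonoM ((ysign m * ynorm l m) *: P l `|m|) ((ysign n * ynorm l' n) *: P l' `|n|) m (- n).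
  rewrite (_ : (fun x => _) = sphmono ((ysign m * ynorm l m) *: P l `|m| *
      ((ysign n * ynorm l' n) *: P l' `|n|) * (1 - 'X^2) ^+ e) (m - n)).
    by rewrite cintegral_mono subr_eq0 (negPf mn) andbF.
  by apply/funext => x; rewrite !sphericalYE conj_mono h.
rewrite andbT; subst n.
pose c : R := ysign m * ynorm l m; pose c' : R := ysign m * ynorm l' m.
rewrite (_ : (fun x => _) = sphmono ((c * c') *: ((1 - 'X^2) ^+ `|m| * P l `|m| * P l' `|m|)) 0); last first.
  apply/funext => x; rewrite !sphericalYE conj_mono /sphmono mulrACA -conj_zetaX zetaX_norm.
  rewrite /= mulr1 -!rmorphM -!hornerM -!mul_polyC; congr (_.[_]%:C)%C.
  by rewrite /c /c' !polyCM; ring.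
rewrite cintegral_mono eqxx int11Z -/(legendre_gram `|m| l l').
have [ll|ll] := eqVneq l l'; last by rewrite legendre_gram_neq// !mulr0.
subst l'; rewrite legendre_gram_diag// -expr2 exprMn ysign_sqr mul1r.
rewrite sqr_sqrtr ?(ltW (ynorm_arg_gt0 _ _))//.
rewrite (_ : _ * _ = 1)//.
have F k : k`!%:R != 0 :> R by rewrite pnatr_eq0 -lt0n fact_gt0.
have p0 : pi != 0 :> R by rewrite gt_eqF ?pi_gt0.
have l1 : (2 * l + 1)%:R != 0 :> R by rewrite addn1 pnatr_eq0.
move: (F (l - `|m|)%N) (F (l + `|m|)%N) l1 p0.
move: (l - `|m|)`! (l + `|m|)`! (2 * l + 1)%N (pi : R) => a b t p a0 b0 t0 p0.
by field; rewrite a0 b0 t0 p0.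
Qed.

End MonoIntegral.

(** * Closures in the space of square-integrable functions *)

Section L2Closure.
Import HBNNSimple.
Context d (T : measurableType d) (R : realType).
Context (mu : {measure set T -> \bar R}).
Implicit Types (f g h : T -> R[i]) (m : T -> R).

Definition L2sq f : \bar R := (\int[mu]_x (nsq f x)%:E)%E.

Lemma L2sq_ge0 f : (0 <= L2sq f)%E.
Proof. by apply: integral_ge0 => x _; rewrite lee_fin nsq_ge0. Qed.

Lemma measurable_nsq f : cmeasurable f -> measurable_fun setT (EFin \o nsq f).
Proof. by move=> mf; apply/measurable_EFinP; exact: cmeasurable_nsq. Qed.

Lemma sq_integrableB f g : sq_integrable mu f -> sq_integrable mu g ->
  sq_integrable mu (fun x => f x - g x).
Proof.
move=> fi gi; under eq_fun do rewrite -mulN1r.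
exact: sq_integrableD fi (sq_integrableZ _ gi).
Qed.

Lemma L2sqD_le f g : cmeasurable f -> cmeasurable g ->
  (L2sq (fun x => f x + g x)%R <= 2%:E * (L2sq f + L2sq g))%E.
Proof.
move=> mf mg; rewrite /L2sq -ge0_integralD//; last first.
- exact: measurable_nsq.
- by move=> x _; rewrite lee_fin nsq_ge0.
- exact: measurable_nsq.
- by move=> x _; rewrite lee_fin nsq_ge0.
rewrite -ge0_integralZl//; last 2 first.
- by apply: emeasurable_funD; exact: measurable_nsq.
- by move=> x _; rewrite -EFinD lee_fin addr_ge0// nsq_ge0.
have mfg : cmeasurable (fun x => f x + g x).
  case: mf mg => [fr fi] [gr gi]; split.
    by under eq_fun do rewrite Defs.ReD; exact: measurable_funD.
  by under eq_fun do rewrite Defs.ImD; exact: measurable_funD.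
apply: ge0_le_integral => //.
- by move=> x _; rewrite lee_fin nsq_ge0.
- exact: measurable_nsq.
- apply: measurable_funeM; apply: emeasurable_funD; exact: measurable_nsq.
- move=> x _; rewrite -EFinD -EFinM lee_fin /nsq Defs.ReD Defs.ImD.
  have := sqr_ge0 (Re (f x) - Re (g x)); have := sqr_ge0 (Im (f x) - Im (g x)).
  by rewrite !expr2; nra.
Qed.

Lemma nsqZ (a : R[i]) f x : nsq (fun x => a * f x) x = (Re a ^+ 2 + Im a ^+ 2) * nsq f x.
Proof. by rewrite /nsq Defs.ReM Defs.ImM; ring. Qed.

Lemma nsqBC f g x : nsq (fun y => f y - g y) x = nsq (fun y => g y - f y) x.
Proof. by rewrite /nsq !raddfB /=; ring. Qed.

Lemma L2sqZ (a : R[i]) f : cmeasurable f ->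
  L2sq (fun x => a * f x)%R = ((Re a ^+ 2 + Im a ^+ 2)%:E * L2sq f)%E.
Proof.
move=> mf; rewrite /L2sq -ge0_integralZl//.
- by apply: eq_integral => x _; rewrite nsqZ.
- exact: measurable_nsq.
- by move=> x _; rewrite lee_fin nsq_ge0.
- by rewrite lee_fin addr_ge0 ?sqr_ge0.
Qed.

Lemma L2sq_dominated (F : nat -> T -> R[i]) f (G : T -> R) :
  (forall n, cmeasurable (F n)) -> cmeasurable f ->
  (forall x, (nsq (fun y => F n y - f y) x) @[n --> \oo] --> (0 : R)) ->
  mu.-integrable setT (EFin \o G) ->
  (forall n x, nsq (fun y => F n y - f y) x <= G x) ->
  L2sq (fun y => F n y - f y)%R @[n --> \oo] --> 0%E.
Proof.
move=> mF mf cF iG FG.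
have mFf n : cmeasurable (fun y => F n y - f y).
  have [Fr Fi] := mF n; case: mf => fr fi; split.
    by under eq_fun do rewrite raddfB; exact: measurable_funB.
  by under eq_fun do rewrite raddfB; exact: measurable_funB.
have [] // := @dominated_convergence _ T R mu setT measurableT
  (fun n => EFin \o nsq (fun y => F n y - f y)) (cst 0%E) (EFin \o G)
  (fun n => measurable_nsq (mFf n)) (measurable_cst _).
- by apply: aeW => x _ /=; apply: cvg_EFin; [exact: nearW|exact: cF].
- apply: aeW => x n _ /=; rewrite lee_fin ger0_norm ?nsq_ge0//.
- by move=> _ _; rewrite integral0.
Qed.

Variable test : (T -> R[i]) -> Prop.
Hypothesis testL2 : forall f, test f -> sq_integrable mu f.
Hypothesis testD : forall f g, test f -> test g -> test (fun x => f x + g x).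
Hypothesis testZ : forall a f, test f -> test (fun x => a * f x).

(** Membership in the closure of the test functions, for the squared distance. *)
Definition L2approx f := sq_integrable mu f /\
  forall e : R, 0 < e -> exists2 g, test g & (L2sq (fun x => f x - g x)%R < e%:E)%E.

Lemma test_approx f : test f -> L2approx f.
Proof.
move=> tf; split; first exact: testL2.
move=> e e0; exists f => //; rewrite /L2sq.
under eq_integral do rewrite /nsq subrr expr0n/= addr0.
by rewrite integral0 lte_fin.
Qed.

Lemma approxD f g : L2approx f -> L2approx g -> L2approx (fun x => f x + g x).
Proof.
move=> [fi fa] [gi ga]; split; first exact: sq_integrableD.
move=> e e0.
(* Squared norms satisfy |f + g|^2 <= 2 (|f|^2 + |g|^2), hence the factor 4. *)
have e4 : 0 < e / 4 by rewrite divr_gt0.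
have [f' tf' ff'] := fa _ e4; have [g' tg' gg'] := ga _ e4.
exists (fun x => f' x + g' x); first exact: testD.
have := @L2sqD_le (fun x => f x - f' x) (fun x => g x - g' x)
  (sq_integrableB fi (testL2 tf')).1 (sq_integrableB gi (testL2 tg')).1.
under eq_fun do rewrite addrACA -opprD.
move/le_lt_trans; apply.
rewrite (_ : e%:E = (2%:E * (e / 4 + e / 4)%:E)%E); last by rewrite -EFinM; congr EFin; field.
by rewrite lte_pmul2l// EFinD lteD.
Qed.

Lemma approxZ a f : L2approx f -> L2approx (fun x => a * f x).
Proof.
move=> [fi fa]; split; first exact: sq_integrableZ.
move=> e e0; pose c := Re a ^+ 2 + Im a ^+ 2 + 1.
have c0 : 0 < c by rewrite ltr_wpDl// addr_ge0 ?sqr_ge0.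
have [g tg fg] := fa _ (divr_gt0 e0 c0).
exists (fun x => a * g x); first exact: testZ.
under eq_fun do rewrite -mulrBr.
have mfg := (sq_integrableB fi (testL2 tg)).1.
rewrite L2sqZ//; apply: (@le_lt_trans _ _ (c%:E * L2sq (fun x => f x - g x)%R)%E).
  by rewrite lee_wpmul2r ?L2sq_ge0// lee_fin lerDl.
rewrite (_ : e%:E = (c%:E * (e / c)%:E)%E); last first.
  by rewrite -EFinM mulrC divfK// gt_eqF.
by rewrite lte_pmul2l.
Qed.

Lemma approx_closed f : sq_integrable mu f ->
  (forall e : R, 0 < e -> exists2 g, L2approx g & (L2sq (fun x => f x - g x)%R < e%:E)%E) ->
  L2approx f.
Proof.
move=> fi fa; split => // e e0; have e4 : 0 < e / 4 by rewrite divr_gt0.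
have [g [gi ga] fg] := fa _ e4; have [h th gh] := ga _ e4.
exists h => //.
have := @L2sqD_le (fun x => f x - g x) (fun x => g x - h x)
  (sq_integrableB fi gi).1 (sq_integrableB gi (testL2 th)).1.
under eq_fun do rewrite addrA subrK.
move/le_lt_trans; apply.
rewrite (_ : e%:E = (2%:E * (e / 4 + e / 4)%:E)%E); last by rewrite -EFinM; congr EFin; field.
by rewrite lte_pmul2l// EFinD lteD.
Qed.

Lemma approx_limit (F : nat -> T -> R[i]) f : (forall n, L2approx (F n)) ->
  sq_integrable mu f -> L2sq (fun y => F n y - f y)%R @[n --> \oo] --> 0%E -> L2approx f.
Proof.
move=> aF fi cF; apply: approx_closed => // e e0.
have [N _ /(_ N (leqnn N))/= FN] : \forall n \near \oo, (L2sq (fun y => F n y - f y)%R < e%:E)%E.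
  have /fine_cvgP[ffin /cvgr0Pnorm_lt /(_ e e0) clt] := cF.
  near=> n; have nf : L2sq (fun y => F n y - f y)%R \is a fin_num by near: n.
  rewrite -(fineK nf) lte_fin; apply: (le_lt_trans (ler_norm _)).
  by near: n.
exists (F N) => //; rewrite /L2sq; move: FN; rewrite /L2sq.
by under eq_integral do rewrite nsqBC.
Unshelve. all: by end_near. Qed.

(** Passing from approximable functions to their multipliers makes the class stable
    under products, which the closure itself need not be. *)
Definition multiplier m := measurable_fun setT m /\
  forall f, L2approx f -> L2approx (fun x => (m x)%:C%C * f x).

Lemma multiplier_cst (a : R) : multiplier (fun=> a).
Proof. by split; [exact: measurable_cst|move=> f; exact: approxZ]. Qed.

Lemma multiplierD m1 m2 : multiplier m1 -> multiplier m2 ->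
  multiplier (fun x => m1 x + m2 x).
Proof.
move=> [mm1 h1] [mm2 h2]; split; first exact: measurable_funD.
move=> f fa; under eq_fun do rewrite rmorphD mulrDl.
by apply: approxD; [exact: h1|exact: h2].
Qed.

Lemma multiplierM m1 m2 : multiplier m1 -> multiplier m2 ->
  multiplier (fun x => m1 x * m2 x).
Proof.
move=> [mm1 h1] [mm2 h2]; split; first exact: measurable_funM.
move=> f fa; under eq_fun do rewrite rmorphM -mulrA.
exact/h1/h2.
Qed.

Lemma multiplierB m1 m2 : multiplier m1 -> multiplier m2 ->
  multiplier (fun x => m1 x - m2 x).
Proof.
move=> h1 h2; under eq_fun do rewrite -mulN1r.
exact/multiplierD/multiplierM/h2/multiplier_cst.
Qed.

Lemma multiplierX m n : multiplier m -> multiplier (fun x => m x ^+ n).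
Proof.
move=> h; elim: n => [|n IH]; first exact: multiplier_cst.
by under eq_fun do rewrite exprS; exact: multiplierM.
Qed.

(** Dominated convergence: the products with f are bounded by a multiple of |f|. *)
Lemma multiplier_lim (M : nat -> T -> R) m : (forall n, multiplier (M n)) ->
  (forall n x, `|M n x| <= 1) -> (forall x, M n x @[n --> \oo] --> m x) ->
  multiplier m.
Proof.
move=> hM bM cM.
have mm : measurable_fun setT m.
  apply/measurable_EFinP; apply: (@emeasurable_fun_cvg _ _ _ setT (fun n => EFin \o M n)).
    by move=> n; apply/measurable_EFinP; exact: (hM n).1.
  by move=> x _; apply: cvg_EFin; [exact: nearW|exact: cM].
have bm x : `|m x| <= 1.
  have c : `|M n x| @[n --> \oo] --> `|m x| by apply: cvg_norm; exact: cM.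
  rewrite -(cvg_lim _ c)//; apply: limr_le; first by apply/cvg_ex; exists `|m x|.
  by apply: nearW => n; exact: bM.
split => // f [fi fa].
have mf : cmeasurable (fun x => (m x)%:C%C * f x).
  exact: cmeasurableM (cmeasurable_real mm) fi.1.
have [mfm ii] := (sq_integrableP mu f).1 fi.
have bnd (t : T -> R) c x : `|t x| <= c -> nsq (fun y => (t y)%:C%C * f y) x <= c ^+ 2 * nsq f x.
  move=> tc; rewrite /nsq Defs.ReM Defs.ImM /= !mul0r subr0 addr0 !exprMn -mulrDr.
  rewrite ler_wpM2r ?nsq_ge0// -(real_normK (num_real (t x))).
  by rewrite lerXn2r ?nnegrE ?normr_ge0// (le_trans _ tc).
have fi' : sq_integrable mu (fun x => (m x)%:C%C * f x).
  apply/sq_integrableP; split => //; apply: le_integrable ii => //.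
    exact: measurable_nsq.
  move=> x _ /=; rewrite lee_fin !ger0_norm ?nsq_ge0//.
  by have := bnd m 1 x (bm x); rewrite expr1n mul1r.
apply: (approx_limit (F := fun n x => (M n x)%:C%C * f x)) => //.
  by move=> n; exact: (hM n).2.
have E n : (fun y => (M n y)%:C%C * f y - (m y)%:C%C * f y) =
    (fun y => (M n y - m y)%:C%C * f y).
  by apply/funext => y; rewrite -mulrBl -rmorphB.
apply: (L2sq_dominated (G := fun x => 4 * nsq f x)) => //.
- by move=> n; apply: cmeasurableM fi.1; apply: cmeasurable_real; exact: (hM n).1.
- move=> x; have c0 : M n x - m x @[n --> \oo] --> (0 : R).
    by rewrite -(subrr (m x)); apply: cvgB; [exact: cM|exact: cvg_cst].
  have ck : (cst (nsq f x) : nat -> R) @ \oo --> nsq f x by exact: cvg_cst.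
  have H := cvgM (cvgM c0 c0) ck; rewrite !mul0r in H.
  have -> : (fun n => nsq (fun y => (M n y)%:C%C * f y - (m y)%:C%C * f y) x) =
      (fun n => (M n x - m x) * (M n x - m x) * nsq f x).
    by apply/funext => n; rewrite E [LHS]/nsq Defs.ReM Defs.ImM /= /nsq; ring.
  exact: H.
- rewrite (_ : EFin \o _ = fun x => (4%:E * (nsq f x)%:E)%E)//; exact: integrableZl.
- move=> n x; rewrite E (_ : 4 = 2 ^+ 2); last by rewrite expr2; ring.
  apply: bnd; apply: (le_trans (ler_normB _ _)).
  by rewrite (_ : 2 = 1 + 1)// lerD.
Qed.

Definition indic_multiplier (A : set T) := multiplier (\1_A : T -> R).

(** Complements are 1 - 1_A, finite unions multiply the complementary indicators,
    and countable unions are bounded pointwise limits of finite ones. *)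
Lemma indic_multiplier_sigma : sigma_algebra setT [set A | indic_multiplier A].
Proof.
split => /=.
- rewrite /indic_multiplier (_ : \1_set0 = fun=> 0); first exact: multiplier_cst.
  by apply/funext => x; rewrite indicE in_set0.
- move=> A hA; rewrite /indic_multiplier (_ : \1_(setT `\` A) = fun x => 1 - \1_A x).
    exact/multiplierB/hA/multiplier_cst.
  by apply/funext => x; rewrite !indicE in_setD in_setT/=; case: (x \in A); rewrite ?subrr ?subr0.
- move=> A hA.
  pose U n := \big[setU/set0]_(i < n) A i.
  have hU n : indic_multiplier (U n).
    elim: n => [|n IH].
      rewrite /indic_multiplier /U big_ord0 (_ : \1_set0 = fun=> 0); first exact: multiplier_cst.
      by apply/funext => x; rewrite indicE in_set0.
    rewrite /indic_multiplier /U big_ord_recr/= -/(U n).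
    rewrite (_ : \1_(U n `|` A n) = fun x => 1 - (1 - \1_(U n) x) * (1 - \1_(A n) x)).
      by do ?[apply: multiplierB; first exact: multiplier_cst]; apply: multiplierM;
        (apply: multiplierB; first exact: multiplier_cst); [exact: IH|exact: hA].
    apply/funext => x; rewrite !indicE in_setU.
    by case: (x \in U n); case: (x \in A n) => /=; ring.
  apply: (multiplier_lim (M := fun n => \1_(U n))) => //.
    by move=> n x; rewrite indicE; case: (_ \in _); rewrite ?normr0 ?normr1.
  move=> x; have [[k _ Ak]|nA] := pselect ((\bigcup_k A k) x).
    rewrite indicE mem_set; last by exists k.
    apply: cvg_near_cst; exists k.+1 => // n /= kn.
    by rewrite indicE mem_set// /U -bigcup_mkord; exists k.
  rewrite indicE memNset//; apply: cvg_near_cst; apply: nearW => n.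
  rewrite indicE memNset// /U -bigcup_mkord => -[i _ Ai]; apply: nA.
  by exists i.
Qed.

(** Simple functions below f are combinations of indicators, hence approximable, and
    they converge to f under the bound f. *)
Lemma ge0_approx (f : T -> R) : (forall A, measurable A -> indic_multiplier A) ->
  L2approx (fun=> 1) -> (forall x, 0 <= f x) ->
  sq_integrable mu (fun x => (f x)%:C%C) -> L2approx (fun x => (f x)%:C%C).
Proof.
move=> hA h1 f0 fi.
have mf : measurable_fun setT f := fi.1.1.
have mf' : measurable_fun setT (EFin \o f) by exact/measurable_EFinP.
pose g := nnsfun_approx measurableT mf'.
have gf n x : g n x <= f x.
  rewrite -lee_fin -[leRHS]/((EFin \o f) x) /g nnsfun_approxE.
  by apply: le_approx => // y _; rewrite lee_fin.
have ag n : L2approx (fun x => (g n x)%:C%C).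
  have E : (fun x => (g n x)%:C%C) =
      (fun x => \sum_(r \in range (g n)) (r%:C%C * ((\1_(g n @^-1` [set r]) x)%:C%C * 1))).
    apply/funext => x; rewrite [in LHS]fimfunE !fsbig_finite// rmorph_sum.
    by apply: eq_bigr => r _; rewrite mulr1 rmorphM.
  rewrite E; under eq_fun do rewrite fsbig_finite//.
  elim: (fset_set _ : seq R) => [|r s IH].
    under eq_fun do rewrite big_nil -(mul0r 1).
    exact: approxZ.
  under eq_fun do rewrite big_cons.
  by apply: approxD => //; apply: approxZ; apply: (hA _ _).2.
apply: (approx_limit (F := fun n x => (g n x)%:C%C)) => //.
have [_ ii] := (sq_integrableP mu _).1 fi.
have E n : (fun y => (g n y)%:C%C - (f y)%:C%C) = (fun y => (g n y - f y)%:C%C).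
  by apply/funext => y; rewrite rmorphB.
apply: (L2sq_dominated (G := nsq (fun x => (f x)%:C%C))) => //.
- move=> x; have cg : g n x @[n --> \oo] --> f x.
    have f0' y : [set: T] y -> (0 <= (EFin \o f) y)%E by move=> _; rewrite lee_fin.
    by have /fine_cvgP[] := cvg_nnsfun_approx measurableT mf' f0' (I : [set: T] x).
  have c0 : g n x - f x @[n --> \oo] --> (0 : R).
    have cf : (cst (f x) : nat -> R) @ \oo --> f x by exact: cvg_cst.
    by rewrite -(subrr (f x)); apply: cvgB; [exact: cg|exact: cf].
  have H := cvgM c0 c0; rewrite mul0r in H.
  have -> : (fun n => nsq (fun y => (g n y)%:C%C - (f y)%:C%C) x) =
      (fun n => (g n x - f x) * (g n x - f x)).
    by apply/funext => n; rewrite E /nsq /=; ring.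
  exact: H.
- move=> n x; rewrite E /nsq /= expr0n /= !addr0 -sqrrN opprB.
  by rewrite lerXn2r ?nnegrE ?subr_ge0// gerBl.
Qed.

Lemma approx_all f : (forall A, measurable A -> indic_multiplier A) ->
  L2approx (fun=> 1) -> sq_integrable mu f -> L2approx f.
Proof.
move=> hA h1 fi; have [mf ii] := (sq_integrableP mu f).1 fi.
have part (h : T -> R) : measurable_fun setT h -> (forall x, 0 <= h x) ->
    (forall x, h x ^+ 2 <= nsq f x) -> L2approx (fun x => (h x)%:C%C).
  move=> mh h0 hle; apply: ge0_approx => //; apply/sq_integrableP.
  have mhc := cmeasurable_real mh; split => //.
  apply: le_integrable ii => //; first exact: measurable_nsq.
  move=> x _ /=; rewrite lee_fin !ger0_norm ?nsq_ge0//.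
  by rewrite /nsq /= expr0n addr0.
have real (h : T -> R) : measurable_fun setT h ->
    (forall x, h x ^+ 2 <= nsq f x) -> L2approx (fun x => (h x)%:C%C).
  move=> mh hle.
  have -> : (fun x => (h x)%:C%C) =
      (fun x => (Num.max (h x) 0)%:C%C + (-1) * (Num.max (- h x) 0)%:C%C).
    apply/funext => x; rewrite mulN1r -rmorphB; congr (_%:C)%C.
    by case: (ltrgtP (h x) 0) => [h0|h0|->]; rewrite ?maxrN ?oppr0 ?maxxx ?subrr//; case: ltgtP; lra.
  have sq (a b : R) : Num.max a 0 ^+ 2 <= a ^+ 2.
    by case: (lerP a 0) => _; rewrite // expr0n sqr_ge0.
  apply: approxD; last apply: approxZ.
    apply: part => [|x|x]; first exact: measurable_maxr.
      by rewrite le_max lexx orbT.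
    exact: le_trans (sq _ 0) (hle x).
  apply: part => [|x|x]; first by apply: measurable_maxr => //; exact: measurableT_comp.
    by rewrite le_max lexx orbT.
  by apply: le_trans (sq _ 0) _; rewrite sqrrN.
have -> : f = (fun x => (Re (f x))%:C%C + 'i%C * (Im (f x))%:C%C).
  apply/funext => x; case: (f x) => a b; apply/eqP; rewrite eq_complex /=.
  by apply/andP; split; apply/eqP; ring.
apply: approxD; last apply: approxZ; apply: real; [exact: mf.1| |exact: mf.2|] => x.
  by rewrite /nsq lerDl sqr_ge0.
by rewrite /nsq lerDr sqr_ge0.
Qed.

End L2Closure.

(** * Density of the polynomials on the sphere *)

Section StepPolynomials.
Context {R : realType}.
Implicit Types (s y : R).

Lemma bernoulli_ineq y n : -1 <= y -> 1 + n%:R * y <= (1 + y) ^+ n.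
Proof.
move=> y1; elim: n => [|n IH]; first by rewrite expr0 mul0r addr0.
have y0 : 0 <= 1 + y by lra.
rewrite exprS; apply: (le_trans _ (ler_wpM2l y0 IH)).
have : 0 <= n%:R * y ^+ 2 by rewrite mulr_ge0// sqr_ge0.
by rewrite -natr1; nra.
Qed.

Lemma onem_expr_le y n : 0 <= y <= 1 -> (1 - y) ^+ n * (1 + n%:R * y) <= 1.
Proof.
move=> /andP[y0 y1]; have y0' : 0 <= (1 - y) ^+ n by rewrite exprn_ge0 ?subr_ge0.
apply: (le_trans (ler_wpM2l y0' (bernoulli_ineq n _))); first lra.
rewrite -exprMn -[leRHS](expr1n _ n) lerXn2r ?nnegrE//; nra.
Qed.

(** Polynomials converging on [0, 1] to the indicator of [0, 1/2[. The outer exponent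
    is chosen so that its product with s^(2 n) is n (2 s)^(2 n), which tends to 0 for
    s < 1/2 and to infinity for s >= 1/2; the factor n settles s = 1/2. *)
Definition step_approx n s : R := (1 - s ^+ (2 * n)) ^+ (n * 4 ^ n).

Lemma step_approx_le1 n s : 0 <= s <= 1 -> 0 <= step_approx n s <= 1.
Proof.
move=> /andP[s0 s1]; have h : 0 <= s ^+ (2 * n) <= 1 by rewrite exprn_ge0// exprn_ile1.
move/andP: h => [h0 h1].
by rewrite exprn_ge0 ?subr_ge0//= exprn_ile1 ?subr_ge0// gerBl.
Qed.

Lemma step_approx_cvg s : 0 <= s <= 1 ->
  step_approx n s @[n --> \oo] --> ((s < 2^-1)%R%:R : R).
Proof.
move=> s01; have /andP[s0 s1] := s01.
have h n : 0 <= s ^+ (2 * n) <= 1 by rewrite exprn_ge0// exprn_ile1.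
have ky n : (n * 4 ^ n)%:R * s ^+ (2 * n) = n%:R * ((2 * s) ^+ n) ^+ 2.
  rewrite natrM natrX -mulrA; congr (_ * _).
  rewrite (exprM s 2 n) -exprMn -exprM (mulnC n 2%N) (exprM _ 2 n).
  by congr (_ ^+ _); ring.
case: ltP => s2.
  pose q := 2 * s; have q1 : `|q| < 1 by rewrite ger0_norm /q ?mulr_ge0//; lra.
  have q0 : 0 <= q by rewrite mulr_ge0.
  have nq n : n%:R * q ^+ n <= (1 - q)^-1.
    rewrite ger0_norm// in q1; rewrite -[leRHS]mul1r ler_pdivlMr ?subr_gt0//.
    have := @onem_expr_le (1 - q) n; rewrite opprB addrCA subrr addr0.
    have -> : 0 <= 1 - q <= 1 by lra.
    move=> /(_ isT); have : 0 <= q ^+ n by rewrite exprn_ge0.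
    by nra.
  apply: (@squeeze_cvgr _ _ _ _ (fun n => 1 - (1 - q)^-1 * q ^+ n) (cst 1)).
  - apply: nearW => n; have /andP[_ ->] := step_approx_le1 n s01; rewrite andbT.
    have /andP[h0 h1] := h n.
    have := @bernoulli_ineq (- s ^+ (2 * n)) (n * 4 ^ n); rewrite mulrN ky => /(_ _).
    have -> : -1 <= - s ^+ (2 * n) by rewrite lerN2.
    move=> /(_ isT); apply: le_trans; rewrite lerD2l lerN2 -/q expr2 mulrA.
    by rewrite ler_wpM2r ?exprn_ge0.
  - rewrite -[X in _ --> X](subr0 (1 : R)); apply: cvgB; first exact: cvg_cst.
    rewrite -[X in _ --> X](mulr0 (1 - q)^-1); apply: cvgM; first exact: cvg_cst.
    exact: cvg_expr.
  - exact: cvg_cst.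
apply: (@squeeze_cvgr _ _ _ _ (cst 0) (@harmonic R)).
- apply: nearW => n; have /andP[-> _] /= := step_approx_le1 n s01.
  have := @onem_expr_le (s ^+ (2 * n)) (n * 4 ^ n) (h n); rewrite ky => le1.
  rewrite /harmonic -[leRHS]mul1r ler_pdivlMr ?ltr0n//.
  apply: le_trans le1; rewrite /= ler_wpM2l//.
    by have /andP[] := step_approx_le1 n s01.
  rewrite -natr1 addrC lerD2l ler_peMr// exprn_ege1// exprn_ege1//.
  lra.
- exact: cvg_cst.
- exact: cvg_harmonic.
Qed.

End StepPolynomials.

Section SphereDensity.
Context {R : realType}.
Local Notation S2 := (sphere R).
Local Notation sigma := (@surface_measure R).

Inductive sphpoly : (S2 -> R[i]) -> Prop :=
| sphpoly_mono q n : sphpoly (sphmono q n)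
| sphpoly_add f g : sphpoly f -> sphpoly g -> sphpoly (fun x => f x + g x)
| sphpoly_scale a f : sphpoly f -> sphpoly (fun x => a * f x).

Lemma sphpoly_L2 f : sphpoly f -> sq_integrable sigma f.
Proof.
elim=> [q n|g h _ gi _ hi|a g _ gi]; first exact: sphmono_L2.
  exact: sq_integrableD.
exact: sq_integrableZ.
Qed.

Lemma sphpoly_mono_mul p n f : sphpoly f -> sphpoly (fun x => sphmono p n x * f x).
Proof.
elim=> [q k|g h _ gi _ hi|a g _ gi].
- have [e _ h] := sphmonoM p q n k.
  by rewrite (_ : (fun x => _) = sphmono (p * q * (1 - 'X^2) ^+ e) (n + k)); [exact: sphpoly_mono|exact/funext].
- by under eq_fun do rewrite mulrDr; exact: sphpoly_add.
- by under eq_fun do rewrite mulrCA; exact: sphpoly_scale.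
Qed.

Local Notation mult := (multiplier sigma sphpoly).

Let mcst := multiplier_cst sphpoly_L2 sphpoly_scale.
Let mD := multiplierD sphpoly_L2 sphpoly_add.
Let mB := multiplierB sphpoly_L2 sphpoly_add sphpoly_scale.
Let mX := multiplierX sphpoly_L2 sphpoly_scale.

(** Multiplication by c is a contraction that maps polynomials to polynomials, hence
    preserves their closure. *)
Lemma coord_multiplier (c : S2 -> R) : measurable_fun setT c ->
  (forall x, `|c x| <= 1) ->
  (forall f, sphpoly f -> sphpoly (fun x => (c x)%:C%C * f x)) -> mult c.
Proof.
move=> mc c1 tc; split => // f [fi fa].
have le1 g : cmeasurable g -> forall x, nsq (fun y => (c y)%:C%C * g y) x <= nsq g x.
  move=> mg x; rewrite /nsq Defs.ReM Defs.ImM /= !mul0r subr0 addr0 !exprMn -mulrDr.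
  rewrite ler_piMl ?nsq_ge0//.
  by rewrite -(real_normK (num_real (c x))) exprn_ile1.
have cm g : cmeasurable g -> cmeasurable (fun x => (c x)%:C%C * g x).
  by move=> mg; exact: cmeasurableM (cmeasurable_real mc) mg.
split.
  have [mf ii] := (sq_integrableP sigma f).1 fi.
  apply/sq_integrableP; split; first exact: cm.
  apply: le_integrable ii => //; first exact/measurable_nsq/cm.
  by move=> x _ /=; rewrite lee_fin !ger0_norm ?nsq_ge0//; exact: le1.
move=> e e0; have [g tg fg] := fa e e0.
exists (fun x => (c x)%:C%C * g x); first exact: tc.
under eq_fun do rewrite -mulrBr.
have mfg := (sq_integrableB fi (sphpoly_L2 tg)).1.
apply: le_lt_trans fg; apply: ge0_le_integral => //.
- by move=> x _; rewrite lee_fin nsq_ge0.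
- exact/measurable_nsq/cm.
- exact/measurable_nsq.
- by move=> x _; rewrite lee_fin; exact: (le1 (fun y => f y - g y)).
Qed.

(** The sublevel set is {s < 1/2} for an affine function s of c with values in
    [0, 1], so that its indicator is the limit of the step polynomials of s. *)
Lemma coord_indic_multiplier (c : S2 -> R) (a : R) : (forall x, `|c x| <= 1) -> mult c ->
  indic_multiplier sigma sphpoly [set x | c x < a].
Proof.
move=> c1 hc; pose b := 1 + `|a|; have b0 : 0 < b by rewrite ltr_pwDl.
pose s x := 2^-1 + (c x - a) * (2 * b)^-1.
have s01 x : 0 <= s x <= 1.
  have : `|c x - a| <= b by rewrite (le_trans (ler_normB _ _))// lerD2r.
  rewrite ler_norml /s => /andP[h1 h2].
  have b2 : 0 < 2 * b by rewrite mulr_gt0.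
  have E1 : (- b) * (2 * b)^-1 = - 2^-1 by field; rewrite gt_eqF.
  have E2 : b * (2 * b)^-1 = 2^-1 by field; rewrite gt_eqF.
  have l1 := ler_wpM2r (ltW (_ : 0 < (2 * b)^-1)) h1.
  have l2 := ler_wpM2r (ltW (_ : 0 < (2 * b)^-1)) h2.
  rewrite invr_gt0 b2 E1 in l1; rewrite invr_gt0 b2 E2 in l2.
  by have := l1 isT; have := l2 isT; lra.
have sE x : (s x < 2^-1) = (c x < a).
  by rewrite /s gtrDl pmulr_llt0 ?invr_gt0 ?mulr_gt0// subr_lt0.
have ms : mult s by exact: mD (mcst _) (multiplierM (mB hc (mcst _)) (mcst _)).
apply: (multiplier_lim sphpoly_L2 (M := fun n x => step_approx n (s x))).
- by move=> n; apply: mX; apply: mB (mcst _) _; exact: mX.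
- move=> n x; have /andP[h0 h1] := step_approx_le1 n (s01 x).
  by rewrite ger0_norm.
- move=> x; have := step_approx_cvg (s01 x); rewrite sE indicE.
  by rewrite (_ : (x \in _) = (c x < a))//; apply/idP/idP; rewrite inE.
Qed.

Definition re_zeta (x : S2) : R := Re (zeta x).
Definition im_zeta (x : S2) : R := Im (zeta x).

Lemma height_multiplier : mult (@height R).
Proof.
apply: coord_multiplier; first exact: measurable_height.
  by move=> x; have [] := height_zeta_le1 x.
move=> f tf; rewrite (_ : (fun x => _) = fun x => sphmono 'X 0 x * f x); last first.
  by apply/funext => x; rewrite /sphmono hornerX mulr1.
exact: sphpoly_mono_mul.
Qed.

Lemma normc_ge_Re (z : R[i]) : `|Re z| <= normc z.
Proof.
case: z => a b /=; rewrite -sqrtr_sqr ler_sqrt ?addr_ge0 ?sqr_ge0//.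
by rewrite lerDl sqr_ge0.
Qed.

Lemma normc_ge_Im (z : R[i]) : `|Im z| <= normc z.
Proof.
case: z => a b /=; rewrite -sqrtr_sqr ler_sqrt ?addr_ge0 ?sqr_ge0//.
by rewrite lerDr sqr_ge0.
Qed.

Lemma re_zeta_multiplier : mult re_zeta.
Proof.
apply: coord_multiplier; first exact: cmeasurable_zeta.1.
  by move=> x; apply: le_trans (normc_ge_Re _) _; have [] := height_zeta_le1 x.
move=> f tf; rewrite (_ : (fun x => _) =
   fun x => (2^-1)%:C%C * (sphmono 1 1 x * f x + sphmono 1 (-1) x * f x)); last first.
  apply/funext => x; rewrite -mulrDl mulrA; congr (_ * _).
  rewrite /sphmono !hornerC !mul1r /re_zeta /= !expr1 /zeta.
  by apply/eqP; rewrite eq_complex /=; apply/andP; split; apply/eqP; field.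
by apply: sphpoly_scale; apply: sphpoly_add; exact: sphpoly_mono_mul.
Qed.

Lemma im_zeta_multiplier : mult im_zeta.
Proof.
apply: coord_multiplier; first exact: cmeasurable_zeta.2.
  by move=> x; apply: le_trans (normc_ge_Im _) _; have [] := height_zeta_le1 x.
move=> f tf; rewrite (_ : (fun x => _) =
   fun x => (Complex 0 (- 2^-1)) * (sphmono 1 1 x * f x + (-1) * (sphmono 1 (-1) x * f x))); last first.
  apply/funext => x; rewrite mulrA -mulrDl mulrA; congr (_ * _).
  rewrite /sphmono !hornerC !mul1r /im_zeta /= !expr1 /zeta.
  by apply/eqP; rewrite eq_complex /=; apply/andP; split; apply/eqP; field.
by apply: sphpoly_scale; apply: sphpoly_add; [|apply: sphpoly_scale]; exact: sphpoly_mono_mul.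
Qed.

Let Msets : set (set S2) := [set A | indic_multiplier sigma sphpoly A].

Let Msigma : sigma_algebra setT Msets := indic_multiplier_sigma sphpoly_L2 sphpoly_add sphpoly_scale.

Let coord_measurable (c : S2 -> R) : (forall x, `|c x| <= 1) -> mult c ->
  measurable_fun [set: g_sigma_algebraType Msets] c.
Proof.
move=> c1 hc.
apply: (measurability _ (RGenInftyO.measurableE R)).
move=> _ [_ [a ->] <-]; rewrite setTI; apply: sub_sigma_algebra.
rewrite /Msets/= (_ : _ @^-1` _ = [set x | c x < a]); first exact: coord_indic_multiplier.
by apply/seteqP; split => x /=; rewrite in_itv.
Qed.

(** The sets whose indicators are multipliers form a sigma-algebra for which the
    coordinates are measurable, and the coordinates generate the Borel sets. *)
Lemma measurable_indic_multiplier (A : set S2) : measurable A -> indic_multiplier sigma sphpoly A.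
Proof.
move=> [C mC <-]; rewrite setTI.
have bz x : `|re_zeta x| <= 1 /\ `|im_zeta x| <= 1.
  have [_ z1] := height_zeta_le1 x.
  by split; apply: le_trans z1; [exact: normc_ge_Re|exact: normc_ge_Im].
have mv : measurable_fun [set: g_sigma_algebraType Msets] (val : S2 -> R * R * R).
  rewrite (_ : val = fun x => (re_zeta x, im_zeta x, height x)); last first.
    by apply/funext => x; rewrite /re_zeta /im_zeta /height /=; case: (val x) => -[].
  apply: measurable_fun_pair; first apply: measurable_fun_pair; apply: coord_measurable.
  - by move=> x; have [] := bz x.
  - exact: re_zeta_multiplier.
  - by move=> x; have [] := bz x.
  - exact: im_zeta_multiplier.
  - by move=> x; have [] := height_zeta_le1 x.
  - exact: height_multiplier.
have := mv measurableT C mC; rewrite setTI.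
by rewrite /measurable/= /g_sigma_algebraType (sigma_algebra_id Msigma).
Qed.

Theorem sphpoly_dense f : sq_integrable sigma f -> forall e : R, 0 < e ->
  exists2 g, sphpoly g & (L2sq sigma (fun x => f x - g x)%R < e%:E)%E.
Proof.
move=> fi; have [] // := approx_all sphpoly_L2 sphpoly_add sphpoly_scale measurable_indic_multiplier _ fi.
apply: test_approx; first exact: sphpoly_L2.
rewrite (_ : (fun=> 1) = sphmono 1 0); first exact: sphpoly_mono.
by apply/funext => x; rewrite /sphmono hornerC mulr1.
Qed.

End SphereDensity.

(** * Completeness of the space of square-integrable functions *)

Section RieszFischer.
Context d (T : measurableType d) (R : realType).
Context (mu : {measure set T -> \bar R}).
Implicit Types (f g : T -> R[i]).

Lemma geometric_steps_cvg (s : nat -> R) c :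
  (forall k, `|s k.+1 - s k| <= c * (2^-1) ^+ k) -> cvgn s.
Proof.
move=> h.
have c0 : 0 <= c by have := h 0; rewrite expr0 mulr1; apply: le_trans.
have ct : cvgn (series (telescope s)).
  apply: normed_cvg; apply: (@series_le_cvg _ _ (geometric c 2^-1)).
  - by move=> n; exact: normr_ge0.
  - by move=> n; rewrite /geometric/= mulr_ge0// exprn_ge0.
  - by move=> n; exact: h.
  - by apply: is_cvg_geometric_series; rewrite ger0_norm//; lra.
rewrite (_ : s = fun n => s 0%N + series (telescope s) n); last first.
  by apply/funext => n; exact: eq_sum_telescope.
exact: is_cvgD (is_cvg_cst _) ct.
Qed.

(** Split 16^(-k) as 4^(-k) * 4^(-k). One factor makes the sum of
    4^k |F_(k+1) - F_k|^2 integrable, hence finite almost everywhere; where it is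
    finite, |F_(k+1) - F_k| is at most a constant times 2^(-k). *)
Lemma ae_cauchy (F : nat -> T -> R[i]) :
  (forall k, sq_integrable mu (F k)) ->
  (forall k, (L2sq mu (fun x => F k.+1 x - F k x)%R <= ((16^-1) ^+ k)%:E)%E) ->
  exists D : set T, [/\ measurable D, mu (~` D) = 0%E &
    forall x, D x -> cvgn (fun k => Re (F k x)) /\ cvgn (fun k => Im (F k x))].
Proof.
move=> Fi Fle.
pose a k x := nsq (fun y => F k.+1 y - F k y) x.
have a0 k x : 0 <= a k x by exact: nsq_ge0.
have ma k : measurable_fun setT (a k).
  by apply: cmeasurable_nsq; exact: (sq_integrableB (Fi k.+1) (Fi k)).1.
pose S n x := \sum_(k < n) 4 ^+ k * a k x.
have S0 n x : 0 <= S n x by apply: sumr_ge0 => k _; rewrite mulr_ge0// exprn_ge0.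
have mS n : measurable_fun setT (EFin \o S n).
  by apply/measurable_EFinP; apply: measurable_sum => k; exact: measurable_funM.
have ndS x : nondecreasing_seq (fun n => (EFin \o S n) x).
  apply/nondecreasing_seqP => n /=; rewrite lee_fin /S big_ord_recr/= lerDl.
  by rewrite mulr_ge0// exprn_ge0.
pose G x := limn (fun n => (EFin \o S n) x).
have IS n : (\int[mu]_x (S n x)%:E <= 2%:E)%E.
  rewrite /S; under eq_integral do rewrite -sumEFin.
  rewrite ge0_integral_sum//; last 2 first.
  - by move=> k; apply/measurable_EFinP; exact: measurable_funM.
  - by move=> k x _; rewrite lee_fin mulr_ge0// exprn_ge0.
  apply: (@le_trans _ _ (\sum_(k < n) ((4^-1) ^+ k)%:E)%E).
    apply: lee_sum => k _; under eq_integral do rewrite EFinM.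
    rewrite ge0_integralZl//; last 2 first.
    - by apply/measurable_EFinP; exact: ma.
    - by move=> x _; rewrite lee_fin.
    apply: (le_trans (lee_wpmul2l _ (Fle k))); first by rewrite lee_fin exprn_ge0.
    by rewrite -EFinM lee_fin -exprMn (_ : 4 * 16^-1 = 4^-1 :> R)//; field.
  rewrite sumEFin lee_fin.
  have -> : \sum_(k < n) (4^-1) ^+ k = (4 / 3) * (1 - (4^-1) ^+ n) :> R.
    elim: (n) => [|m IH]; first by rewrite big_ord0 expr0 subrr mulr0.
    by rewrite big_ord_recr/= IH exprS; field.
  have : 0 <= (4^-1 : R) ^+ n by rewrite exprn_ge0.
  by lra.
have mG : measurable_fun setT G.
  apply: (@emeasurable_fun_cvg _ _ _ setT (fun n => EFin \o S n)) => // x _.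
  by apply: ereal_nondecreasing_is_cvgn; exact: ndS.
have G0 x : (0 <= G x)%E.
  apply: lime_ge; first by apply: ereal_nondecreasing_is_cvgn; exact: ndS.
  by apply: nearW => n; rewrite lee_fin.
have IG : (\int[mu]_x G x <= 2%:E)%E.
  rewrite monotone_convergence//; last by move=> *; first [exact: ndS | rewrite lee_fin].
  apply: lime_le; last by apply: nearW => n; exact: IS.
  apply: ereal_nondecreasing_is_cvgn => m n mn.
  apply: ge0_le_integral => //.
  - by move=> x _; rewrite lee_fin.
  - by move=> x _; exact: ndS.
have iG : mu.-integrable setT G.
  apply/integrableP; split => //.
  under eq_integral do rewrite gee0_abs//.
  by rewrite (le_lt_trans IG)// ltry.
exists [set x | (G x < +oo)%E]; split.
- by rewrite -[X in measurable X]setTI; apply: emeasurable_fun_infty_o.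
- have [N [mN N0 sN]] := integrable_ae measurableT iG.
  apply/eqP; rewrite eq_le measure_ge0 andbT -N0 le_measure ?inE//.
    apply: measurableC; rewrite -[X in measurable X]setTI.
    exact: emeasurable_fun_infty_o.
  move=> x /= /negP; rewrite -leNgt leye_eq => /eqP Gx; apply: sN => /= /(_ I).
  by rewrite Gx.
- move=> x /= Gx.
  have Gf : G x \is a fin_num by rewrite ge0_fin_numE.
  have SG n : S n x <= fine (G x).
    rewrite -lee_fin fineK//.
    have cS := ereal_nondecreasing_cvgn (ndS x).
    rewrite /G (cvg_lim _ cS)//; apply: ereal_sup_ubound; exists n => //.
  have akle k : a k x <= fine (G x) * (4^-1) ^+ k.
    rewrite exprVn ler_pdivlMr ?exprn_gt0// mulrC.
    apply: le_trans (SG k.+1); rewrite /S big_ord_recr/= lerDr sumr_ge0// => i _.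
    by rewrite mulr_ge0// exprn_ge0.
  have step (h : R[i] -> R) : (forall z w, h (z - w) = h z - h w) ->
      (forall f y, h (f y) ^+ 2 <= nsq f y) -> cvgn (fun k => h (F k x)).
    move=> hB hle; apply: (@geometric_steps_cvg _ (Num.sqrt (fine (G x)))) => k.
    rewrite -hB -sqrtr_sqr -[(2^-1) ^+ k]ger0_norm ?exprn_ge0// -sqrtr_sqr.
    rewrite -sqrtrM ?fine_ge0// ler_sqrt; last by rewrite mulr_ge0 ?fine_ge0 ?sqr_ge0.
    apply: (le_trans (hle (fun y => F k.+1 y - F k y) x)).
    have -> : (2^-1 ^+ k) ^+ 2 = 4^-1 ^+ k :> R.
      by rewrite -exprM mulnC exprM; congr (_ ^+ _); rewrite expr2; field.
    exact: akle.
  split; apply: step; do ?[by move=> z w; rewrite raddfB]; move=> f y.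
    by rewrite /nsq lerDl sqr_ge0.
  by rewrite /nsq lerDr sqr_ge0.
Qed.

Lemma L2sq_ae f g : cmeasurable f -> cmeasurable g ->
  {ae mu, forall x, f x = g x} -> L2sq mu f = L2sq mu g.
Proof.
move=> mf mg fg; apply: ge0_ae_eq_integral => //.
- exact: measurable_nsq.
- exact: measurable_nsq.
- by move=> x _; rewrite lee_fin nsq_ge0.
- by move=> x _; rewrite lee_fin nsq_ge0.
- by apply: filterS fg => x fgx _; rewrite /nsq fgx.
Qed.

Lemma cmeasurableB f g : cmeasurable f -> cmeasurable g ->
  cmeasurable (fun x => f x - g x).
Proof.
move=> [fr fi] [gr gi]; split.
  by under eq_fun do rewrite raddfB; exact: measurable_funB.
by under eq_fun do rewrite raddfB; exact: measurable_funB.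
Qed.

(** The pointwise limit given by [ae_cauchy] is the limit in mean, by Fatou's lemma
    applied to |F_n - F_k|^2 as k grows. *)
Lemma L2_limit (F : nat -> T -> R[i]) : (forall k, sq_integrable mu (F k)) ->
  (forall n k, (n <= k)%N ->
    (L2sq mu (fun x => F n x - F k x)%R <= ((16^-1) ^+ n)%:E)%E) ->
  exists2 f, sq_integrable mu f &
    forall n, (L2sq mu (fun x => F n x - f x)%R <= ((16^-1) ^+ n)%:E)%E.
Proof.
move=> Fi Fle.
have Fstep k : (L2sq mu (fun x => F k.+1 x - F k x)%R <= ((16^-1) ^+ k)%:E)%E.
  by have := Fle k k.+1 (leqnSn k); rewrite /L2sq; under eq_integral do rewrite nsqBC.
have [D [mD D0 cD]] := ae_cauchy Fi Fstep.
(* Cutting off outside D makes the sequence converge at every point. *)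
pose F' k x : R[i] := (\1_D x)%:C%C * F k x.
have mF' k : cmeasurable (F' k).
  exact: cmeasurableM (cmeasurable_real (measurable_indic mD)) (Fi k).1.
have part (h : R[i] -> R) : (forall (a : R) z, h (a%:C%C * z) = a * h z) ->
    (forall x, D x -> cvgn (fun k => h (F k x))) ->
    forall x, (fun k => h (F' k x)) @ \oo --> limn (fun k => h (F' k x)).
  move=> hM hD x; have [Dx|nDx] := pselect (D x).
    have -> : (fun k => h (F' k x)) = (fun k => h (F k x)).
      by apply/funext => k; rewrite /F' hM indicE mem_set// mul1r.
    exact: hD.
  have -> : (fun k => h (F' k x)) = cst 0.
    by apply/funext => k; rewrite /F' hM indicE memNset// mul0r.
  exact: is_cvg_cst.
have cr := part (@Re R) (fun a z => _) (fun x Dx => (cD x Dx).1).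
have {}cr x : (fun k => Re (F' k x)) @ \oo --> limn (fun k => Re (F' k x)).
  by apply: cr => a z; rewrite Defs.ReM /= mul0r subr0.
have ci := part (@Im R) (fun a z => _) (fun x Dx => (cD x Dx).2).
have {}ci x : (fun k => Im (F' k x)) @ \oo --> limn (fun k => Im (F' k x)).
  by apply: ci => a z; rewrite Defs.ImM /= mul0r addr0.
pose f x : R[i] := Complex (limn (fun k => Re (F' k x))) (limn (fun k => Im (F' k x))).
have mf : cmeasurable f.
  split; apply/measurable_EFinP.
    apply: (@emeasurable_fun_cvg _ _ _ setT (fun n x => (Re (F' n x))%:E)).
      by move=> n; apply/measurable_EFinP; exact: (mF' n).1.
    by move=> x _; apply: cvg_EFin; [exact: nearW|exact: cr].
  apply: (@emeasurable_fun_cvg _ _ _ setT (fun n x => (Im (F' n x))%:E)).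
    by move=> n; apply/measurable_EFinP; exact: (mF' n).2.
  by move=> x _; apply: cvg_EFin; [exact: nearW|exact: ci].
have aeD k : {ae mu, forall x, F k x = F' k x}.
  exists (~` D); split => //; first exact: measurableC.
  move=> x /= h Dx; apply: h.
  by rewrite /F' indicE mem_set// mul1r.
have bound n : (L2sq mu (fun x => F n x - f x)%R <= ((16^-1) ^+ n)%:E)%E.
  have -> : L2sq mu (fun x => F n x - f x)%R = L2sq mu (fun x => F' n x - f x)%R.
    apply: L2sq_ae.
    - exact: cmeasurableB (Fi n).1 mf.
    - exact: cmeasurableB (mF' n) mf.
    - by apply: filterS (aeD n) => x ->.
  have E k : L2sq mu (fun x => F' n x - F' k x)%R = L2sq mu (fun x => F n x - F k x)%R.
    apply: L2sq_ae.
    - exact: cmeasurableB (mF' n) (mF' k).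
    - exact: cmeasurableB (Fi n).1 (Fi k).1.
    - by apply: filterS2 (aeD n) (aeD k) => x -> ->.
  have mFF k : measurable_fun setT (EFin \o nsq (fun x => F' n x - F' k x)).
    by apply: measurable_nsq; exact: cmeasurableB (mF' n) (mF' k).
  have FF0 k x : [set: T] x -> (0 <= (EFin \o nsq (fun x => F' n x - F' k x)%R) x)%E.
    by move=> _; rewrite lee_fin nsq_ge0.
  have := @fatou _ T R mu setT measurableT _ mFF FF0.
  have -> : (\int[mu]_x limn_einf (fun k => (EFin \o nsq (fun x => F' n x - F' k x)%R) x))%E
      = L2sq mu (fun x => F' n x - f x)%R.
    apply: eq_integral => x _.
    have c (h : R -> R) (s : nat -> R) (l a : R) : s @ \oo --> l ->
        (fun k => (a - s k) * (a - s k)) @ \oo --> (a - l) * (a - l).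
      move=> sl; have ca : (cst a : nat -> R) @ \oo --> a by exact: cvg_cst.
      exact: cvgM (cvgB ca sl) (cvgB ca sl).
    have cc : (fun k => nsq (fun x => F' n x - F' k x) x) @ \oo -->
        nsq (fun x => F' n x - f x) x.
      rewrite /nsq !raddfB /=.
      have -> : (fun k => Re (F' n x - F' k x) ^+ 2 + Im (F' n x - F' k x) ^+ 2) =
        (fun k => (Re (F' n x) - Re (F' k x)) * (Re (F' n x) - Re (F' k x)) +
                  (Im (F' n x) - Im (F' k x)) * (Im (F' n x) - Im (F' k x))).
        by apply/funext => k; rewrite !raddfB /= !expr2.
      rewrite !expr2; exact: cvgD (c idfun _ _ _ (cr x)) (c idfun _ _ _ (ci x)).
    have ce : (fun k => (EFin \o nsq (fun x => F' n x - F' k x)) x) @ \oo -->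
        (nsq (fun x => F' n x - f x) x)%:E.
      by apply: cvg_EFin; [exact: nearW|exact: cc].
    by rewrite is_cvg_limn_einfE ?(cvg_lim _ ce)//; apply/cvg_ex; eexists; exact: ce.
  move/le_trans; apply; rewrite limn_einf_lim.
  apply: lime_le; first exact: is_cvg_einfs.
  exists n => // k /= nk; apply: (@le_trans _ _ (L2sq mu (fun x => F' n x - F' k x)%R)).
    by apply: ereal_inf_lbound; exists k => //=.
  by rewrite E; exact: Fle.
exists f => //.
have -> : f = (fun x => F 0%N x - (F 0%N x - f x)).
  by apply/funext => x; rewrite opprB addrC subrK.
apply: sq_integrableB => //; apply/sq_integrableP; split.
  exact: cmeasurableB (Fi 0%N).1 mf.
apply/integrableP; split; first by apply: measurable_nsq; exact: cmeasurableB (Fi 0%N).1 mf.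
under eq_integral do rewrite /= ger0_norm ?nsq_ge0//.
by rewrite (le_lt_trans (bound 0%N))// ltry.
Qed.

End RieszFischer.

Section L2Norm.
Context d (T : measurableType d) (R : realType).
Context (mu : {measure set T -> \bar R}).
Implicit Types (u v : L2space mu).
Local Notation norm := (hnorm (@L2dot _ _ _ mu)).

Lemma Re_L2dot u : Re (L2dot u u) = \int[mu]_x nsq (L2repr u) x.
Proof.
by apply: eq_Rintegral => x _; rewrite Defs.ReM Defs.ReJ Defs.ImJ mulrN opprK /nsq !expr2.
Qed.

Lemma hnorm_sqE u : (norm u ^+ 2)%:E = L2sq mu (L2repr u).
Proof.
have [_ ii] := (sq_integrableP mu _).1 (L2reprP u).
rewrite /hnorm Re_L2dot sqr_sqrtr; last by apply: Rintegral_ge0 => x _; exact: nsq_ge0.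
by rewrite /Rintegral fineK//; exact: integrable_fin_num ii.
Qed.

Lemma L2reprB u v : {ae mu, forall x, L2repr (u - v) x = L2repr u x - L2repr v x}.
Proof.
have h1 := L2reprD u (L2opp v); have h2 := L2reprZ (-1) v.
by apply: filterS2 h1 h2 => x E1 E2; rewrite -mulN1r -E2; exact: E1.
Qed.

Lemma hnorm_sqB u v f g : {ae mu, forall x, L2repr u x = f x} ->
  {ae mu, forall x, L2repr v x = g x} -> cmeasurable f -> cmeasurable g ->
  (norm (u - v) ^+ 2)%:E = L2sq mu (fun x => f x - g x)%R.
Proof.
move=> uf vg mf mg; rewrite hnorm_sqE; apply: L2sq_ae.
- exact: (L2reprP _).1.
- exact: cmeasurableB.
- have h := L2reprB u v.
  near=> x; rewrite (near h x)// (near uf x)// (near vg x)//.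
Unshelve. all: by end_near. Qed.

(** Riesz-Fischer: a subsequence converges at the geometric rate that [L2_limit]
    asks for, and it drags the whole sequence with it. *)
Theorem L2_complete (u : nat -> L2space mu) :
  (forall e : R, 0 < e -> exists N, forall m n, (N <= m)%N -> (N <= n)%N ->
     norm (u m - u n) ^+ 2 < e) ->
  exists v, forall e : R, 0 < e -> exists N, forall n, (N <= n)%N ->
     norm (u n - v) ^+ 2 < e.
Proof.
move=> cu.
have e16 k : 0 < (16^-1 : R) ^+ k by rewrite exprn_gt0.
have [N hN] := choice (fun k => cu _ (e16 k)).
pose n_ k := \sum_(i < k.+1) N i.
have nN k : (N k <= n_ k)%N by rewrite /n_ big_ord_recr leq_addl.
have nmono j k : (j <= k)%N -> (n_ j <= n_ k)%N.
  move=> jk; rewrite /n_ -(big_mkord xpredT) -(big_mkord xpredT N).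
  by rewrite [X in (_ <= X)%N](big_cat_nat _ (n := j.+1))//= leq_addr.
have [||f fi hf] := @L2_limit _ _ _ mu (fun k => L2repr (u (n_ k))).
- by move=> k; exact: L2reprP.
- move=> j k jk; rewrite -(@hnorm_sqB (u (n_ j)) (u (n_ k))); last 4 first.
  + exact: aeW.
  + exact: aeW.
  + exact: (L2reprP _).1.
  + exact: (L2reprP _).1.
  by rewrite lee_fin ltW// hN// (leq_trans (nN j))// nmono.
exists (L2class fi) => e e0.
have e4 : 0 < e / 4 by rewrite divr_gt0.
have [k hk] : exists k, (16^-1 : R) ^+ k < e / 4.
  have q1 : `|16^-1 : R| < 1 by rewrite ger0_norm//; lra.
  have /cvgr0Pnorm_lt/(_ _ e4)[k _ /(_ k (leqnn k))/= hk] := cvg_expr q1.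
  by exists k; apply: le_lt_trans hk; exact: ler_norm.
exists (n_ k) => n kn.
have E : (norm (u n - L2class fi) ^+ 2)%:E =
    L2sq mu (fun x => (L2repr (u n) x - L2repr (u (n_ k)) x) + (L2repr (u (n_ k)) x - f x))%R.
  rewrite (@hnorm_sqB _ _ (L2repr (u n)) f).
  - by apply: eq_integral => x _; rewrite /nsq addrA subrK.
  - exact: aeW.
  - exact: L2class_repr.
  - exact: (L2reprP _).1.
  - exact: fi.1.
rewrite -lte_fin E; apply: (le_lt_trans (L2sqD_le _ _ _)).
- by apply: cmeasurableB; exact: (L2reprP _).1.
- by apply: cmeasurableB fi.1; exact: (L2reprP _).1.
rewrite -(@hnorm_sqB (u n) (u (n_ k))); last 4 first.
- exact: aeW.
- exact: aeW.
- exact: (L2reprP _).1.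
- exact: (L2reprP _).1.
apply: (@le_lt_trans _ _ (2%:E * (((16^-1) ^+ k)%:E + ((16^-1) ^+ k)%:E))%E).
  rewrite lee_wpmul2l//; apply: leeD; last exact: hf.
  by rewrite lee_fin ltW// hN// (leq_trans (nN k)).
by rewrite -EFinD -EFinM lte_fin; lra.
Qed.

End L2Norm.

(** * Unconditional sums of positive operators *)

Section Summation.
Context {R : realType} {I : choiceType}.

Lemma partial_sumE (V : zmodType) (x : I -> V) (A : {fset I}) :
  summability.partial_sum x A = \sum_(i <- A) x i.
Proof. by rewrite [RHS]big_seq_fsetE. Qed.

Lemma partial_sum_le_esum (a : I -> R) (A : {fset I}) (s : R) :
  (forall i, 0 <= a i) -> (\esum_(i in [set: I]) (a i)%:E <= s%:E)%E ->
  summability.partial_sum a A <= s.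
Proof.
move=> a0 sle; rewrite -lee_fin; apply: le_trans sle.
rewrite partial_sumE -sumEFin.
apply: esum_ge; exists [set` A]; first by split.
by rewrite fsbig_finite ?set_fsetK.
Qed.

Lemma partial_sum_subset (a : I -> R) (A B : {fset I}) : (forall i, 0 <= a i) ->
  (A `<=` B)%fset -> summability.partial_sum a A <= summability.partial_sum a B.
Proof.
move=> a0 AB; rewrite !partial_sumE (big_fsetID _ (mem A) B)/=.
rewrite (_ : [fset x in B | x \in A]%fset = A) ?lerDl ?sumr_ge0//.
apply/fsetP => x; rewrite !inE/= andbC; case xA : (x \in A) => //=.
exact: (fsubsetP AB).
Qed.

Lemma esum_partial_sum_cvg (a : I -> R) (s : R) : (forall i, 0 <= a i) ->
  \esum_(i in [set: I]) (a i)%:E = s%:E ->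
  summability.partial_sum a @ summability.totally --> s.
Proof.
move=> a0 sE; apply/cvgrPdist_lt => e e0.
have : ((s - e)%:E < \esum_(i in [set: I]) (a i)%:E)%E by rewrite sE lte_fin gtrBl.
move=> /ereal_sup_gt[_ [X [finX _] <-]]; rewrite fsbig_finite//= sumEFin lte_fin => Xlt.
exists (fset_set X) => // B /= XB.
have sB : summability.partial_sum a B <= s.
  by apply: partial_sum_le_esum => //; rewrite sE.
have := partial_sum_subset a0 XB; rewrite partial_sumE => le.
by rewrite ger0_norm ?subr_ge0// ltrBlDl -ltrBlDr (lt_le_trans Xlt).
Qed.

End Summation.

Section RealInner.
Context {R : realType} {V : lmodType R[i]} (ip : {dot V for conjc}).
Implicit Types u v w : V.

Definition redot u v : R := Re (ip u v).
Local Notation N u := (redot u u).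

Lemma ipC u v : ip u v = (ip v u)^*%C.
Proof. by rewrite hermC expr0 mul1r. Qed.

Lemma redotC u v : redot u v = redot v u.
Proof. by rewrite /redot ipC Defs.ReJ. Qed.

Lemma redotDl u v w : redot (u + v) w = redot u w + redot v w.
Proof. by rewrite /redot linearDl Defs.ReD. Qed.

Lemma redotNl u w : redot (- u) w = - redot u w.
Proof. by rewrite /redot linearNl raddfN. Qed.

Lemma redotBl u v w : redot (u - v) w = redot u w - redot v w.
Proof. by rewrite redotDl redotNl. Qed.

Lemma redotZl (a : R) u w : redot (a%:C%C *: u) w = a * redot u w.
Proof. by rewrite /redot linearZl_LR /= Defs.ReM /= mul0r subr0. Qed.

Lemma redotDr u v w : redot w (u + v) = redot w u + redot w v.
Proof. by rewrite !(redotC w) redotDl. Qed.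

Lemma redotBr u v w : redot w (u - v) = redot w u - redot w v.
Proof. by rewrite !(redotC w) redotBl. Qed.

Lemma redotZr (a : R) u w : redot w (a%:C%C *: u) = a * redot w u.
Proof. by rewrite !(redotC w) redotZl. Qed.

Lemma redot_suml (J : Type) (s : seq J) (P : pred J) (F : J -> V) w :
  redot (\sum_(j <- s | P j) F j) w = \sum_(j <- s | P j) redot (F j) w.
Proof.
elim/big_rec2: _ => [|j y x _ <-]; last by rewrite redotDl.
by rewrite /redot linear0l.
Qed.

Lemma ip_suml (I : Type) (s : seq I) (F : I -> V) w :
  ip (\sum_(i <- s) F i) w = \sum_(i <- s) ip (F i) w.
Proof.
by elim/big_rec2: _ => [|i y x _ <-]; [rewrite linear0l|rewrite linearDl].
Qed.

Lemma ip_sumr (I : Type) (s : seq I) (F : I -> V) w :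
  ip w (\sum_(i <- s) F i) = \sum_(i <- s) ip w (F i).
Proof.
by elim/big_rec2: _ => [|i y x _ <-]; [rewrite linear0r|rewrite linearDr].
Qed.

Lemma ip_realZr (a : R) u w : ip w (a%:C%C *: u) = a%:C%C * ip w u.
Proof. by rewrite linearZr_LR; congr (_ * _); exact: conjc_real. Qed.

Lemma ip_real u : ip u u = (N u)%:C%C.
Proof.
have := ipC u u; rewrite /redot; case: (ip u u) => a b /= [] bE.
by congr Complex; lra.
Qed.

Lemma sqnorm_gt0 u : u != 0 -> 0 < N u.
Proof. by move=> /(@neq0_dnorm_gt0 _ _ _ ip); rewrite ip_real ltcR. Qed.

Lemma sqnorm_ge0 u : 0 <= N u.
Proof.
have [->|/sqnorm_gt0/ltW//] := eqVneq u 0.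
by rewrite /redot linear0l.
Qed.

Lemma sqnorm_eq0 u : N u = 0 -> u = 0.
Proof. by move=> u0; apply/eqP; apply: contraT => /sqnorm_gt0; rewrite u0 ltxx. Qed.

Lemma hnorm_sqr u : hnorm ip u ^+ 2 = N u.
Proof. by rewrite sqr_sqrtr ?sqnorm_ge0. Qed.

Lemma sqnormB u v : N (u - v) = N u - 2 * redot u v + N v.
Proof. by rewrite !(redotBl, redotBr) (redotC v u); ring. Qed.

Definition rlinear (D : V -> V) := (forall u v, D (u + v) = D u + D v) /\
  (forall (a : R) u, D (a%:C%C *: u) = a%:C%C *: D u).

Definition symmetric_op (D : V -> V) := forall u v, redot (D u) v = redot u (D v).

Lemma rlinearB D u v : rlinear D -> D (u - v) = D u - D v.
Proof.
move=> [DD DZ]; rewrite DD; congr (_ + _).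
by rewrite -scaleN1r -[in RHS]scaleN1r -(rmorphN1 (real_complex R)) DZ.
Qed.

(** Positivity of D at g - D g / C, combined with the upper bound at D g. No square
    root of D is involved. *)
Lemma psd_op_bound (D : V -> V) (C : R) g : rlinear D -> symmetric_op D -> 0 < C ->
  (forall u, 0 <= redot (D u) u <= C * N u) -> N (D g) <= C * redot (D g) g.
Proof.
move=> lD sD C0 bD; pose t := C^-1.
have /andP[+ _] := bD (g - t%:C%C *: D g).
have /andP[_ b2] := bD (D g).
rewrite rlinearB// lD.2 !(redotBl, redotBr, redotZl, redotZr).
rewrite -(sD (D g) g) => h.
have C0' : C != 0 by rewrite gt_eqF.
have h2 : t * (t * redot (D (D g)) (D g)) <= t * N (D g).
  have t0 : 0 <= t by rewrite invr_ge0 ltW.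
  apply: ler_wpM2l => //; apply: (le_trans (ler_wpM2l t0 b2)).
  by rewrite mulKf.
have h3 : t * N (D g) <= redot (D g) g.
  move: h h2; rewrite -[redot (D g) (D g)]/(N (D g)) (sD (D g) g).
  by lra.
by rewrite sD; move: h3; rewrite /t ler_pdivrMl.
Qed.

Lemma partial_op_rlinear (I : choiceType) (T : I -> V -> V) (A : {fset I}) :
  (forall i, rlinear (T i)) -> rlinear (fun g => summability.partial_sum (T ^~ g) A).
Proof.
move=> lT; split => [u v|a u]; rewrite !partial_sumE.
  by rewrite -big_split; apply: eq_bigr => i _; exact: (lT i).1.
by rewrite scaler_sumr; apply: eq_bigr => i _; exact: (lT i).2.
Qed.

(** Each remainder D = S - sum_(i in A) T_i lies between 0 and C, so [psd_op_bound]
    bounds |D g|^2 by C <D g, g>, which is C times the remainder of a convergent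
    series of nonnegative numbers. *)
Theorem psd_sum_cvg (I : choiceType) (T : I -> V -> V) (S : V -> V) (C : R) (g : V) :
  (forall i, rlinear (T i)) -> (forall i, symmetric_op (T i)) ->
  (forall i u, 0 <= redot (T i u) u) ->
  rlinear S -> symmetric_op S -> 0 < C ->
  (forall u, redot (S u) u <= C * N u) ->
  (forall u, \esum_(i in [set: I]) (redot (T i u) u)%:E = (redot (S u) u)%:E) ->
  hsums_to ip (fun i => T i g) (S g).
Proof.
move=> lT sT T0 lS sS C0 SC ST.
have E A u : redot (summability.partial_sum (T ^~ u) A) u =
    summability.partial_sum (fun i => redot (T i u) u) A.
  by rewrite !partial_sumE redot_suml.
have bnd A : N (summability.partial_sum (T ^~ g) A - S g) <=
    C * (redot (S g) g - summability.partial_sum (fun i => redot (T i g) g) A).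
  (* The remainder, a positive operator bounded by C. *)
  pose D u := S u - summability.partial_sum (T ^~ u) A.
  have lA := partial_op_rlinear A lT.
  have lD : rlinear D.
    split => [u v|a u]; rewrite /D; first by rewrite lS.1 lA.1 opprD addrACA.
    by rewrite lS.2 lA.2 scalerBr.
  have sD : symmetric_op D.
    move=> u v; rewrite /D redotBl redotBr sS; congr (_ - _).
    rewrite !partial_sumE redot_suml redotC redot_suml; apply: eq_bigr => i _.
    by rewrite sT redotC.
  have bD u : 0 <= redot (D u) u <= C * N u.
    rewrite /D redotBl E; apply/andP; split.
      by rewrite subr_ge0 partial_sum_le_esum// ST.
    apply: le_trans (SC u); rewrite gerBl partial_sumE sumr_ge0// => i _; exact: T0.
  have h := @psd_op_bound D C g lD sD C0 bD.
  have Eg : redot (D g) g = redot (S g) g - summability.partial_sum (fun i => redot (T i g) g) A.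
    by rewrite /D redotBl E.
  by move: h; rewrite Eg /D !sqnormB (redotC (S g)); lra.
have cv : summability.partial_sum (fun i => redot (T i g) g) @ summability.totally --> redot (S g) g.
  by apply: esum_partial_sum_cvg.
apply/cvgr0Pnorm_lt => e e0.
have d0 : 0 < e ^+ 2 / C by rewrite divr_gt0// exprn_gt0.
have /cvgrPdist_lt/(_ _ d0) := cv; apply: filterS => A /= h.
rewrite ger0_norm ?sqrtr_ge0//.
rewrite -(@ltr_pXn2r _ 2) ?nnegrE ?sqrtr_ge0 ?(ltW e0)// hnorm_sqr.
apply: (le_lt_trans (bnd A)); rewrite -ltr_pdivlMl// mulrC.
exact: le_lt_trans (ler_norm _) h.
Qed.

End RealInner.

(** * Double sums of nonnegative families *)

Section Esum.
Context {R : realType}.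
Local Open Scope ereal_scope.

Lemma esum_exchange (T1 T2 : choiceType) (a : T1 -> T2 -> \bar R) :
  (forall i j, 0 <= a i j) ->
  \esum_(i in [set: T1]) \esum_(j in [set: T2]) a i j =
  \esum_(j in [set: T2]) \esum_(i in [set: T1]) a i j.
Proof.
move=> a0; rewrite !esum_esum//.
rewrite (@reindex_esum _ _ _ ([set: T2] `*`` (fun=> [set: T1])) _ (fun x => (x.2, x.1)))//.
split => //=; first by move=> [x y] [x' y'] _ _ /= [-> ->].
by move=> [x y] _; exists (y, x).
Qed.

Lemma esumZ_le (T : choiceType) (a : T -> R) (n : R) : (0 <= n)%R -> (forall i, 0 <= a i)%R ->
  \esum_(i in [set: T]) (n * a i)%:E <= n%:E * \esum_(i in [set: T]) (a i)%:E.
Proof.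
move=> n0 a0; apply: ge_ereal_sup => _ [X [finX _] <-].
rewrite fsbig_finite//= sumEFin -mulr_sumr EFinM lee_wpmul2l ?lee_fin//.
apply: esum_ge; exists X; first by split.
by rewrite fsbig_finite//= sumEFin.
Qed.

Lemma esumZ (T : choiceType) (a : T -> R) (n s : R) : (0 <= n)%R -> (forall i, 0 <= a i)%R ->
  \esum_(i in [set: T]) (a i)%:E = s%:E ->
  \esum_(i in [set: T]) (n * a i)%:E = (n * s)%:E.
Proof.
move=> n0 a0 sE; apply/eqP; rewrite eq_le; apply/andP; split.
  by rewrite EFinM -sE esumZ_le.
have [->|nN0] := eqVneq n 0%R.
  by rewrite mul0r esum_ge0// => i _; rewrite mul0r.
have n0' : (0 < n)%R by rewrite lt_neqAle eq_sym nN0.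
have V0 : (0 <= n^-1)%R by rewrite invr_ge0.
have := @esumZ_le T (fun i => n * a i)%R n^-1 V0 (fun i => mulr_ge0 n0 (a0 i)).
rewrite (eq_esum (b := fun i => (a i)%:E)); last by move=> i _; rewrite mulKf.
by rewrite sE lee_pdivlMl// -EFinM.
Qed.

Lemma esum_sigT (J : choiceType) (K : J -> finType) (a : {j : J & K j} -> \bar R) :
  (forall i, 0 <= a i) ->
  \esum_(i in [set: {j : J & K j}]) a i =
  \esum_(j in [set: J]) (\sum_(k : K j) a (Tagged K k)).
Proof.
move=> a0.
have inner j : \sum_(k : K j) a (Tagged K k) = \esum_(i in [set i | tag i = j]) a i.
  rewrite (@reindex_esum _ _ _ [set: K j] _ (fun k => Tagged K k)); last first.
    split => //=; first by move=> k k' _ _ /eqP; rewrite eq_Tagged => /eqP.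
    by move=> [j' k] /= jj; subst j'; exists k.
  have -> : [set: K j] = [set` index_enum (K j)].
    by apply/seteqP; split => // k _; rewrite /= mem_index_enum.
  rewrite esum_fset//.
  by rewrite -fsbig_seq// index_enum_uniq.
rewrite [RHS](eq_esum (fun j _ => inner j)).
rewrite (@esum_esum _ _ _ setT (fun j => [set i | tag i = j]) (fun _ i => a i))//.
rewrite (@reindex_esum _ _ _ ([set: J] `*`` (fun j => [set i | tag i = j])) _ snd)//.
split => //=.
- by move=> [j i] [j' i'] /[!inE]/= -[_ <-] [_ <-] ->.
- by move=> i _; exists (tag i, i).
Qed.

End Esum.

(** * Resolutions of the identity and their multipliers *)

Section Projections.
Context {R : realType} {V : lmodType R[i]} (ip : {dot V for conjc}).
Implicit Types (u v w : V) (c : nat -> R).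
Local Notation rdot := (redot ip).
Local Notation N u := (rdot u u).
(** Orthogonal projections onto mutually orthogonal subspaces of a Hilbert space,
    whose finite sums approximate every vector. *)
Variable P : nat -> V -> V.
Hypothesis P_lin : forall l a u v, P l (a *: u + v) = a *: P l u + P l v.
Hypothesis P_sym : forall l u v, ip (P l u) v = ip u (P l v).
Hypothesis P_proj : forall l k u, P l (P k u) = if l == k then P l u else 0.
Hypothesis P_dense : forall u (e : R), 0 < e ->
  exists L, N (u - \sum_(l < L) P l u) < e.
Hypothesis complete : forall s : nat -> V,
  (forall e : R, 0 < e -> exists M, forall m n, (M <= m)%N -> (M <= n)%N ->
     N (s m - s n) < e) ->
  exists v, forall e : R, 0 < e -> exists M, forall n, (M <= n)%N -> N (s n - v) < e.

Lemma projD l u v : P l (u + v) = P l u + P l v.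
Proof. by rewrite -[u in LHS]scale1r P_lin scale1r. Qed.

Lemma proj0 l : P l 0 = 0.
Proof. by apply: (addrI (P l 0)); rewrite -projD !addr0. Qed.

Lemma projZ l a u : P l (a *: u) = a *: P l u.
Proof. by rewrite -[a *: u in LHS]addr0 P_lin proj0 addr0. Qed.

Lemma projB l u v : P l (u - v) = P l u - P l v.
Proof. by rewrite projD -scaleN1r projZ scaleN1r. Qed.

Lemma proj_sum l (J : Type) (s : seq J) (F : J -> V) :
  P l (\sum_(j <- s) F j) = \sum_(j <- s) P l (F j).
Proof. by elim/big_rec2: _ => [|j y x _ <-]; [exact: proj0|rewrite projD]. Qed.

Lemma proj_symmetric l : symmetric_op ip (P l).
Proof. by move=> u v; rewrite /redot P_sym. Qed.

Lemma redot_proj l k u v : rdot (P l u) (P k v) = if l == k then rdot (P l u) v else 0.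
Proof.
rewrite proj_symmetric P_proj; case: eqP => _; first by rewrite proj_symmetric.
by rewrite /redot linear0r.
Qed.

Lemma sqnorm_proj l u : N (P l u) = rdot (P l u) u.
Proof. by rewrite redot_proj eqxx. Qed.

Lemma sqnorm_comb c u (r : seq nat) : uniq r ->
  N (\sum_(l <- r) (c l)%:C%C *: P l u) = \sum_(l <- r) c l ^+ 2 * N (P l u).
Proof.
move=> ur; rewrite redot_suml; rewrite big_seq [RHS]big_seq; apply: eq_bigr => l lr.
rewrite redotC redot_suml (bigD1_seq l)//= big1 => [|k /negPf kl].
  by rewrite addr0 redotZl redotZr sqnorm_proj; ring.
by rewrite redotZl redotZr redot_proj kl !mulr0.
Qed.

Lemma sqnorm_tail u L : N (u - \sum_(l < L) P l u) = N u - \sum_(l < L) N (P l u).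
Proof.
have E : \sum_(l < L) P l u = \sum_(0 <= l < L) (1 : R)%:C%C *: P l u.
  by rewrite big_mkord; apply: eq_bigr => l _; rewrite scale1r.
have E2 : \sum_(l < L) N (P l u) = \sum_(0 <= l < L) N (P l u) by rewrite big_mkord.
have NS : N (\sum_(l < L) P l u) = \sum_(l < L) N (P l u).
  rewrite E (sqnorm_comb (fun=> 1)) ?iota_uniq// E2; apply: eq_bigr => l _.
  by rewrite expr1n mul1r.
rewrite sqnormB NS redotC redot_suml (eq_bigr (fun l : 'I_L => N (P l u))); first by ring.
by move=> l _; rewrite sqnorm_proj.
Qed.

Lemma parseval_partial_le u L : \sum_(l < L) N (P l u) <= N u.
Proof. by rewrite -subr_ge0 -sqnorm_tail sqnorm_ge0. Qed.

Lemma parseval_partial_mono u L L' : (L <= L')%N ->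
  \sum_(l < L) N (P l u) <= \sum_(l < L') N (P l u).
Proof.
move=> LL; rewrite -!(big_mkord xpredT (fun l => N (P l u))).
rewrite [leRHS](big_cat_nat _ (n := L))//= lerDl.
by apply: sumr_ge0 => l _; exact: sqnorm_ge0.
Qed.

Lemma parseval_cvg u : (fun L => \sum_(l < L) N (P l u)) @ \oo --> N u.
Proof.
apply/cvgrPdist_lt => e e0; have [L hL] := P_dense u e0.
exists L => // L' /= LL; rewrite ger0_norm ?subr_ge0 ?parseval_partial_le//.
apply: le_lt_trans hL; rewrite sqnorm_tail lerD2l lerN2.
exact: parseval_partial_mono.
Qed.

Lemma parseval u : \esum_(l in [set: nat]) (N (P l u))%:E = (N u)%:E.
Proof.
rewrite -nneseries_esumT; last by move=> l; rewrite lee_fin sqnorm_ge0.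
apply/cvg_lim => //; under eq_fun do rewrite big_mkord sumEFin.
by apply: cvg_EFin; [exact: nearW|exact: parseval_cvg].
Qed.

Lemma sqnorm_proj_le l u : N (P l u) <= N u.
Proof.
apply: le_trans (parseval_partial_le u l.+1); rewrite big_ord_recr/= lerDr.
by apply: sumr_ge0 => k _; exact: sqnorm_ge0.
Qed.

Lemma proj_inj u v : (forall l, P l u = P l v) -> u = v.
Proof.
move=> uv; apply/eqP; rewrite -subr_eq0; apply/eqP; apply: (@sqnorm_eq0 _ _ ip).
apply/eqP; rewrite -eqe -parseval; apply/eqP; apply: esum1 => l _.
by rewrite projB uv subrr /redot linear0l.
Qed.

(** Polarization of [parseval_cvg]. *)
Lemma redot_cvg u v : (fun L => \sum_(l < L) rdot (P l u) v) @ \oo --> rdot u v.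
Proof.
have E : (fun L => \sum_(l < L) rdot (P l u) v) = (fun L =>
    4^-1 * (\sum_(l < L) N (P l (u + v)) - \sum_(l < L) N (P l (u - v)))).
  apply/funext => L; rewrite -sumrB mulr_sumr; apply: eq_bigr => l _.
  rewrite projD projB sqnormB !(redotDl, redotDr) (redotC ip (P l v)) !redot_proj eqxx.
  by field.
have -> : rdot u v = 4^-1 * (N (u + v) - N (u - v)).
  by rewrite sqnormB !(redotDl, redotDr) (redotC ip v u); field.
rewrite E; apply: cvgMl_tmp; apply: cvgB; exact: parseval_cvg.
Qed.

(** The projections are contractions, hence continuous. *)
Lemma proj_limit l (s : nat -> V) v : (forall e : R, 0 < e ->
    exists M, forall n, (M <= n)%N -> N (s n - v) < e) ->
  forall w, (exists M, forall n, (M <= n)%N -> P l (s n) = w) -> P l v = w.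
Proof.
move=> sv w [M hM]; apply/eqP; rewrite -subr_eq0 -oppr_eq0 opprB; apply/eqP.
apply: (@sqnorm_eq0 _ _ ip); apply/eqP; rewrite eq_le sqnorm_ge0 andbT.
apply/ler_addgt0Pr => e e0; rewrite add0r.
have [M' hM'] := sv e e0; have := hM' (maxn M M') (leq_maxr _ _).
move/ltW; apply: le_trans; rewrite -(hM (maxn M M') (leq_maxl _ _)) -projB.
exact: sqnorm_proj_le.
Qed.

(** The partial sums of c_l P_l u form a Cauchy sequence, since their increments are
    at most B^2 times those of Parseval's series. *)
Lemma multiplier_exists c (B : R) u : (forall l, `|c l| <= B) ->
  exists v, forall l, P l v = (c l)%:C%C *: P l u.
Proof.
move=> cB; have B0 : 0 <= B by apply: le_trans (cB 0%N).
pose s n := \sum_(0 <= l < n) (c l)%:C%C *: P l u.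
have sB n m : (n <= m)%N -> N (s m - s n) <=
    B ^+ 2 * (\sum_(l < m) N (P l u) - \sum_(l < n) N (P l u)).
  move=> nm.
  have -> : s m - s n = \sum_(n <= l < m) (c l)%:C%C *: P l u.
    by rewrite /s [X in X - _](big_cat_nat _ (n := n))//= [LHS]addrC addKr.
  have -> : \sum_(l < m) N (P l u) - \sum_(l < n) N (P l u) = \sum_(n <= l < m) N (P l u).
    rewrite -!(big_mkord xpredT (fun l => N (P l u))).
    by rewrite [X in X - _](big_cat_nat _ (n := n))//= [LHS]addrC addKr.
  rewrite sqnorm_comb ?iota_uniq// mulr_sumr; apply: ler_sum => l _.
  apply: ler_wpM2r; first exact: sqnorm_ge0.
  by rewrite -(real_normK (num_real (c l))) lerXn2r ?nnegrE.
have [|v sv] := complete (s := s).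
  move=> e e0; have B1 : 0 < B ^+ 2 + 1 by rewrite ltr_wpDl// sqr_ge0.
  have [M hM] := P_dense u (divr_gt0 e0 B1); rewrite sqnorm_tail in hM.
  exists M.
  have W n m : (M <= n)%N -> (n <= m)%N -> N (s m - s n) < e.
    move=> Mn nm; apply: (le_lt_trans (sB _ _ nm)).
    have d0 : \sum_(l < m) N (P l u) - \sum_(l < n) N (P l u) < e / (B ^+ 2 + 1).
      by apply: le_lt_trans hM; apply: lerB; [exact: parseval_partial_le|exact: parseval_partial_mono].
    have d1 : 0 <= \sum_(l < m) N (P l u) - \sum_(l < n) N (P l u).
      by rewrite subr_ge0 parseval_partial_mono.
    apply: (@le_lt_trans _ _ ((B ^+ 2 + 1) * (\sum_(l < m) N (P l u) - \sum_(l < n) N (P l u)))).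
      by apply: ler_wpM2r => //; rewrite lerDl.
    by rewrite mulrC -ltr_pdivlMr.
  move=> m n Mm Mn; have [nm|/ltnW mn] := leqP n m; first exact: W.
  by have := W _ _ Mm mn; rewrite !sqnormB (redotC ip (s n) (s m)); lra.
exists v => l; apply: (proj_limit sv); exists l.+1 => n ln.
rewrite /s proj_sum (bigD1_seq l)/= ?mem_index_iota ?iota_uniq// projZ P_proj eqxx.
by rewrite big1 ?addr0// => k /negPf kl; rewrite projZ P_proj eq_sym kl scaler0.
Qed.

(** The vector is determined by its projections ([proj_inj]), whence the choice;
    the value is 0 where no such vector exists. *)
Definition mulop c u : V :=
  if pselect (exists v, forall l, P l v = (c l)%:C%C *: P l u) is left h
  then sval (cid h) else 0.

Lemma proj_mulop c (B : R) u l : (forall l, `|c l| <= B) ->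
  P l (mulop c u) = (c l)%:C%C *: P l u.
Proof.
move=> cB; rewrite /mulop; case: pselect => [h|]; last by move=> /(_ (multiplier_exists u cB)).
by case: (cid h) => v /= ->.
Qed.

Lemma mulop_rlinear c (B : R) : (forall l, `|c l| <= B) -> rlinear (mulop c).
Proof.
move=> cB; split => [u v|a u]; apply: proj_inj => l.
  by rewrite projD !(proj_mulop _ _ cB) projD scalerDr.
by rewrite projZ !(proj_mulop _ _ cB) projZ !scalerA mulrC.
Qed.

(** A vector need not be a finite sum of projections, so the symmetry is obtained in
    the limit from that of the finite sums ([redot_cvg]). *)
Lemma mulop_symmetric c (B : R) : (forall l, `|c l| <= B) -> symmetric_op ip (mulop c).
Proof.
move=> cB u v.
have h1 := @redot_cvg (mulop c u) v; have h2 := @redot_cvg (mulop c v) u.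
have E : (fun L => \sum_(l < L) rdot (P l (mulop c u)) v) =
    (fun L => \sum_(l < L) rdot (P l (mulop c v)) u).
  apply/funext => L; apply: eq_bigr => l _.
  by rewrite !(proj_mulop _ _ cB) !redotZl proj_symmetric redotC.
by rewrite [RHS]redotC -(cvg_lim _ h1)// -(cvg_lim _ h2)// E.
Qed.

Lemma redot_mulop c (B : R) u : (forall l, 0 <= c l <= B) ->
  (rdot (mulop c u) u)%:E = \esum_(l in [set: nat]) (c l * N (P l u))%:E.
Proof.
move=> cB; have cB' l : `|c l| <= B by have /andP[c0 ?] := cB l; rewrite ger0_norm.
rewrite -nneseries_esumT; last first.
  by move=> l; have /andP[c0 _] := cB l; rewrite lee_fin mulr_ge0// sqnorm_ge0.
apply/esym/cvg_lim => //; under eq_fun do rewrite big_mkord sumEFin.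
apply: cvg_EFin; first exact: nearW.
rewrite /comp /=; have := @redot_cvg (mulop c u) u.
by under eq_fun do under eq_bigr do rewrite (proj_mulop _ _ cB') redotZl -sqnorm_proj.
Qed.


(** A family grouped into finite blocks, each of which is diagonal with respect to the
    projections: the weights are the squares of b in the frame operator, and B gathers
    them over all the blocks. *)
Section MultiplierFrames.
Context {J : countType} {K : J -> finType}.
Variables (f f' : forall j : J, K j -> V) (b : J -> nat -> R) (d : J -> nat).
Variables (B : nat -> R) (C1 C2 : R).
Hypothesis C1_gt0 : 0 < C1.
Hypothesis B_bounds : forall l, C1 <= B l <= C2.
Hypothesis B_sum : forall l, \esum_(j in [set: J]) (b j l ^+ 2)%:E = (B l)%:E.
Hypothesis b_deg : forall j l, (d j < l)%N -> b j l = 0.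
Hypothesis f_sum : forall j u, \sum_(k : K j) ip u (f k) *: f k =
  \sum_(l < (d j).+1) (b j l ^+ 2)%:C%C *: P l u.
Hypothesis f'_sum : forall j u, \sum_(k : K j) ip u (f k) *: f' k =
  \sum_(l < (d j).+1) (b j l ^+ 2 / B l)%:C%C *: P l u.
Hypothesis f'_P : forall l j (k : K j), P l (f' k) = (B l)^-1%:C%C *: P l (f k).

Definition bandmul (q : nat -> R) n u := \sum_(l < n.+1) (q l)%:C%C *: P l u.

Lemma bandmul_rlinear q n : rlinear (bandmul q n).
Proof.
split=> [u v|a u]; rewrite /bandmul; [rewrite -big_split|rewrite scaler_sumr];
  apply: eq_bigr => l _ /=; first by rewrite projD scalerDr.
by rewrite projZ !scalerA mulrC.
Qed.

Lemma bandmul_symmetric q n : symmetric_op ip (bandmul q n).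
Proof.
move=> u v; rewrite /bandmul redot_suml redotC redot_suml; apply: eq_bigr => l _.
by rewrite !redotZl proj_symmetric redotC.
Qed.

Lemma redot_bandmul q n u : rdot (bandmul q n u) u = \sum_(l < n.+1) q l * N (P l u).
Proof. by rewrite redot_suml; apply: eq_bigr => l _; rewrite redotZl sqnorm_proj. Qed.

(** Exchange of the sums over j and l, both over nonnegative terms. *)
Lemma esum_bandmul (q : J -> nat -> R) (s : nat -> R) u :
  (forall j l, 0 <= q j l) -> (forall j l, (d j < l)%N -> q j l = 0) ->
  (forall l, \esum_(j in [set: J]) (q j l)%:E = (s l)%:E) ->
  \esum_(j in [set: J]) (rdot (bandmul (q j) (d j) u) u)%:E =
  \esum_(l in [set: nat]) (s l * N (P l u))%:E.
Proof.
move=> q0 qd qs.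
have qN0 j l : (0 <= (q j l * N (P l u))%:E)%E by rewrite lee_fin mulr_ge0// sqnorm_ge0.
have E j : (rdot (bandmul (q j) (d j) u) u)%:E = \esum_(l in [set: nat]) (q j l * N (P l u))%:E.
  rewrite redot_bandmul -nneseries_esumT//; apply/esym/cvg_lim => //.
  apply: cvg_near_cst; exists (d j).+1 => // n /= dn.
  rewrite (big_cat_nat _ (n := (d j).+1))//= big_mkord sumEFin [X in (_ + X)%E]big_nat_cond.
  rewrite [X in (_ + X)%E]big1 ?adde0// => l /andP[/andP[dl _] _].
  by rewrite qd ?mul0r.
rewrite (eq_esum (fun j _ => E j)) esum_exchange//; apply: eq_esum => l _.
under eq_esum do rewrite mulrC.
by rewrite (esumZ (sqnorm_ge0 ip _) (q0^~ l) (qs l)) mulrC.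
Qed.

Let B_gt0 l : 0 < B l.
Proof. by have /andP[h _] := B_bounds l; exact: lt_le_trans h. Qed.

Let C2_gt0 : 0 < C2.
Proof. by have /andP[_ h] := B_bounds 0; exact: lt_le_trans h. Qed.

Let B_norm l : `|B l| <= C2.
Proof. by rewrite gtr0_norm//; have /andP[] := B_bounds l. Qed.

Let BV_norm l : `|(B l)^-1| <= C1^-1.
Proof.
by rewrite gtr0_norm ?invr_gt0// lef_pV2 ?posrE//; have /andP[] := B_bounds l.
Qed.

Lemma rank_one_form u v : rdot (ip u v *: v) u = normc (ip u v) ^+ 2.
Proof.
by rewrite /redot linearZl_LR/= (ipC ip v u) Defs.ReM Defs.ReJ Defs.ImJ normc_sqr; ring.
Qed.

Lemma esum_tight u :
  \esum_(i in [set: {j : J & K j}]) (normc (ip u (f (tagged i))) ^+ 2)%:E =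
  \esum_(l in [set: nat]) (B l * N (P l u))%:E.
Proof.
rewrite (@esum_sigT _ _ K (fun i => (normc (ip u (f (tagged i))) ^+ 2)%:E)).
  by rewrite -(esum_bandmul u (fun j l => sqr_ge0 (b j l)) _ B_sum) => [|j l dl];
    [apply: eq_esum => j _; rewrite sumEFin /bandmul -f_sum redot_suml; congr EFin;
     apply: eq_bigr => k _; rewrite rank_one_form|rewrite b_deg// expr0n].
by move=> i; rewrite lee_fin sqr_ge0.
Qed.

Lemma multiplier_frame : is_frame ip (fun i : {j : J & K j} => f (tagged i)) C1 C2.
Proof.
split=> // g; rewrite esum_tight hnorm_sqr; apply/andP; split.
  have <- := esumZ (ltW C1_gt0) (fun l => sqnorm_ge0 ip (P l g)) (parseval g).
  apply: le_esum => l _; rewrite lee_fin ler_wpM2r ?sqnorm_ge0//.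
  by have /andP[] := B_bounds l.
have <- := esumZ (ltW C2_gt0) (fun l => sqnorm_ge0 ip (P l g)) (parseval g).
apply: le_esum => l _; rewrite lee_fin ler_wpM2r ?sqnorm_ge0//.
by have /andP[] := B_bounds l.
Qed.

Lemma rank_one_rlinear v : rlinear (fun u => ip u v *: v).
Proof.
split=> [u w|a u]; first by rewrite linearDl scalerDl.
by rewrite linearZl_LR/= scalerA.
Qed.

Lemma rank_one_symmetric v : symmetric_op ip (fun u => ip u v *: v).
Proof.
move=> u w; rewrite [RHS]redotC /redot !linearZl_LR/= (ipC ip v w) (ipC ip v u).
by rewrite !Defs.ReM !Defs.ReJ !Defs.ImJ; ring.
Qed.

Let mulop_le u : rdot (mulop B u) u <= C2 * N u.
Proof.
rewrite -lee_fin (@redot_mulop _ C2) => [|l]; last first.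
  by have /andP[_ ->] := B_bounds l; rewrite ltW.
rewrite -(esumZ (ltW C2_gt0) (fun l => sqnorm_ge0 ip (P l u)) (parseval u)).
apply: le_esum => l _; rewrite lee_fin ler_wpM2r ?sqnorm_ge0//.
by have /andP[] := B_bounds l.
Qed.

Lemma multiplier_frame_operator :
  is_frame_operator ip (fun i : {j : J & K j} => f (tagged i)) (mulop B).
Proof.
move=> g; apply: (@psd_sum_cvg _ _ ip _
  (fun (i : {j : J & K j}) u => ip u (f (tagged i)) *: f (tagged i)) _ C2 g) => //.
- by move=> i; exact: rank_one_rlinear.
- by move=> i; exact: rank_one_symmetric.
- by move=> i u; rewrite rank_one_form sqr_ge0.
- exact: (mulop_rlinear B_norm).
- exact: (mulop_symmetric B_norm).
move=> u; rewrite (@redot_mulop _ C2) => [|l]; last first.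
  by have /andP[_ ->] := B_bounds l; rewrite ltW.
by rewrite -esum_tight; apply: eq_esum => i _; rewrite rank_one_form.
Qed.

(** The frame operator is the multiplier by B, and its inverse the multiplier
    by 1 / B. *)
Lemma multiplier_dual : is_canonical_dual ip
  (fun i : {j : J & K j} => f (tagged i)) (fun i => f' (tagged i)).
Proof.
exists (mulop B), (mulop (fun l => (B l)^-1)); split.
- exact: multiplier_frame_operator.
- move=> u; apply: proj_inj => l; rewrite (proj_mulop _ _ BV_norm) (proj_mulop _ _ B_norm).
  by rewrite scalerA -rmorphM/= mulVf ?scale1r ?gt_eqF.
- move=> u; apply: proj_inj => l; rewrite (proj_mulop _ _ B_norm) (proj_mulop _ _ BV_norm).
  by rewrite scalerA -rmorphM/= mulfV ?scale1r ?gt_eqF.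
- by move=> [j k]; apply: proj_inj => l /=; rewrite (proj_mulop _ _ BV_norm) f'_P.
Qed.

Let h j l := b j l ^+ 2 / B l.

Let h_ge0 j l : 0 <= h j l.
Proof. by rewrite divr_ge0 ?sqr_ge0// ltW. Qed.

Lemma h_sum l : \esum_(j in [set: J]) (h j l)%:E = (1 : R)%:E.
Proof.
have V0 : 0 <= (B l)^-1 by rewrite invr_ge0 ltW.
rewrite -[in RHS](@mulVf _ (B l)) ?gt_eqF//.
rewrite -(esumZ V0 (fun j => sqr_ge0 (b j l)) (B_sum l)).
by apply: eq_esum => j _; rewrite mulrC.
Qed.

Let h_deg j l : (d j < l)%N -> h j l = 0.
Proof. by move=> dl; rewrite /h b_deg// expr0n mul0r. Qed.

Let h_bandmul_sum u :
  \esum_(j in [set: J]) (rdot (bandmul (h j) (d j) u) u)%:E = (N u)%:E.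
Proof.
rewrite (esum_bandmul u h_ge0 h_deg h_sum) -parseval.
by apply: eq_esum => l _; rewrite mul1r.
Qed.

Lemma partition_of_unity l :
  summability.partial_sum (h ^~ l) @ summability.totally --> (1 : R).
Proof. by apply: esum_partial_sum_cvg => //; exact: h_sum. Qed.

(** The operators attached to the indices j are multipliers by b_j^2 / B, which are
    nonnegative and add up to 1: [psd_sum_cvg] applies with the identity as sum. *)
Lemma multiplier_reconstruction u :
  hsums_to ip (fun j => \sum_(k : K j) ip u (f k) *: f' k) u.
Proof.
rewrite (_ : (fun j => _) = (fun j => bandmul (h j) (d j) u)); last first.
  by apply/funext => j; rewrite f'_sum.
apply: (@psd_sum_cvg _ _ ip _ (fun j => bandmul (h j) (d j)) id 1 u) => //.
- by move=> j; exact: bandmul_rlinear.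
- by move=> j; exact: bandmul_symmetric.
- move=> j v; rewrite redot_bandmul sumr_ge0// => l _.
  by rewrite mulr_ge0 ?sqnorm_ge0// h_ge0.
- by move=> v; rewrite mul1r.
Qed.

Lemma multiplier_energy u :
  summability.partial_sum
    (fun j => \sum_(k : K j) (ip u (f' k))^*%C * ip u (f k))
  @ summability.totally --> ((N u)%:C%C : R[i]^o).
Proof.
have E j : \sum_(k : K j) (ip u (f' k))^*%C * ip u (f k) =
    (rdot (bandmul (h j) (d j) u) u)%:C%C.
  have -> : (rdot (bandmul (h j) (d j) u) u)%:C%C = ip (bandmul (h j) (d j) u) u.
    rewrite redot_bandmul (ip_suml ip) rmorph_sum/=; apply: eq_bigr => l _.
    have -> : ip ((h j l)%:C%C *: P l u) u = (h j l)%:C%C * ip (P l u) u by exact: linearZl_LR.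
    have -> : ip (P l u) u = (N (P l u))%:C%C by rewrite -ip_real -P_sym P_proj eqxx.
    exact: rmorphM.
  have -> : bandmul (h j) (d j) u = \sum_(k : K j) ip u (f k) *: f' k by rewrite f'_sum.
  rewrite (ip_suml ip); apply: eq_bigr => k _.
  by rewrite linearZl_LR/= mulrC (ipC ip (f' k)).
rewrite (_ : summability.partial_sum _ = fun A =>
    (summability.partial_sum (fun j => rdot (bandmul (h j) (d j) u) u) A)%:C%C); last first.
  apply/funext => A; rewrite !partial_sumE rmorph_sum.
  by apply: eq_bigr => j _; exact: E.
have : summability.partial_sum (fun j => rdot (bandmul (h j) (d j) u) u)
    @ summability.totally --> N u.
  apply: esum_partial_sum_cvg => // j; rewrite redot_bandmul sumr_ge0// => l _.
  by rewrite mulr_ge0 ?sqnorm_ge0// h_ge0.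
move=> /cvgrPdist_lt cv; apply/(@cvgrPdist_lt R[i] R[i]^o) => -[a c].
(* The order of R[i] compares only numbers with the same imaginary part, so that
   a positive e is real. *)
rewrite ltcE/= => /andP[/eqP c0 a0]; move: (cv a a0); apply: filterS => A /=.
by rewrite -rmorphB/= c0 normc_def/= expr0n addr0 sqrtr_sqr ltcR.
Qed.

End MultiplierFrames.
End Projections.

(** * Harmonic projections and needlets *)

Section L2Sums.
Context d (T : measurableType d) (R : realType) (mu : {measure set T -> \bar R}).

Lemma L2repr_sum (I : Type) (s : seq I) (u : I -> L2space mu) (f : I -> T -> R[i]) :
  (forall i, {ae mu, forall x, L2repr (u i) x = f i x}) ->
  {ae mu, forall x, L2repr (\sum_(i <- s) u i) x = \sum_(i <- s) f i x}.
Proof.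
move=> uf; elim: s => [|i s IH].
  by rewrite big_nil; apply: filterS (L2repr0 mu) => x; rewrite big_nil => <-.
rewrite big_cons; have h := L2reprD (u i) (\sum_(j <- s) u j).
near=> x; rewrite big_cons; have := near h x; rewrite /= => ->//.
by congr (_ + _); near: x.
Unshelve. all: by end_near. Qed.

Lemma L2repr_scale_class (a : R[i]) f (fi : sq_integrable mu f) :
  {ae mu, forall x, L2repr (a *: L2class fi) x = a * f x}.
Proof.
have h := L2reprZ a (L2class fi).
near=> x; have := near h x; rewrite /= => ->//; congr (_ * _); near: x.
exact: L2class_repr.
Unshelve. all: by end_near. Qed.

Lemma L2class_eq u f (fi : sq_integrable mu f) :
  {ae mu, forall x, L2repr u x = f x} -> u = L2class fi.
Proof.
move=> uf; apply: L2repr_inj; near=> x.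
have -> : L2repr u x = f x by near: x.
by apply/esym; near: x; exact: L2class_repr.
Unshelve. all: by end_near. Qed.

End L2Sums.

Section HarmonicProjections.
Context {R : realType}.
Local Notation sigma := (@surface_measure R).
Local Notation V := (L2space sigma).
Local Notation ip := (@L2dot _ _ _ sigma).
Local Notation rdot := (redot ip).
Local Notation N u := (rdot u u).

(** Orders are shifted by l, so that k ranges over 0, ..., 2 l. *)
Definition Yclass (l k : nat) : V := L2class (sphericalY_L2 l (k%:Z - l%:Z)).

Lemma abs_order (l : nat) (k : 'I_(2 * l).+1) : (`|(k%:Z - l%:Z)%R| <= l)%N.
Proof. by have := ltn_ord k; lia. Qed.

Lemma Yclass_ortho l l' (k : 'I_(2 * l).+1) (k' : 'I_(2 * l').+1) :
  ip (Yclass l k) (Yclass l' k') = ((l == l') && (k == k' :> nat))%:R.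
Proof.
rewrite L2dot_class sphericalY_ortho ?abs_order//; congr (nat_of_bool _)%:R.
have [E|//] := eqVneq l l'; subst l'; rewrite /= (inj_eq (addIr _)); exact: eqz_nat.
Qed.

Definition hproj l (u : V) : V := \sum_(k < (2 * l).+1) ip u (Yclass l k) *: Yclass l k.

Lemma hproj_lin l a u v : hproj l (a *: u + v) = a *: hproj l u + hproj l v.
Proof.
rewrite /hproj scaler_sumr -big_split; apply: eq_bigr => k _ /=.
by rewrite linearDl linearZl_LR/= scalerDl scalerA.
Qed.

Lemma hproj_sym l u v : ip (hproj l u) v = ip u (hproj l v).
Proof.
rewrite (ip_suml ip) (ip_sumr ip); apply: eq_bigr => k _.
by rewrite linearZl_LR linearZr_LR /= (ipC ip (Yclass l k) v) mulrC.
Qed.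

Lemma hproj_Yclass l l' (k : 'I_(2 * l').+1) :
  hproj l (Yclass l' k) = if l == l' then Yclass l' k else 0.
Proof.
have [E|ll] := eqVneq l l'.
  subst l'; rewrite /hproj (bigD1 k)//= Yclass_ortho !eqxx scale1r big1 ?addr0// => i ik.
  rewrite Yclass_ortho eqxx/= (_ : (k == i :> nat) = false) ?scale0r//.
  by apply/negbTE; rewrite eq_sym.
by rewrite /hproj big1// => i _; rewrite Yclass_ortho eq_sym (negbTE ll) scale0r.
Qed.

Lemma hproj_sum l (I : Type) (s : seq I) (F : I -> V) :
  hproj l (\sum_(i <- s) F i) = \sum_(i <- s) hproj l (F i).
Proof. exact: (proj_sum hproj_lin). Qed.

Lemma hproj_proj l k u : hproj l (hproj k u) = if l == k then hproj l u else 0.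
Proof.
rewrite {2}/hproj hproj_sum; have [->|lk] := eqVneq l k.
  by apply: eq_bigr => i _; rewrite (projZ hproj_lin) hproj_Yclass eqxx.
by rewrite big1// => i _; rewrite (projZ hproj_lin) hproj_Yclass (negbTE lk) scaler0.
Qed.

Definition bandlimited L u := \sum_(l < L) hproj l u = u.

Lemma bandlimited_widen L L' u : (L <= L')%N -> bandlimited L u -> bandlimited L' u.
Proof.
move=> LL uL; rewrite /bandlimited -(big_mkord xpredT (fun l => hproj l u)).
rewrite (big_cat_nat _ (n := L))//= big_mkord uL big_nat_cond big1 ?addr0//.
move=> l /andP[/andP[Ll _] _]; rewrite -uL hproj_sum big1// => k _.
by rewrite hproj_proj gtn_eqF// (leq_trans (ltn_ord k)).
Qed.

Lemma bandlimited_lin L a u v : bandlimited L u -> bandlimited L v -> bandlimited L (a *: u + v).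
Proof.
rewrite /bandlimited => uL vL; rewrite -[u in RHS]uL -[v in RHS]vL scaler_sumr -big_split.
by apply: eq_bigr => l _; exact: hproj_lin.
Qed.

Lemma bandlimited0 L : bandlimited L 0.
Proof. by apply: big1 => l _; exact: (proj0 hproj_lin). Qed.

Lemma bandlimitedZ L a u : bandlimited L u -> bandlimited L (a *: u).
Proof. by move=> /(bandlimited_lin a)/(_ (bandlimited0 L)); rewrite addr0. Qed.

Lemma bandlimited_sum L n (F : 'I_n -> V) :
  (forall i, bandlimited L (F i)) -> bandlimited L (\sum_(i < n) F i).
Proof.
move=> FL; apply: big_ind => //; first exact: bandlimited0.
by move=> u v uL vL; rewrite -[u]scale1r; exact: bandlimited_lin.
Qed.

Lemma bandlimited_Yclass L l (k : 'I_(2 * l).+1) : (l < L)%N -> bandlimited L (Yclass l k).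
Proof.
move=> lL; rewrite /bandlimited (bigD1 (Ordinal lL))//= hproj_Yclass eqxx.
rewrite big1 ?addr0// => i /negbTE il; rewrite hproj_Yclass.
by rewrite (_ : (i == l :> nat) = false)// -il.
Qed.

Lemma bandlimited_harmonic L f (fi : sq_integrable sigma f) :
  harmonic_sum L f -> bandlimited L.+1 (L2class fi).
Proof.
move=> [Y HY fE].
have HY' l : exists a : int -> R[i], (l <= L)%N -> Y l = fun x =>
    \sum_(k < (2 * l).+1) a (k%:Z - l%:Z) * sphericalY l (k%:Z - l%:Z) x.
  have [lL|] := leqP l L; last by exists (fun=> 0).
  by have [a aE] := HY l lL; exists a.
have [a aE] := choice HY'.
have <- : \sum_(l < L.+1) \sum_(k < (2 * l).+1) a l (k%:Z - l%:Z) *: Yclass l k = L2class fi.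
  apply: L2class_eq.
  have h := @L2repr_sum _ _ _ sigma 'I_L.+1 (index_enum _) _ _ (fun l : 'I_L.+1 =>
    @L2repr_sum _ _ _ sigma 'I_(2 * l).+1 (index_enum _) _ _ (fun k : 'I_(2 * l).+1 =>
      L2repr_scale_class (a l (k%:Z - l%:Z)) (sphericalY_L2 l (k%:Z - l%:Z)))).
  apply: filterS h => x ->; rewrite fE; apply: eq_bigr => l _.
  by rewrite aE// -ltnS ltn_ord.
apply: bandlimited_sum => l; apply: bandlimited_sum => k.
exact/bandlimitedZ/bandlimited_Yclass.
Qed.

Lemma sphpoly_bandlimited f : sphpoly f ->
  forall fi : sq_integrable sigma f, exists L, bandlimited L (L2class fi).
Proof.
elim=> [q n|f1 f2 t1 IH1 t2 IH2|a g tg IH] fi.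
- exists (size q + `|n|).+1; apply: bandlimited_harmonic.
  by apply: harmonic_sum_mono; rewrite leqW.
- have [L1 h1] := IH1 (sphpoly_L2 t1); have [L2 h2] := IH2 (sphpoly_L2 t2).
  exists (maxn L1 L2).
  have <- : 1 *: L2class (sphpoly_L2 t1) + L2class (sphpoly_L2 t2) = L2class fi.
    apply: L2class_eq; have e1 := L2class_repr (sphpoly_L2 t1).
    have e2 := L2class_repr (sphpoly_L2 t2); have e3 := L2reprD (1 *: L2class (sphpoly_L2 t1)) (L2class (sphpoly_L2 t2)).
    rewrite scale1r in e3 *.
    near=> x; have := near e3 x; rewrite /= => ->//.
    by congr (_ + _); near: x.
  apply: bandlimited_lin; [exact: bandlimited_widen (leq_maxl _ _) h1|exact: bandlimited_widen (leq_maxr _ _) h2].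
- have [L h] := IH (sphpoly_L2 tg); exists L.
  rewrite -(L2class_eq fi (L2repr_scale_class a (sphpoly_L2 tg))).
  exact: bandlimitedZ.
Unshelve. all: by end_near. Qed.

(** With Q the sum of the first L projections and Q p = p, the left-hand vector is
    (u - p) - Q (u - p), and subtracting a projection does not lengthen. *)
Lemma hproj_best L p u : bandlimited L p -> N (u - \sum_(l < L) hproj l u) <= N (u - p).
Proof.
move=> pL; have -> : u - \sum_(l < L) hproj l u = (u - p) - \sum_(l < L) hproj l (u - p).
  have -> : \sum_(l < L) hproj l (u - p) = \sum_(l < L) hproj l u - p.
    rewrite -[p in RHS]pL -sumrB; apply: eq_bigr => l _; exact: (projB hproj_lin).
  by rewrite opprB addrA subrK.
rewrite (sqnorm_tail hproj_sym hproj_proj) gerBl sumr_ge0// => l _; exact: sqnorm_ge0.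
Qed.

Lemma hproj_dense u (e : R) : 0 < e -> exists L, N (u - \sum_(l < L) hproj l u) < e.
Proof.
move=> e0; have [g tg ge] := sphpoly_dense (L2reprP u) e0.
have [L gL] := sphpoly_bandlimited tg (sphpoly_L2 tg); exists L.
apply: le_lt_trans (hproj_best u gL) _.
rewrite -lte_fin -(hnorm_sqr ip); apply: le_lt_trans ge.
rewrite (hnorm_sqB (f := L2repr u) (g := g))//.
- exact: aeW.
- exact: L2class_repr.
- by have [] := L2reprP u.
- by have [] := sphpoly_L2 tg.
Qed.

Lemma L2_redot_complete (s : nat -> V) :
  (forall e : R, 0 < e -> exists M, forall m n, (M <= m)%N -> (M <= n)%N ->
     N (s m - s n) < e) ->
  exists v, forall e : R, 0 < e -> exists M, forall n, (M <= n)%N -> N (s n - v) < e.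
Proof.
move=> cs; have [|v hv] := @L2_complete _ _ _ sigma s.
  by move=> e e0; have [M hM] := cs e e0; exists M => m n Mm Mn; rewrite hnorm_sqr hM.
by exists v => e e0; have [M hM] := hv e e0; exists M => n Mn; rewrite -(hnorm_sqr ip) hM.
Qed.

Definition zonal_class l (x0 : sphere R) : V :=
  \sum_(k < (2 * l).+1) (sphericalY l (k%:Z - l%:Z) x0)^*%C *: Yclass l k.

(** The addition theorem, read as an expansion in x of L_l (x . x0). *)
Lemma needletL2E w n x0 (r : R) : needletL2 w n x0 r =
  \sum_(l < n.+1) (Num.sqrt r * w l)%:C%C *: zonal_class l x0.
Proof.
apply/esym/L2class_eq.
have hz l : {ae sigma, forall x, L2repr (zonal_class l x0) x = (zonal l (dotS x x0))%:C%C}.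
  have h := @L2repr_sum _ _ _ sigma 'I_(2 * l).+1 (index_enum _) _ _ (fun k : 'I_(2 * l).+1 =>
    L2repr_scale_class (sphericalY l (k%:Z - l%:Z) x0)^*%C (sphericalY_L2 l (k%:Z - l%:Z))).
  apply: filterS h => x /= ->; rewrite zonal_addition.
  by apply: eq_bigr => k _; rewrite mulrC.
have hs l : {ae sigma, forall x, L2repr ((Num.sqrt r * w l)%:C%C *: zonal_class l x0) x =
    (Num.sqrt r * w l)%:C%C * (zonal l (dotS x x0))%:C%C}.
  have h := L2reprZ (Num.sqrt r * w l)%:C%C (zonal_class l x0).
  near=> x; have := near h x; rewrite /= => ->//; congr (_ * _).
  by near: x.
apply: filterS (@L2repr_sum _ _ _ sigma 'I_n.+1 (index_enum _) _ _ (fun l : 'I_n.+1 => hs l)) => x ->.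
rewrite /needlet mulr_sumr rmorph_sum; apply: eq_bigr => l _.
by rewrite mulrA [RHS]rmorphM.
Unshelve. all: by end_near. Qed.

Lemma ip_zonal_class u l x0 : ip u (zonal_class l x0) =
  \sum_(k < (2 * l).+1) sphericalY l (k%:Z - l%:Z) x0 * ip u (Yclass l k).
Proof.
by rewrite (ip_sumr ip); apply: eq_bigr => k _; rewrite linearZr_LR /= conjcK.
Qed.

Lemma hproj_zonal_class l l' x0 :
  hproj l (zonal_class l' x0) = if l == l' then zonal_class l' x0 else 0.
Proof.
rewrite hproj_sum; case: eqP => [->|/eqP/negbTE ll].
  by apply: eq_bigr => k _; rewrite (projZ hproj_lin) hproj_Yclass eqxx.
by rewrite big1// => k _; rewrite (projZ hproj_lin) hproj_Yclass ll scaler0.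
Qed.

Lemma hproj_needlet l w n x0 (r : R) : hproj l (needletL2 w n x0 r) =
  if (l <= n)%N then (Num.sqrt r * w l)%:C%C *: zonal_class l x0 else 0.
Proof.
rewrite needletL2E hproj_sum; case: leqP => ln.
  rewrite (bigD1 (Ordinal (ln : l < n.+1)%N))//= (projZ hproj_lin) hproj_zonal_class eqxx.
  rewrite big1 ?addr0// => k /negbTE kl; rewrite (projZ hproj_lin) hproj_zonal_class.
  by rewrite (_ : (l == k :> nat) = false) ?scaler0// eq_sym -kl.
rewrite big1// => k _; rewrite (projZ hproj_lin) hproj_zonal_class gtn_eqF ?scaler0//.
exact: leq_trans ln.
Qed.

Section Quadrature.
Context {K : finType}.
Variables (xi : K -> sphere R) (lam : K -> R) (n : nat).
Hypothesis quad : exact_quadrature xi lam (2 * n).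
Hypothesis lam_gt0 : forall k, 0 < lam k.

Lemma quadrature_Y l l' (m : 'I_(2 * l).+1) (m' : 'I_(2 * l').+1) :
  (l <= n)%N -> (l' <= n)%N ->
  \sum_k (lam k)%:C%C *
    (sphericalY l (m%:Z - l%:Z) (xi k) * (sphericalY l' (m'%:Z - l'%:Z) (xi k))^*%C) =
  ((l == l') && (m == m' :> nat))%:R.
Proof.
move=> ln ln'.
have lnn : (l + l' <= 2 * n)%N by lia.
have h := @sphericalY_prod R _ _ _ _ _ (abs_order m) (abs_order m') lnn.
rewrite -(quad h) -Yclass_ortho; exact/esym/L2dot_class.
Qed.

(** Expanding both zonal functions leaves the sampled products Y_lm conj Y_l'm',
    which the quadrature integrates exactly. *)
Lemma quadrature_zonal u l l' : (l <= n)%N -> (l' <= n)%N ->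
  \sum_k ((lam k)%:C%C * ip u (zonal_class l (xi k))) *: zonal_class l' (xi k) =
  if l == l' then hproj l u else 0.
Proof.
move=> ln ln'.
transitivity (\sum_(m' < (2 * l').+1) \sum_(m < (2 * l).+1)
    (ip u (Yclass l m) * ((l == l') && (m == m' :> nat))%:R) *: Yclass l' m').
  under eq_bigr do rewrite /zonal_class scaler_sumr.
  rewrite exchange_big/=; apply: eq_bigr => m' _.
  under eq_bigr do rewrite scalerA ip_zonal_class mulr_sumr mulr_suml scaler_suml.
  rewrite exchange_big/=; apply: eq_bigr => m _.
  rewrite -(quadrature_Y m m' ln ln') mulr_sumr scaler_suml; apply: eq_bigr => k _.
  by congr (_ *: _); ring.
case: eqP => [E|_]; last first.
  by apply: big1 => m' _; apply: big1 => m _; rewrite mulr0 scale0r.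
subst l'; apply: eq_bigr => m' _; rewrite (bigD1 m')//= eqxx mulr1 big1 ?addr0// => m /negbTE mm.
by rewrite (_ : (m == m' :> nat) = false) ?mulr0 ?scale0r.
Qed.

(** The square root of the weight occurs in both needlets, so that the sum over the
    nodes is the quadrature formula itself. *)
Lemma needlet_sum w w' u :
  \sum_k ip u (needletL2 w n (xi k) (lam k)) *: needletL2 w' n (xi k) (lam k) =
  \sum_(l < n.+1) (w l * w' l)%:C%C *: hproj l u.
Proof.
transitivity (\sum_(l < n.+1) \sum_(l' < n.+1) (w l * w' l')%:C%C *:
    if l == l' :> nat then hproj l u else 0); last first.
  apply: eq_bigr => l _; rewrite (bigD1 l)//= eqxx big1 ?addr0// => l' /negbTE ll.
  by rewrite (_ : (l == l' :> nat) = false) ?scaler0// eq_sym.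
under eq_bigr do rewrite !needletL2E (ip_sumr ip) scaler_suml.
rewrite exchange_big/=; apply: eq_bigr => l _.
under eq_bigr do rewrite scaler_sumr.
rewrite exchange_big/=; apply: eq_bigr => l' _.
rewrite -(quadrature_zonal u (leq_ord l) (leq_ord l')) scaler_sumr; apply: eq_bigr => k _.
rewrite (ip_realZr ip) !scalerA; congr (_ *: _).
have -> : (lam k)%:C%C = (Num.sqrt (lam k))%:C%C * (Num.sqrt (lam k))%:C%C.
  by rewrite -rmorphM -expr2 sqr_sqrtr// ltW.
have E (z s p q : R[i]) : s * p * z * (s * q) = p * q * (s * s * z) by ring.
by rewrite !(rmorphM (real_complex R)); exact: E.
Qed.

End Quadrature.
End HarmonicProjections.

Section WindowDegree.
Context {R : realType} {J : countType}.
Variables (b : J -> nat -> R) (C1 C2 : R).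
Hypothesis hsupp : forall j : J, finite_set [set l | b j l != 0].
Hypothesis C1_gt0 : 0 < C1.
Hypothesis hb : forall l : nat,
  (C1%:E <= \esum_(j in [set: J]) (`|b j l| ^+ 2)%:E <= C2%:E)%E.

Lemma window_sumE l : \esum_(j in [set: J]) (b j l ^+ 2)%:E = (window_sum b l)%:E.
Proof.
have E : \esum_(j in [set: J]) (`|b j l| ^+ 2)%:E = \esum_(j in [set: J]) (b j l ^+ 2)%:E.
  by apply: eq_esum => j _; rewrite real_normK ?num_real.
have /andP[_ h] := hb l; rewrite E in h.
rewrite /window_sum fineK// ge0_fin_numE; first exact: le_lt_trans h (ltry _).
by apply: esum_ge0 => j _; rewrite lee_fin sqr_ge0.
Qed.

Lemma window_sum_bounds l : C1 <= window_sum b l <= C2.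
Proof.
rewrite -!lee_fin -window_sumE; have := hb l.
by rewrite (eq_esum (b := fun j => (b j l ^+ 2)%:E))// => j _; rewrite real_normK ?num_real.
Qed.

(** Since the window sum is positive, b_j vanishes wherever its product with the
    synthesis window does. *)
Lemma window_deg j l : (window_degree b j < l)%N -> b j l = 0.
Proof.
have B0 : window_sum b l != 0.
  by have /andP[h _] := window_sum_bounds l; rewrite gt_eqF// (lt_le_trans C1_gt0).
have fin : finite_set [set l | reconstruction_window b j l != 0].
  apply: sub_finite_set (hsupp j) => i /=; apply: contraNN => /eqP bi.
  by rewrite /reconstruction_window bi mulr0.
apply: contraTeq => bl; rewrite -leqNgt; apply: leq_bigmax_seq => //.
rewrite in_fset_set// inE /= /reconstruction_window /synthesis_window.
by rewrite !mulf_neq0 ?invr_eq0.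
Qed.

End WindowDegree.

(** * The needlet frame *)

Theorem proposition1p5 (R : realType) (J : countType) (b : J -> nat -> R)
  (C1 C2 : R) (K : J -> finType)
  (xi : forall j : J, K j -> sphere R) (lam : forall j : J, K j -> R)
  (hsupp : forall j : J, finite_set [set l | b j l != 0])
  (hC1 : 0 < C1) (hC2 : 0 < C2)
  (hb : forall l : nat,
     (C1%:E <= \esum_(j in [set: J]) (`|b j l| ^+ 2)%:E <= C2%:E)%E)
  (hquad : forall j : J,
     exact_quadrature (xi j) (lam j) (2 * window_degree b j)%N)
  (hpos : forall (j : J) (k : K j), 0 < lam j k) :
  let psi (j : J) (k : K j) : L2space (@surface_measure R) :=
    needletL2 (b j) (window_degree b j) (xi j k) (lam j k) in
  let psit (j : J) (k : K j) : L2space (@surface_measure R) :=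
    needletL2 (synthesis_window b j) (window_degree b j) (xi j k) (lam j k) in
  let ip := @L2dot _ _ _ (@surface_measure R) in
  [/\ forall l : nat,
        summability.partial_sum (fun j => reconstruction_window b j l)
          @ summability.totally --> (1 : R),
      is_frame ip (fun i : {j : J & K j} => psi (tag i) (tagged i)) C1 C2,
      is_canonical_dual ip
        (fun i : {j : J & K j} => psi (tag i) (tagged i))
        (fun i : {j : J & K j} => psit (tag i) (tagged i)) &
      forall X : L2space (@surface_measure R),
        hsums_to ip (fun j => \sum_(k : K j) ip X (psi j k) *: psit j k) X /\
        summability.partial_sum
          (fun j => \sum_(k : K j) (ip X (psit j k))^*%C * ip X (psi j k))
          @ summability.totally --> ((hnorm ip X ^+ 2)%:C%C : R[i]^o)].
Proof.
move=> psi psit ip.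
have Bb := window_sum_bounds hb; have BE := window_sumE hb.
have bd := window_deg hsupp hC1 hb.
have fs j u : \sum_(k : K j) ip u (psi j k) *: psi j k =
    \sum_(l < (window_degree b j).+1) (b j l ^+ 2)%:C%C *: hproj l u.
  exact: (needlet_sum (hquad j) (hpos j)).
have fs' j u : \sum_(k : K j) ip u (psi j k) *: psit j k =
    \sum_(l < (window_degree b j).+1) (b j l ^+ 2 / window_sum b l)%:C%C *: hproj l u.
  rewrite /ip (needlet_sum (hquad j) (hpos j)); apply: eq_bigr => l _.
  by rewrite /synthesis_window mulrA -expr2.
have Pf l j (k : K j) : hproj l (psit j k) = (window_sum b l)^-1%:C%C *: hproj l (psi j k).
  rewrite !hproj_needlet; case: ifP => _; last by rewrite scaler0.
  by rewrite scalerA -rmorphM /synthesis_window; congr (_%:C%C *: _); ring.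
split.
- move=> l; rewrite (_ : (fun j => _) = (fun j => b j l ^+ 2 / window_sum b l)).
    exact: (partition_of_unity hC1 Bb BE).
  by apply/funext => j; rewrite /reconstruction_window /synthesis_window; ring.
- exact: (multiplier_frame hproj_sym hproj_proj hproj_dense hC1 Bb BE bd fs).
- exact: (multiplier_dual hproj_lin hproj_sym hproj_proj hproj_dense L2_redot_complete hC1 Bb BE bd fs Pf).
move=> X; split.
  exact: (multiplier_reconstruction hproj_lin hproj_sym hproj_proj hproj_dense hC1 Bb BE bd fs').
rewrite hnorm_sqr.
exact: (multiplier_energy hproj_sym hproj_proj hproj_dense hC1 Bb BE bd fs').
Qed.
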